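(* Let $K$ be a number field of degree $d=[K:\mathbb{Q}]$ and let $w_K$ be the number of roots of unity in $K$. Then: (i) $\dfrac{w_K}{\log 2}\leq C_K \leq \dfrac{w_K}{\log 2} + \dfrac{d}{\log M_K}$. (ii) If $K$ is totally real, or $K=\mathbb{Q}(\sqrt{-1})$, or $K=\mathbb{Q}(\sqrt{-3})$, then $C_K = \dfrac{w_K}{\log 2}$. Moreover, the equality $C_K=\frac{w_K}{\log 2}$ does not hold for every number field $K$, i.e. there exists a number field $K$ with $C_K\neq \frac{w_K}{\log 2}$.
   Context: Absolute values on a number field $K$ of degree $d$: for each nonzero prime ideal $\mathfrak p$ of the ring of integers $\mathcal O_K$, $|x|_{\mathfrak p}=N(\mathfrak p)^{-\mathrm{ord}_{\mathfrak p}(x)}$ for $x\in K^\times$ (and $|0|_{\mathfrak p}=0$), where $N(\mathfrak p)=[\mathcal O_K:\mathfrak p]$; for each field embedding $\sigma:K\to\mathbb{C}$, $|x|_\sigma=|\sigma(x)|$ (usual complex absolute value). Products $\prod_{\mathfrak p}$ and $\prod_\sigma$ run over all nonzero prime ideals of $\mathcal O_K$ and over all embeddings $K\to\mathbb{C}$ respectively (so a non-real embedding and its complex conjugate both appear). For $f=a_nx^n+\dots+a_0\in K[x]$ and such an absolute value $|\cdot|_v$, the Gauss norm is $|f|_v=\max_{0\le i\le n}|a_i|_v$, and the height $H(f)$ is defined by $H(f)^d=\prod_{\mathfrak p}|f|_{\mathfrak p}\prod_\sigma|f|_\sigma$ (this does not depend on the choice of number field containing the coefficients). $C_K$ is the infimum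 of the set of real constants $C$ for which there is a function $g(n)=o(n)$ such that every polynomial $f\in K[x]$ of degree $n$ all of whose roots lie in $K^\times$ satisfies $n-g(n)\le C\log H(f)$ (the infimum of the empty set being $\infty$). For $\alpha\in K$, let $M_K(\alpha)=\prod_{\mathfrak p}\max(1,|\alpha|_{\mathfrak p})\prod_\sigma\max(1,|\alpha|_\sigma)$; this equals the Mahler measure of $f^\alpha_{\mathbb Z}(x)^{[K:\mathbb{Q}(\alpha)]}$, where $f^\alpha_{\mathbb Z}$ is the minimal polynomial of $\alpha$ over $\mathbb{Z}$ (the Mahler measure of $a\prod_i(x-\alpha_i)\in\mathbb{C}[x]$ being $|a|\prod_i\max(1,|\alpha_i|)$). $M_K$ denotes the minimum of $\{M_K(\alpha):\alpha\in K,\ M_K(\alpha)>1\}$ (this minimum exists). *)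

(* Defs.v *)
From HB Require Import structures.
From mathcomp Require Export all_boot all_order all_algebra all_field finmap.
From mathcomp Require Export all_classical all_reals all_analysis.
From mathcomp Require Export complex.

Set Implicit Arguments.
Unset Strict Implicit.
Unset Printing Implicit Defensive.

Export Order.TTheory GRing.Theory Num.Theory.
Export numFieldNormedType.Exports.

Local Open Scope classical_set_scope.
Local Open Scope ring_scope.

(* A number field is a [K : fieldExtType rat], of degree [\dim {:K}] over the
   rationals; the complex numbers are [R[i]] for a [R : realType]. *)

Section RingOfIntegers.
Variable K : fieldExtType rat.
Implicit Types (I J P : set K) (x a b : K).

Definition OK : set K := [set x | integralOver (intr : int -> K) x].

Record is_ideal I : Prop := IsIdeal {
  ideal_sub : I `<=` OK;
  ideal_0 : I 0;
  ideal_D : forall x y, I x -> I y -> I (x + y);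
  ideal_M : forall a x, OK a -> I x -> I (a * x) }.

Record is_prime_ideal P : Prop := IsPrimeIdeal {
  prime_is_ideal : is_ideal P;
  prime_proper : ~ P 1;
  prime_M : forall a b, OK a -> OK b -> P (a * b) -> P a \/ P b }.

Definition nonzero_primes : set (set K) :=
  [set P | is_prime_ideal P /\ P != [set 0]].

Definition ideal_mul I J : set K :=
  [set x | exists2 s : seq (K * K), (forall u, u \in s -> I u.1 /\ J u.2)
                                  & x = \sum_(u <- s) u.1 * u.2].

Definition ideal_exp I n : set K := iter n (ideal_mul I) OK.

Definition ideal_coset I x : set K := [set y | I (y - x)].

(* The index [OK : I]; [fset_set] is the empty set on infinite sets, but the
   quotient is finite for every nonzero ideal. *)
Definition ideal_norm I : nat := #|` fset_set (ideal_coset I @` OK) |%fset.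

(* For a nonzero [a] in [OK]: the largest n such that [a] lies in P^n, that is,
   the exponent of P in the factorization of the ideal ([a]). *)
Definition ord_int P a : nat :=
  xget 0%N [set n | ideal_exp P n a /\
                    forall m, ideal_exp P m a -> (m <= n)%N].

(* For a nonzero [x] in [K]: ord_P(a) - ord_P(b) for any expression x = a / b
   with [a] and [b] in [OK] nonzero. *)
Definition ord_prime P x : int :=
  xget 0 [set m : int | exists a b,
    [/\ OK a /\ a != 0, OK b /\ b != 0, x = a / b
      & m = (ord_int P a)%:Z - (ord_int P b)%:Z]].

Definition num_roots_of_unity : nat :=
  #|` fset_set [set x : K | exists2 n, (0 < n)%N & n.-unity_root x] |%fset.

Definition splits_with_nonzero_roots (f : {poly K}) : Prop :=
  exists2 rs : seq K, 0 \notin rs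
                    & f = lead_coef f *: \prod_(r <- rs) ('X - r%:P).

Definition is_Q_adjoin_sqrt (m : int) : Prop :=
  exists2 x : K, x ^+ 2 = m%:~R & <<1; x>>%VS = {:K}%VS.

End RingOfIntegers.

Section Heights.
Variables (R : realType) (K : fieldExtType rat).
Implicit Types (P : set K) (x : K) (f : {poly K}) (s : K -> R[i]).

Definition abs_prime P x : R :=
  if x == 0 then 0 else (ideal_norm P)%:R ^ (- ord_prime P x).

Definition embeddings : set (K -> R[i]) :=
  [set s : K -> R[i] | exists t : {rmorphism K -> R[i]}, s = t].

Definition abs_emb s x : R := Normc.normc (s x).

(* Finitely supported products: only the factors different from 1 are
   multiplied. Below, almost all factors indexed by primes are equal to 1. *)
Definition prod_places (F : (K -> R) -> R) : R :=
  (\big[*%R/1]_(P \in @nonzero_primes K) F (abs_prime P)) *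
  (\big[*%R/1]_(s \in embeddings) F (abs_emb s)).

Definition gauss_norm f (v : K -> R) : R :=
  \big[Num.max/0]_(i < size f) v f`_i.

Definition height f : R :=
  prod_places (gauss_norm f) `^ (\dim {:K})%:R^-1.

Definition admissible_constants : set R :=
  [set C | exists2 g : nat -> R,
       g =o_\oo (fun n : nat => n%:R : R)
     & forall (n : nat) (f : {poly K}),
         size f = n.+1 -> splits_with_nonzero_roots f ->
         n%:R - g n <= C * ln (height f)].

Definition C_const : \bar R := ereal_inf (EFin @` admissible_constants).

Definition M_elt x : R := prod_places (fun v => Num.max 1 (v x)).

(* The minimum of the values M_elt x > 1; it is attained, so that the default
   value 0 is never used. *)
Definition M_const : R :=
  let S := [set m | exists2 x : K, m = M_elt x & 1 < m] in
  xget 0 [set m | S m /\ lbound S m].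

Definition totally_real : Prop :=
  forall s, embeddings s -> forall x, complex.Im (s x) = 0.

End Heights.

(* Main.v *)
(**
Let [w] be the number of roots of unity of [K] and let
[f = c * \prod_i ('X - r_i)] have degree [n].

Upper bound. At each embedding, evaluating [f] at the [w] roots of [z^w = -1]
bounds [|c|^w * \prod_i |r_i^w + 1|] by [((n + 1) |f|)^w]; at each prime,
Gauss's lemma bounds [|c|^w * \prod_i max(1, |r_i|)^w] by [|f|^w]. The factor
contributed by a root [r] to the product over all places is [2^d] when [r] is a
root of unity and at least [1] otherwise, being the norm of an integral ideal;
hence [n1 <= w / log 2 * log ((n + 1) H(f))] for the number [n1] of roots of
unity among the [r_i]. Landau's inequality and Gauss's lemma similarly give
[M_K^n2 <= ((n + 1) H(f))^d] for the remaining [n2 = n - n1] roots.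

Lower bound. If a monic integral [F] of degree [m] splits over [K] and has sum
of absolute values of coefficients at most [h], then [F^k] has height at most
[h^k], so [C_K >= m / log h]. Take [F = 'X^w - 1], and, for the strict
inequality over Q(sqrt(-2)), [F = ('X^2 - 1)^2 * ('X^2 + 2) = 'X^6 - 3 'X^2 + 2],
where [6 / log 6 > 2 / log 2].

Equality. If the factor of every nonzero [r] is at least [2^d], the first
argument covers all the roots. In the totally real case this is
[r^2 + 1 >= 2 |r|] together with the product formula. Over Q(i) and Q(sqrt(-3)),
[r^w + 1] splits into quadratic factors of norm at least [1] (after clearing
denominators) whose sum is bounded below by the parallelogram law; over Q(i) this
leaves the value [3], excluded because no ideal of Z[i] has norm [3].
*)

From HB Require Import structures.
Require Import Defs.
From mathcomp Require Import zify ring lra.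

Set Implicit Arguments.
Unset Strict Implicit.
Unset Printing Implicit Defensive.

Local Open Scope classical_set_scope.
Local Open Scope ring_scope.

(** * Indices of subgroups and integer lattices *)

(** The arithmetic of [K] rests on the index of one subgroup of [K] in another, handled through
    finite lists of representatives. The index of a principal ideal [(a)] in the ring of integers is
    computed twice. A determinant over Z[theta], for an integral primitive element theta, gives the
    product of the moduli of the conjugates of [a]; a chain of ideals with simple quotients gives a
    product of prime norms. Equating the two is the product formula. It removes the leading
    coefficient [c] from the height, and it turns [r^w + 1], once denominators are cleared, into the
    norm of an ideal. The points with [z^w = -1] are chosen because the product of their distances
    to [r] is [|r^w + 1|], which equals 2 at every embedding when [r] is a root of unity. For other
    roots this quantity may be close to 0 at some embeddings and only the global bound 1 survives;
    hence the separate argument for them and the extra term in the upper bound. The factors [n + 1]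
    cost a multiple of [log(n + 1)], absorbed by [g(n) = o(n)]. *)

Section SubgroupIndex.
Variable V : zmodType.
Implicit Types (A B C : set V) (s t : seq V).

Definition subgroup A := A 0 /\ forall x y, A x -> A y -> A (x - y).

Definition incongruent A B s :=
  [/\ uniq s, {in s, forall x, A x} & {in s &, forall x y, B (x - y) -> x = y}].

(** A complete list of representatives replaces the quotient group, so that no quotient type has to
    be built for each pair of sets; finiteness of the index is part of the assertion. *)
Definition has_index A B n :=
  exists s, [/\ incongruent A B s,
    forall x, A x -> exists2 y, y \in s & B (x - y) & size s = n].

Lemma subgroupN A x : subgroup A -> A x -> A (- x).
Proof. by move=> [A0 AB] Ax; rewrite -[- x]add0r; apply: AB. Qed.

Lemma subgroupD A x y : subgroup A -> A x -> A y -> A (x + y).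
Proof.
by move=> sA Ax Ay; rewrite -[y]opprK; apply: (sA.2) => //; apply: subgroupN.
Qed.

Lemma subgroupBC A x y : subgroup A -> A (x - y) -> A (y - x).
Proof. by move=> sA Axy; rewrite -opprB; apply: subgroupN. Qed.

Lemma incongruent_size A B n t :
  subgroup B -> has_index A B n -> incongruent A B t -> (size t <= n)%N.
Proof.
move=> sB [s [[us As Bs] cov <-]] [ut At Bt].
pose f x := xget 0 [set y | y \in s /\ B (x - y)].
have fP x : A x -> f x \in s /\ B (x - f x).
  move=> /cov[y ys Bxy]; have : [set y | y \in s /\ B (x - y)] (f x) by apply: xgetPex; exists y.
  by [].
rewrite -(size_map f t); apply: uniq_leq_size.
  rewrite map_inj_in_uniq // => x y xt yt fxy; apply: Bt => //.
  have [_ Bx] := fP x (At x xt); have [_ By] := fP y (At y yt).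
  have -> : x - y = (x - f x) - (y - f y) by rewrite fxy opprB addrA subrK.
  exact: sB.2.
by move=> _ /mapP[x xt ->]; have [] := fP x (At x xt).
Qed.

Lemma has_index_unique A B n m :
  subgroup B -> has_index A B n -> has_index A B m -> n = m.
Proof.
move=> sB iAn iAm; apply/eqP; rewrite eqn_leq; apply/andP; split.
  by case: (iAn) => s [ist _ <-]; apply: incongruent_size iAm ist.
by case: (iAm) => s [ist _ <-]; apply: incongruent_size iAn ist.
Qed.

(** A longest incongruent list meets every class, since otherwise an element of a missed class could
    be added to it. *)
Lemma has_index_bounded A B N : subgroup B ->
    (forall t, incongruent A B t -> (size t <= N)%N) ->
  exists2 n, has_index A B n & (n <= N)%N.
Proof.
move=> sB bd.
pose P := [pred n | `[< exists2 t, incongruent A B t & size t = n >]].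
have exP : exists n, P n by exists 0%N; apply/asboolP; exists [::].
have Pbd n : P n -> (n <= N)%N by move=> /asboolP[t /bd + <-].
case: (ex_maxnP exP Pbd) => n /[dup] /Pbd nN /asboolP[t [ut At Bt] tn] nmax.
exists n => //; exists t; split=> // x Ax.
apply: contrapT => H.
have nB y : y \in t -> ~ B (x - y) by move=> yt Bxy; apply: H; exists y.
have : P n.+1.
  apply/asboolP; exists (x :: t); last by rewrite /= tn.
  split.
  - rewrite /= ut andbT; apply/negP => xt; apply: (nB x xt).
    by rewrite subrr; case: sB.
  - by move=> y; rewrite inE => /predU1P[->|/At].
  - move=> y z; rewrite !inE => /predU1P[->|yt] /predU1P[->|zt] //.
    + by move=> /(nB z zt).
    + by move=> /(subgroupBC sB) /(nB y yt).
    + exact: Bt.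
by move=> /nmax; rewrite ltnn.
Qed.

Lemma has_index_gt0 A B n : subgroup A -> has_index A B n -> (0 < n)%N.
Proof. by move=> [A0 _] [s [_ /(_ 0 A0)[y ys _] <-]]; case: s ys. Qed.

Lemma has_index_refl A : subgroup A -> has_index A A 1.
Proof.
move=> sA; exists [:: 0]; split=> //.
  split=> // [x|x y]; rewrite !inE => /eqP -> //; first exact: sA.1.
  by move=> /eqP ->.
by move=> x Ax; exists 0; rewrite ?inE // subr0.
Qed.

Lemma has_index_trans A B C n m : subgroup A -> subgroup B -> subgroup C ->
  B `<=` A -> C `<=` B ->
  has_index A B n -> has_index B C m -> has_index A C (n * m).
Proof.
move=> sA sB sC BA CB [s [[us As Bs] covs <-]] [t [[ut Bt Ct] covt <-]].
have key x x' y y' : x \in s -> x' \in s -> y \in t -> y' \in t ->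
    B (x + y - (x' + y')) -> x = x'.
  move=> xs x's yt y't Bd; apply: Bs => //.
  have -> : x - x' = (x + y - (x' + y')) - (y - y').
    by rewrite opprD addrACA addrK.
  by apply: (sB.2) => //; apply: (sB.2); apply: Bt.
exists [seq x + y | x <- s, y <- t]; split; last by rewrite size_allpairs.
  split.
  - apply: allpairs_uniq => // -[x y] [x' y'] /allpairsP[[u v]/= [us' vt [-> ->]]].
    move=> /allpairsP[[u' v']/= [us'' vt' [-> ->]]] /= e.
    have e1 : u = u' by apply: (key u u' v v') => //; rewrite e subrr; apply: sB.1.
    by move: e; rewrite e1 => /addrI ->.
  - move=> _ /allpairsP[[x y]/= [xs yt ->]].
    by apply: subgroupD => //; [apply: As | apply: BA; apply: Bt].
  - move=> _ _ /allpairsP[[x y]/= [xs yt ->]] /allpairsP[[x' y']/= [x's y't ->]] Cd.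
    have e1 : x = x' by apply: (key x x' y y') => //; apply: CB.
    move: Cd; rewrite -e1 opprD addrACA subrr add0r => /Ct -> //.
move=> x Ax; have [y ys Bxy] := covs x Ax; have [z zt Cz] := covt _ Bxy.
by exists (y + z); [apply/allpairsP; exists (y, z) | rewrite opprD addrA].
Qed.

Lemma has_index_sub A B C n : subgroup B -> subgroup C ->
    B `<=` A -> C `<=` B -> has_index A C n ->
  exists m, has_index B C m.
Proof.
move=> sB sC BA CB iA.
have [|m im _] := @has_index_bounded B C n sC; last by exists m.
move=> t [ut Bt Ct]; apply: (incongruent_size sC iA); split=> // x xt.
by apply: BA; apply: Bt.
Qed.

Lemma has_index_sup A B C n : subgroup B -> subgroup C ->
    C `<=` B -> has_index A C n ->
  exists m, has_index A B m.
Proof.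
move=> sB sC CB iA.
have [|m im _] := @has_index_bounded A B n sB; last by exists m.
move=> t [ut At Bt]; apply: (incongruent_size sC iA); split=> // x y xt yt.
by move=> /CB; apply: Bt.
Qed.

Lemma has_index1 A B : subgroup A -> subgroup B -> has_index A B 1 -> A `<=` B.
Proof.
move=> [A0 _] sB [s [_ cov]]; case: s cov => [|y []] // cov _ x Ax.
have [_ /[!inE]/eqP -> Bxy] := cov x Ax; have [_ /[!inE]/eqP -> B0y] := cov 0 A0.
have -> : x = (x - y) - (0 - y) by rewrite sub0r opprK subrK.
exact: sB.2.
Qed.

Lemma incongruent_mkseq A B (f : nat -> V) n : subgroup B ->
    (forall i, (i < n)%N -> A (f i)) ->
    (forall i j, (i < j < n)%N -> ~ B (f i - f j)) ->
  incongruent A B (mkseq f n).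
Proof.
move=> sB Af Bf.
have fP i j : (i < n)%N -> (j < n)%N -> B (f i - f j) -> i = j.
  move=> ltin ltjn Bij; have [ij|ji|//] := ltngtP i j.
    by case: (Bf i j) => //; rewrite ij.
  by case: (Bf j i); rewrite ?ji //; apply: subgroupBC.
split.
- rewrite map_inj_in_uniq ?iota_uniq // => i j; rewrite !mem_iota !add0n /=.
  by move=> ltin ltjn e; apply: fP => //; rewrite e subrr; case: sB.
- by move=> _ /mapP[i + ->]; rewrite mem_iota => /Af.
- move=> _ _ /mapP[i + ->] /mapP[j + ->]; rewrite !mem_iota !add0n /=.
  by move=> ltin ltjn /fP ->.
Qed.

(** Adding [x] permutes the classes. In the sum of [y + x - f y] over the representatives, with
    [f y] the representative of [y + x], the terms [y] and [f y] cancel and [x *+ n] remains. For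
    [x = 1] this puts the norm of a prime into the prime. *)
Lemma has_index_mulrn A B n x : subgroup A -> subgroup B -> has_index A B n ->
  A x -> B (x *+ n).
Proof.
move=> sA sB [s [[us As Bs] cov <-]] Ax.
pose f y := xget 0 [set z | z \in s /\ B (y + x - z)].
have fP y : y \in s -> f y \in s /\ B (y + x - f y).
  move=> ys; have [z zs Bz] := cov _ (subgroupD sA (As y ys) Ax).
  have : [set z | z \in s /\ B (y + x - z)] (f y) by apply: xgetPex; exists z.
  by [].
have fs : perm_eq (map f s) s.
  have ufs : uniq (map f s).
    rewrite map_inj_in_uniq // => y z ys zs fyz; apply: Bs => //.
    have -> : y - z = (y + x - f y) - (z + x - f z).
      by rewrite fyz opprB addrA subrK opprD addrACA subrr addr0.
    by apply: (sB.2); [have [] := fP y ys | have [] := fP z zs].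
  have sub : {subset map f s <= s} by move=> _ /mapP[y /fP[fys _] ->].
  apply: uniq_perm => //.
  by have [|_ e] := uniq_min_size ufs sub; first by rewrite size_map.
have -> : x *+ size s = \sum_(y <- s) (y + x - f y).
  rewrite big_split /= big_split /= sumrN -[X in _ = _ - X](big_map f xpredT id).
  rewrite (perm_big _ fs) /= addrAC subrr add0r big_const_seq count_predT.
  by rewrite -Monoid.iteropE.
rewrite big_seq; elim/big_ind: _ => [|y z|y /fP[]] //; first by case: sB.
exact: subgroupD.
Qed.

End SubgroupIndex.

Lemma has_index_image (V W : zmodType) (f : {additive V -> W}) (A B : set V) n :
  injective f -> has_index A B n -> has_index (f @` A) (f @` B) n.
Proof.
move=> finj [s [[us As Bs] cov <-]]; exists (map f s); split; last by rewrite size_map.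
  split.
  - by rewrite map_inj_uniq.
  - by move=> _ /mapP[x xs ->]; exists x => //; apply: As.
  - move=> _ _ /mapP[x xs ->] /mapP[y ys ->] [z Bz].
    by rewrite -raddfB => /finj ez; congr (f _); apply: Bs => //; rewrite -ez.
move=> _ [x Ax <-]; have [y ys Bxy] := cov x Ax.
by exists (f y); [apply: map_f | exists (x - y) => //; rewrite raddfB].
Qed.

Section IntegerLattice.
Variable d : nat.

Definition row_lattice (M : 'M[int]_d) : set 'rV[int]_d := range (fun v => v *m M).

(** Induction on the number [k] of coordinates on which divisibility is imposed: one more coordinate
    multiplies the index by [|c_k|], with representatives the multiples of a basis vector by
    [0, ..., |c_k| - 1]. *)
Lemma has_index_diag (c : 'I_d -> int) k : (forall i, c i != 0) -> (k <= d)%N ->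
  has_index [set: 'rV[int]_d]
    [set v : 'rV[int]_d | forall i : 'I_d, (i < k)%N -> (c i %| v 0%R i)%Z]
    (\prod_(i < d | (i < k)%N) `|c i|%N).
Proof.
move=> c0; pose B k := [set v : 'rV[int]_d | forall i : 'I_d, (i < k)%N -> (c i %| v 0%R i)%Z].
rewrite -/(B k).
have sB j : subgroup (B j).
  split=> [i _ | x y Bx By i ij]; rewrite !mxE ?dvdz0 //.
  by apply: rpredB; [apply: Bx | apply: By].
elim: k => [_|k IH kd].
  rewrite big_pred0 //; have -> : B 0%N = setT by apply/seteqP.
  by apply: has_index_refl.
pose ko := Ordinal kd.
rewrite (bigD1 ko) //= mulnC.
rewrite (eq_bigl (fun i : 'I_d => (i < k)%N)); last first.
  by move=> i; rewrite ltnS -val_eqE /= ltn_neqAle andbC.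
apply: (has_index_trans _ (sB k) (sB k.+1)) => //.
- by move=> v Bv i ik; apply: Bv; apply: ltnW.
- exact: (IH (ltnW kd)).
pose e (m : nat) : 'rV[int]_d := m%:Z *: delta_mx 0 ko.
have eE m i : e m 0 i = m%:Z *+ (i == ko).
  by rewrite !mxE eqxx /= mulr_natr.
exists [seq e m | m <- iota 0 `|c ko|]; split; last by rewrite size_map size_iota.
  have einj m n : m \in iota 0 `|c ko| -> n \in iota 0 `|c ko| ->
      B k.+1 (e m - e n) -> m = n.
    rewrite !mem_iota !add0n /= => mc nc /(_ ko (ltnSn _)).
    rewrite mxE [X in _ + X]mxE !eE eqxx !mulr1n => H.
    have : (m%:Z == n%:Z %[mod c ko])%Z by rewrite eqz_mod_dvd.
    rewrite -(modz_abs m) -(modz_abs n) !modz_small ?ltz_nat //=.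
    by move=> /eqP[].
  split.
  - rewrite map_inj_in_uniq ?iota_uniq // => m n mi ni emn.
    by apply: einj => //; rewrite emn subrr; case: (sB k.+1).
  - move=> _ /mapP[m _ ->] i ik; rewrite eE.
    by rewrite (_ : i == ko = false) ?dvdz0 // -val_eqE /= ltn_eqF.
  - by move=> _ _ /mapP[m mi ->] /mapP[n ni ->] /einj ->.
move=> x Bx; exists (e `|(x 0%R ko %% c ko)%Z|%N).
  apply: map_f; rewrite mem_iota /= add0n.
  have := ltz_mod (x 0 ko) (c0 ko); have := modz_ge0 (x 0 ko) (c0 ko).
  lia.
move=> i; rewrite ltnS leq_eqVlt => /predU1P[ik|ik].
  have -> : i = ko by apply: val_inj.
  rewrite mxE [X in _ + X]mxE eE eqxx mulr1n gez0_abs ?modz_ge0 //.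
  by rewrite -eqz_mod_dvd modz_mod.
rewrite mxE [X in _ + X]mxE eE (_ : i == ko = false) ?subr0; first exact: Bx.
by rewrite -val_eqE /= ltn_eqF.
Qed.

(** In the Smith form [L D R] the invertible [L] only changes the generators of the row lattice, and
    [R] is an automorphism of the ambient lattice, so the index is that of the diagonal matrix
    [D]. *)
Lemma has_index_row_lattice (M : 'M[int]_d) : \det M != 0 ->
  has_index [set: 'rV[int]_d] (row_lattice M) `|\det M|%N.
Proof.
have [L uL [R uR [c _ ->]]] := int_Smith_normal_form M.
set D := \matrix_(i, j) _.
have detD : \det D = \prod_(i < d) c`_i.
  rewrite det_trig; last first.
    apply/is_trig_mxP => i j ij; rewrite mxE (_ : (i == j :> nat) = false) //.
    by rewrite ltn_eqF.
  by apply: eq_bigr => i _; rewrite mxE eqxx.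
have absU (U : 'M[int]_d) : U \in unitmx -> `|\det U|%N = 1%N.
  move=> uU; have := congr1 (absz \o determinant) (mulmxV uU).
  by rewrite /= det_mulmx det1 abszM => /eqP; rewrite muln_eq1 => /andP[/eqP].
rewrite !det_mulmx !abszM (absU _ uL) (absU _ uR) mul1n muln1 !mulf_eq0 !negb_or => /andP[/andP[_ D0] _].
have c0 i : i \in index_enum 'I_d -> c`_i != 0.
  by move=> _; move: D0; rewrite detD => /prodf_neq0; apply.
have -> : `|\det D|%N = (\prod_(i < d | (i < d)%N) `|(c`_i)%R|)%N.
  rewrite detD (big_morph absz abszM (erefl _)) big_mkcond [RHS]big_mkcond /=.
  by apply: eq_bigr => i _; rewrite ltn_ord.
have := @has_index_diag (fun i => c`_i) d (fun i => c0 i (mem_index_enum i)) (leqnn d).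
move=> /(has_index_image (f := (mulmxr R : {additive 'rV[int]_d -> 'rV[int]_d}))).
have Rinj : injective (mulmxr R : 'rV[int]_d -> _) by apply: can_inj (mulmxK uR).
move=> /(_ Rinj).
congr (has_index _ _ _).
  apply/seteqP; split=> // v _; exists (v *m invmx R) => //.
  by rewrite /= mulmxKV.
apply/seteqP; split=> [_ [v Bv <-]|_ [v _ <-]] /=.
  pose q : 'rV[int]_d := \row_i (v 0%R i %/ c`_i)%Z.
  have -> : v = q *m D.
    apply/rowP => j; rewrite mxE (bigD1 j) //= big1 => [|i ij].
      by rewrite !mxE eqxx addr0 mulr1n divzK // Bv.
    by rewrite !mxE (_ : (i == j :> nat) = false) ?mulr0 //; apply: negbTE.
  by exists (q *m invmx L) => //; rewrite !mulmxA mulmxKV.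
exists (v *m L *m D); last by rewrite !mulmxA.
move=> j _; rewrite mxE (bigD1 j) //= big1 => [|i ij].
  by rewrite [D _ _]mxE eqxx addr0 mulr1n dvdz_mull.
by rewrite [D _ _]mxE (_ : (i == j :> nat) = false) ?mulr0 //; apply: negbTE.
Qed.

End IntegerLattice.

(** * The ring of integers *)

Section Integers.
Variable K : fieldExtType rat.
Implicit Types (x y a b t : K) (I J P Q A B : set K).

Local Notation OK := (@OK K).
Let toK : {rmorphism int -> K} := intr.

Lemma OK_int (m : int) : OK (m%:~R : K).
Proof. exact: (integral_id toK m). Qed.

Lemma OK_nat (n : nat) : OK (n%:R : K).
Proof. exact: (OK_int n). Qed.

Lemma OK0 : OK (0 : K). Proof. exact: (OK_nat 0). Qed.

Lemma OK1 : OK (1 : K). Proof. exact: (OK_nat 1). Qed.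

Lemma OKD x y : OK x -> OK y -> OK (x + y).
Proof. exact: (@integral_add _ _ toK). Qed.

Lemma OKM x y : OK x -> OK y -> OK (x * y).
Proof. exact: (@integral_mul _ _ toK). Qed.

Lemma OKN x : OK x -> OK (- x).
Proof. exact: (@integral_opp _ _ toK). Qed.

Lemma OKB x y : OK x -> OK y -> OK (x - y).
Proof. exact: (@integral_sub _ _ toK). Qed.

Lemma OKX x n : OK x -> OK (x ^+ n).
Proof.
by move=> Ox; elim: n => [|n IH]; [apply: OK1 | rewrite exprS; apply: OKM].
Qed.

Lemma subgroup_OK : subgroup OK.
Proof. by split; [apply: OK0 | apply: OKB]. Qed.

Lemma ideal_N I x : is_ideal I -> I x -> I (- x).
Proof. by move=> iI Ix; rewrite -mulN1r; apply: (ideal_M iI) => //; apply: (OK_int (-1)). Qed.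

Lemma ideal_B I x y : is_ideal I -> I x -> I y -> I (x - y).
Proof. by move=> iI Ix Iy; apply: (ideal_D iI) => //; apply: ideal_N. Qed.

Lemma ideal_Mr I x a : is_ideal I -> I x -> OK a -> I (x * a).
Proof. by move=> iI Ix Oa; rewrite mulrC; apply: (ideal_M iI). Qed.

Lemma ideal_subgroup I : is_ideal I -> subgroup I.
Proof. by move=> iI; split; [apply: (ideal_0 iI) | move=> x y; apply: ideal_B]. Qed.

Definition principal a : set K := [set a * x | x in OK].

Lemma principal_self a : principal a a.
Proof. by exists 1; rewrite ?mulr1 //; apply: OK1. Qed.

Lemma principalM a x : OK x -> principal a (a * x).
Proof. by exists x. Qed.

Lemma principal_ideal a : OK a -> is_ideal (principal a).
Proof.
move=> Oa; split.
- by move=> _ [x Ox <-]; apply: OKM.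
- by exists 0; rewrite ?mulr0 //; apply: OK0.
- by move=> _ _ [x Ox <-] [y Oy <-]; exists (x + y); rewrite ?mulrDr //; apply: OKD.
- by move=> b _ Ob [x Ox <-]; exists (b * x); rewrite 1?mulrCA //; apply: OKM.
Qed.

Lemma principal_sub I a : is_ideal I -> I a -> principal a `<=` I.
Proof. by move=> iI Ia _ [x Ox <-]; apply: ideal_Mr. Qed.

Definition int_span (Y : seq K) : set K :=
  [set x | exists c : nat -> int, x = \sum_(i < size Y) Y`_i *~ c i].

Lemma int_spanD Y x y : int_span Y x -> int_span Y y -> int_span Y (x + y).
Proof.
move=> [c ->] [e ->]; exists (fun i => c i + e i).
by rewrite -big_split; apply: eq_bigr => i _; rewrite mulrzDr.
Qed.

Lemma int_spanZ Y x (m : int) : int_span Y x -> int_span Y (x *~ m).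
Proof.
move=> [c ->]; exists (fun i => c i * m).
rewrite (big_morph (fun z => z *~ m) (mulrzDl m) (mul0rz _ m)).
by apply: eq_bigr => i _; rewrite mulrzA.
Qed.

Lemma int_span_mem Y y : y \in Y -> int_span Y y.
Proof.
move=> yY; have lt := yY; rewrite -index_mem in lt.
exists (fun i => (i == index y Y)%:Z).
rewrite (bigD1 (Ordinal lt)) //= eqxx nth_index // mulr1z big1 ?addr0 // => i.
by rewrite -val_eqE /= => /negbTE ->; rewrite mulr0z.
Qed.

Lemma int_span_sub Y Z : {in Y, forall y, int_span Z y} -> int_span Y `<=` int_span Z.
Proof.
move=> YZ _ [c ->]; elim/big_ind: _ => [|x y|i _].
- by exists (fun=> 0); rewrite big1 // => i _; rewrite mulr0z.
- exact: int_spanD.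
- by apply: int_spanZ; apply: YZ; rewrite mem_nth.
Qed.

Definition fin_gen A := exists2 Y, {in Y, forall y, A y} & A `<=` int_span Y.

Lemma fin_gen_index A B n : B `<=` A -> fin_gen B -> has_index A B n -> fin_gen A.
Proof.
move=> BA [Y YB BY] [s [[_ sA _] cov _]]; exists (s ++ Y).
  by move=> y; rewrite mem_cat => /orP[/sA//|/YB/BA].
move=> x /cov[y ys Bxy]; rewrite -[x](subrK y); apply: int_spanD.
  apply: (int_span_sub _ (BY _ Bxy)) => z zY.
  by apply: int_span_mem; rewrite mem_cat zY orbT.
by apply: int_span_mem; rewrite mem_cat ys.
Qed.

(* The determinant trick: [t] is an eigenvalue of an integer matrix. *)
Lemma integral_of_stable (Y : seq K) t : has (fun y => y != 0) Y ->
  {in Y, forall y, int_span Y (t * y)} -> OK t.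
Proof.
move=> nzY stY.
pose n := size Y.
pose c := xget (fun _ _ => 0) [set c : 'I_n -> nat -> int |
   forall i : 'I_n, t * Y`_i = \sum_(j < n) Y`_j *~ c i j].
have cP (i : 'I_n) : t * Y`_i = \sum_(j < n) Y`_j *~ c i j.
  suff : [set c : 'I_n -> nat -> int |
     forall i : 'I_n, t * Y`_i = \sum_(j < n) Y`_j *~ c i j] c by apply.
  apply: xgetPex.
  have /choice[f fP] : forall i : 'I_n, exists g : nat -> int,
      t * Y`_i = \sum_(j < n) Y`_j *~ g j.
    by move=> j; have [g ->] := stY _ (mem_nth 0 (ltn_ord j)); exists g.
  by exists f.
pose M : 'M[int]_n := \matrix_(i, j) c j i.
pose v : 'rV[K]_n := \row_i Y`_i.
exists (char_poly M); first exact: char_poly_monic.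
rewrite -[map_poly _ _]/(map_poly toK _) map_char_poly -eigenvalue_root_char.
apply/eigenvalueP; exists v.
  apply/rowP => i; rewrite !mxE cP; apply: eq_bigr => j _.
  by rewrite !mxE mulrzr.
have /hasP[y yY y0] := nzY; have lt := yY; rewrite -index_mem in lt.
apply: contraNneq y0 => /rowP/(_ (Ordinal lt)); rewrite !mxE /= nth_index // => ->.
by [].
Qed.

(** The cosets of the representatives are pairwise distinct and exhaust all cosets, so the norm
    defined by counting cosets agrees with the index defined by lists. *)
Lemma ideal_norm_index I n : is_ideal I -> has_index OK I n -> ideal_norm I = n.
Proof.
move=> iI [s [[us sO sI] cov <-]].
have cosE x y : I (x - y) -> ideal_coset I x = ideal_coset I y.
  move=> Ixy; apply/seteqP; split=> z /= Iz.
    by have := ideal_D iI Iz Ixy; rewrite addrA subrK.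
  by have := ideal_B iI Iz Ixy; rewrite opprB addrA subrK.
pose F := [fset C in map (ideal_coset I) s]%fset.
have -> : ideal_norm I = #|` F|%fset.
  rewrite /ideal_norm (_ : _ @` _ = [set` F]) ?set_fsetK //.
  apply/seteqP; split=> [_ [x Ox <-]|C] /=; rewrite !inE /=.
    by have [y ys Ixy] := cov x Ox; rewrite (cosE _ _ Ixy) map_f.
  by move=> /mapP[x xs ->]; exists x => //; apply: sO.
rewrite card_fseq undup_id ?size_map // map_inj_in_uniq // => x y xs ys exy.
apply: sI => //; have : ideal_coset I x x by rewrite /ideal_coset /= subrr; apply: (ideal_0 iI).
by rewrite exy.
Qed.

Definition adjoin_ideal I g : set K := [set x + g * y | x in I & y in OK].

End Integers.

(** * Denominators and integral elements *)

Lemma common_denominator (I : finType) (q : I -> rat) :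
  exists2 m : int, m != 0 & forall i, exists z : int, m%:~R * q i = z%:~R.
Proof.
exists (\prod_i denq (q i)); first by apply/prodf_neq0 => i _; apply: denq_neq0.
move=> i; exists (numq (q i) * \prod_(j | j != i) denq (q j)).
rewrite (bigD1 i) //= !rmorphM /= numqE; ring.
Qed.

(** The integers are integrally closed: the monic equation is pulled back to the rationals and
    replayed in [algC], where rational algebraic integers are known to be integers. *)
Lemma rat_integral (C : numFieldType) (q : rat) :
  integralOver (intr : int -> C) (ratr q) -> exists z : int, q = z%:~R.
Proof.
move=> [p pm rp].
have rq : root (map_poly (intr : int -> rat) p) q.
  move: rp; rewrite /root.
  have -> : map_poly (intr : int -> C) p = map_poly ratr (map_poly (intr : int -> rat) p).
    by rewrite -map_poly_comp; apply: eq_map_poly => z /=; rewrite rmorph_int.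
  by rewrite horner_map fmorph_eq0.
have : (ratr q : algC) \is a Num.int.
  apply: Cint_rat_Aint; first exact: Crat_rat.
  apply: (@root_monic_Aint (map_poly ratr (map_poly (intr : int -> rat) p))).
  - by rewrite fmorph_root.
  - by apply: monic_map; apply: monic_map.
  - apply/polyOverP => i; rewrite !coef_map /= rmorph_int.
    exact: rpred_int.
move=> /intrP[z ez]; exists z; apply: (fmorph_inj (ratr : {rmorphism rat -> algC})).
by rewrite [RHS]rmorph_int; apply: ez.
Qed.

Section IntegralDet.
Variables (C : fieldType).
Let toC : {rmorphism int -> C} := intr.

Lemma integral_det n (M : 'M[C]_n) :
  (forall i j, integralOver (intr : int -> C) (M i j)) ->
  integralOver (intr : int -> C) (\det M).
Proof.
move=> iM; rewrite /determinant; elim/big_ind: _ => [|x y|s _].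
- exact: (integral_nat toC 0).
- exact: (@integral_add _ _ toC).
apply: (@integral_mul _ _ toC).
  case: (perm.odd_perm s); rewrite ?expr1 ?expr0; last exact: (integral_nat toC 1).
  by apply: (@integral_opp _ _ toC); apply: (integral_nat toC 1).
elim/big_ind: _ => [|x y|i _].
- exact: (integral_nat toC 1).
- exact: (@integral_mul _ _ toC).
- exact: iM.
Qed.

Lemma integral_sum (I : finType) (F : I -> C) :
  (forall i, integralOver (intr : int -> C) (F i)) ->
  integralOver (intr : int -> C) (\sum_i F i).
Proof.
move=> iF; elim/big_ind: _ => // [|x y]; first exact: (integral_nat toC 0).
exact: (@integral_add _ _ toC).
Qed.

End IntegralDet.

(** After factors [X] are removed, the equation of [z] reads [p(z) z + c = 0] with [c] nonzero, so
    [p(z)] is the cofactor and [- c] the integer. Only [p != 0] is kept of monicity, which suits the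
    induction. *)
Lemma integral_dvd_int (C : numFieldType) (z : C) : integralOver (intr : int -> C) z -> z != 0 ->
  exists y (e : int), [/\ integralOver (intr : int -> C) y, e != 0 & z * y = e%:~R].
Proof.
pose toC : {rmorphism int -> C} := intr.
move=> [p pm rp] z0; have iz : integralOver toC z by exists p.
have : p != 0 by apply: monic_neq0.
move: rp; rewrite -[map_poly _ _]/(map_poly toC p) {pm}.
elim/poly_ind: p => [|p c IH]; first by rewrite eqxx.
rewrite rmorphD rmorphM /= map_polyX map_polyC /= /root hornerD hornerM hornerX hornerC.
have [->|c0] := eqVneq c 0.
  rewrite rmorph0 addr0 mulf_eq0 (negbTE z0) orbF => rp pn0.
  by apply: IH => //; apply: contraNneq pn0 => ->; rewrite mul0r add0r polyC0.
rewrite addr_eq0 => /eqP e _; exists (map_poly toC p).[z], (- c); split.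
- apply: (@integral_horner _ _ toC) => //; apply/integral_poly => i.
  by rewrite coef_map; apply: integral_id.
- by rewrite oppr_eq0.
- by rewrite mulrC e rmorphN.
Qed.

(** * Complex embeddings and norms *)

Section Embeddings.
Variable K : fieldExtType rat.
Local Notation OK := (@OK K).
Local Notation d := (\dim {:K}).

Lemma intK_eq0 (m : int) : (m%:~R == 0 :> K) = (m == 0).
Proof. by rewrite -scaler_int scaler_eq0 oner_eq0 orbF intr_eq0. Qed.

Lemma intK_scale (m : int) (x : K) : m%:~R * x = m%:~R *: x.
Proof. by rewrite mulrzl scaler_int. Qed.

(** Multiplication by [x] has a rational matrix in a basis of [K]. For a common denominator [m] of
    its entries, [m x] preserves the group spanned by the basis, and the determinant trick
    applies. *)
Lemma int_multiple_OK (x : K) : exists2 m : int, m != 0 & OK (m%:~R * x).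
Proof.
pose Y := vbasis {:K}.
have YP y : y = \sum_(j < d) coord Y j y *: Y`_j.
  by apply: coord_vbasis; apply: memvf.
have [m m0 mP] := @common_denominator ('I_d * 'I_d)%type (fun u => coord Y u.2 (x * Y`_u.1)).
exists m => //; apply: (@integral_of_stable _ Y).
  apply: contraT => /hasPn Y0.
  have e1 := YP 1; have := oner_neq0 K; rewrite e1 big1 ?eqxx // => j _.
  have := Y0 Y`_j; rewrite negbK mem_nth ?size_tuple // => /(_ isT)/eqP ->.
  by rewrite scaler0.
move=> y yY; have lt := yY; rewrite -index_mem size_tuple in lt.
have [f fP] := choice (fun j => mP (Ordinal lt, j)).
exists (fun j => f (insubd (Ordinal lt) j)); rewrite size_tuple.
rewrite -mulrA -[in x * y](nth_index 0 yY) [x * _]YP mulr_sumr.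
apply: eq_bigr => j _; have -> : insubd (Ordinal lt) (j : nat) = j by apply: valKd.
by rewrite intK_scale scalerA (fP j) scaler_int.
Qed.

Lemma separable_num : separable 1%AS {:K}%AS.
Proof.
have c0 : [pchar K] =i pred0 by move=> p; rewrite pchar_lalg; apply: pchar_num.
by apply/separableP => y _; apply: pcharf0_separable.
Qed.

Lemma primitive_integral : exists2 th : K, OK th & <<1; th>>%VS = {:K}%VS.
Proof.
have sep : separable 1%AS {:K}%AS.
  exact: separable_num.
have gen := eq_adjoin_separable_generator sep (sub1v _).
set x := separable_generator _ _ in gen.
have [m m0 Om] := int_multiple_OK x; exists (m%:~R * x) => //.
apply/eqP; rewrite eqEsubv subvf /= gen -[X in (X <= _)%VS]/(<<1; x>>%VS).
apply/FadjoinP; split; first exact: sub1v.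
have {1}-> : x = (m%:~R)^-1 *: (m%:~R * x).
  by rewrite intK_scale scalerA mulVf ?scale1r // intr_eq0.
by apply: memvZ; apply: memv_adjoin.
Qed.

Variable C : numClosedFieldType.

Lemma emb_integral (s : {rmorphism K -> C}) (x : K) : OK x -> integralOver (intr : int -> C) (s x).
Proof.
move=> Ox; have [p pm rp] := integral_rmorph s Ox.
by exists p => //; congr (root _ _): rp; apply: eq_map_poly => z /=; rewrite rmorph_int.
Qed.

(** An integral primitive element [th] has a separable minimal polynomial of degree [d], and each of
    its [d] roots [z] in [C] gives an embedding sending [q(th)] to [q(z)]; this is well defined
    because the minimal polynomial divides the difference of two representatives. The four
    properties are the interface to the embeddings from here on. [C] is arbitrary: [algC] serves for
    pure arithmetic, [R[i]] for heights. *)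
Theorem embeddings_exist : exists (th : K) (sg : 'I_d -> {rmorphism K -> C}),
  [/\ OK th, forall x, exists c : 'rV[rat]_d, x = \sum_i c 0 i *: th ^+ i,
      injective (fun j => sg j th) & forall t : {rmorphism K -> C}, exists j, t =1 sg j].
Proof.
have [th Oth gen] := primitive_integral.
have dimE : adjoin_degree 1%AS th = d.
  by have := dim_Fadjoin 1%AS th; rewrite dimv1 muln1 gen => ->.
have polyE (q : {poly rat}) n : (size q <= n)%N ->
    (map_poly (in_alg K) q).[th] = \sum_(i < n) q`_i *: th ^+ i.
  move=> sq; rewrite (@horner_coef_wide _ n) ?size_map_poly //.
  by apply: eq_bigr => i _; rewrite coef_map /= -scalerAl mul1r.
have qP x : exists q : {poly rat}, (size q <= d)%N /\ x = (map_poly (in_alg K) q).[th].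
  have xF : x \in <<1; th>>%VS by rewrite gen memvf.
  have /polyOver1P[q eq] := Fadjoin_polyOver 1 th x.
  exists q; split; last by rewrite -eq Fadjoin_poly_eq.
  by rewrite -(size_map_poly (in_alg K)) -eq -dimE size_Fadjoin_poly.
have [q0 q0P] := choice qP.
have /polyOver1P[p0 ep0] := minPolyOver 1 th.
have p0m : p0 \is monic by rewrite -(map_monic (in_alg K)) -ep0 monic_minPoly.
have sp0 : size p0 = d.+1.
  by rewrite -(size_map_poly (in_alg K)) -ep0 size_minPoly dimE.
have p0dvd (q : {poly rat}) : (map_poly (in_alg K) q).[th] = 0 -> p0 %| q.
  move=> q0'; rewrite -(dvdp_map (in_alg K)) -ep0; apply: minPoly_dvdp.
    by apply/polyOver1P; exists q.
  exact/rootP.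
have p0sep : separable_poly p0.
  rewrite -(separable_map (in_alg K)) -ep0.
  have : separable_element 1%AS th.
    by have /separableP := separable_num; apply; apply: memvf.
  by [].
have [rs ers] := closed_field_poly_normal (map_poly (ratr : rat -> C) p0).
have p0C : map_poly (ratr : rat -> C) p0 = \prod_(z <- rs) ('X - z%:P).
  by rewrite {1}ers lead_coef_map (monicP p0m) rmorph1 scale1r.
have urs : uniq rs.
  by rewrite -separable_prod_XsubC -p0C separable_map.
have srs : size rs = d.
  have := congr1 (fun p : {poly C} => size p) p0C.
  by rewrite size_map_poly sp0 size_prod_XsubC => -[].
have ev_eq (q q' : {poly rat}) z : z \in rs ->
    (map_poly (in_alg K) q).[th] = (map_poly (in_alg K) q').[th] ->
    (map_poly (ratr : rat -> C) q).[z] = (map_poly ratr q').[z].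
  move=> zrs e; have /p0dvd/dvdpP[r er] : (map_poly (in_alg K) (q - q')).[th] = 0.
    by rewrite rmorphB /= hornerD hornerN e subrr.
  apply/eqP; rewrite -subr_eq0 -hornerN -hornerD -rmorphB /= er rmorphM /= hornerM.
  suff -> : (map_poly (ratr : rat -> C) p0).[z] = 0 by rewrite mulr0.
  by apply/rootP; rewrite p0C root_prod_XsubC.
have q0E x : (map_poly (in_alg K) (q0 x)).[th] = x by have [_ <-] := q0P x.
have morph z : z \in rs -> exists s : {rmorphism K -> C},
    forall q, s (map_poly (in_alg K) q).[th] = (map_poly (ratr : rat -> C) q).[z].
  move=> zrs; pose s (x : K) := (map_poly (ratr : rat -> C) (q0 x)).[z].
  have sB : zmod_morphism s.
    move=> x y; rewrite /s -hornerN -hornerD -rmorphB; apply: ev_eq => //.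
    by rewrite rmorphB /= hornerD hornerN !q0E.
  have sM : monoid_morphism s.
    split.
      have <- : (map_poly (ratr : rat -> C) 1).[z] = 1 by rewrite rmorph1 hornerC.
      by apply: ev_eq; rewrite // q0E rmorph1 hornerC.
    move=> x y; rewrite /s -hornerM -rmorphM; apply: ev_eq => //.
    by rewrite rmorphM /= hornerM !q0E.
  pose s1 := GRing.isZmodMorphism.Build K C s sB.
  pose s2 := GRing.isMonoidMorphism.Build K C s sM.
  pose t : {rmorphism K -> C} := HB.pack s s1 s2.
  by exists t => q; rewrite /= /s; apply: ev_eq; rewrite ?q0E.
have thE : (map_poly (in_alg K) 'X).[th] = th by rewrite map_polyX hornerX.
have morphj (j : 'I_d) : exists s : {rmorphism K -> C},
    forall q, s (map_poly (in_alg K) q).[th] = (map_poly (ratr : rat -> C) q).[rs`_j].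
  by apply: morph; rewrite mem_nth // srs.
have [sg sgP] := choice morphj.
have sgth j : sg j th = rs`_j by rewrite -{1}thE sgP map_polyX hornerX.
exists th, sg; split=> //.
- move=> x; exists (\row_i (q0 x)`_i); have [sq {1}->] := q0P x.
  by rewrite (polyE _ _ sq); apply: eq_bigr => i _; rewrite mxE.
- move=> i j; rewrite !sgth => /eqP; rewrite nth_uniq ?srs // => /eqP.
  exact: val_inj.
- move=> t.
  have tP (q : {poly rat}) : t (map_poly (in_alg K) q).[th] = (map_poly (ratr : rat -> C) q).[t th].
    rewrite -horner_map -map_poly_comp; congr (_.[_]); apply: eq_map_poly => r /=.
    by rewrite rmorphZ_num rmorph1 mulr1.
  have : t th \in rs.
    rewrite -root_prod_XsubC -p0C; apply/rootP; rewrite -tP -ep0.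
    by have /rootP -> := root_minPoly 1 th; rewrite rmorph0.
  move=> tr; have lt := tr; rewrite -index_mem srs in lt.
  exists (Ordinal lt) => x; rewrite -{1 2}(q0E x) tP sgP /= nth_index //.
Qed.

Section Lattice.
Variables (th : K) (sg : 'I_d -> {rmorphism K -> C}).
Hypothesis Oth : OK th.
Hypothesis coordP : forall x, exists c : 'rV[rat]_d, x = \sum_i c 0 i *: th ^+ i.
Hypothesis sg_inj : injective (fun j => sg j th).

Definition emb_mx : 'M[C]_d := \matrix_(i, j) sg j th ^+ i.

Lemma emb_mx_unit : emb_mx \in unitmx.
Proof.
have -> : emb_mx = Vandermonde d (\row_j sg j th) by apply/matrixP => i j; rewrite !mxE.
rewrite unitmxE unitfE det_Vandermonde; apply/prodf_neq0 => i _; apply/prodf_neq0 => j ij.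
rewrite !mxE subr_eq0; apply: contraTneq ij => /sg_inj ->.
by rewrite ltnn.
Qed.

Lemma emb_coords (c : 'rV[rat]_d) :
  \row_j sg j (\sum_i c 0 i *: th ^+ i) = map_mx ratr c *m emb_mx.
Proof.
apply/rowP => j; rewrite !mxE rmorph_sum /=; apply: eq_bigr => i _.
by rewrite !mxE rmorphZ_num rmorphXn.
Qed.

(** Integer coordinates in the power basis: the range is the order Z[[th]], where indices can be
    computed with integer matrices. *)
Definition lat (c : 'rV[int]_d) : K := \sum_(i < d) th ^+ i *~ c 0 i.

Lemma lat_is_additive : zmod_morphism lat.
Proof.
move=> x y; rewrite /lat -sumrB; apply: eq_bigr => i _.
by rewrite !mxE mulrzBr.
Qed.

HB.instance Definition _ := GRing.isZmodMorphism.Build 'rV[int]_d K lat lat_is_additive.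

Lemma latE c : lat c = \sum_(i < d) (map_mx (intr : int -> rat) c) 0 i *: th ^+ i.
Proof. by apply: eq_bigr => i _; rewrite mxE scaler_int. Qed.

Lemma emb_lat c : \row_j sg j (lat c) = map_mx (intr : int -> C) c *m emb_mx.
Proof.
rewrite latE emb_coords; congr (_ *m _); apply/rowP => i.
by rewrite !mxE rmorph_int.
Qed.

Lemma lat_inj : injective lat.
Proof.
move=> x y e; have := emb_lat x; rewrite e emb_lat => /(can_inj (mulmxK emb_mx_unit)) {}e.
apply/rowP => i; have := congr1 (fun M : 'rV[C]_d => M 0 i) e.
by rewrite !mxE => /eqP; rewrite eqr_int => /eqP.
Qed.

Definition lattice : set K := range lat.

Lemma lattice_OK : lattice `<=` OK.
Proof.
move=> _ [c _ <-]; rewrite /lat; elim/big_ind: _ => [|x y|i _].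
- exact: OK0.
- exact: OKD.
- by rewrite -mulrzr; apply: OKM; [apply: OKX | apply: OK_int].
Qed.

Lemma subgroup_lattice : subgroup lattice.
Proof.
split; first by exists 0; rewrite ?raddf0.
by move=> _ _ [x _ <-] [y _ <-]; exists (x - y); rewrite ?raddfB.
Qed.

Lemma lattice_pow (m : int) (i : 'I_d) : lattice (m%:~R * th ^+ i).
Proof.
exists (m *: \row_j (i == j)%:R) => //.
rewrite /lat (bigD1 i) //= big1 => [|j ji].
  by rewrite !mxE eqxx mulr1 addr0 mulrzl.
by rewrite !mxE eq_sym (negbTE ji) mulr0 mulr0z.
Qed.

(** Cramer's rule: the coordinates of [x] times the determinant of [emb_mx] are integral. A cofactor
    [y] turning the determinant into an integer [e] makes them rational as well as integral, hence
    integers. *)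
Lemma OK_lattice : exists2 e : int, e != 0 & forall x, OK x -> lattice (x *~ e).
Proof.
pose toC : {rmorphism int -> C} := intr.
have emb_int j x : OK x -> integralOver toC (sg j x) by apply: emb_integral.
have iV i j : integralOver toC (emb_mx i j).
  by rewrite mxE -rmorphXn; apply: emb_int; apply: OKX.
have idet : integralOver toC (\det emb_mx) by apply: integral_det.
have det0 : \det emb_mx != 0 by have := emb_mx_unit; rewrite unitmxE unitfE.
have [y [e [iy e0 ye]]] := integral_dvd_int idet det0.
exists e => // x Ox; have [c xc] := coordP x.
have intc i : exists z : int, c 0 i * e%:~R = z%:~R.
  apply: (@rat_integral C); rewrite rmorphM /= rmorph_int -ye mulrA.
  apply: (@integral_mul _ _ toC) => //.
  have -> : ratr (c 0 i) * \det emb_mx = ((\row_j sg j x) *m \adj emb_mx) 0 i.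
    by rewrite xc emb_coords -mulmxA mul_mx_adj mul_mx_scalar !mxE mulrC.
  rewrite mxE; apply: integral_sum => j; rewrite !mxE; apply: (@integral_mul _ _ toC).
    exact: emb_int.
  rewrite /cofactor; apply: (@integral_mul _ _ toC).
    have -> : (-1) ^+ (i + j) = toC ((-1) ^+ (i + j)) by rewrite rmorphXn rmorphN1.
    exact: integral_id.
  by apply: integral_det => k l; rewrite !mxE; have := iV (lift i k) (lift j l); rewrite mxE.
have [f fP] := choice intc.
exists (\row_i f i) => //; rewrite latE xc -scaler_int scaler_sumr.
apply: eq_bigr => i _; rewrite scalerA; congr (_ *: _).
by rewrite !mxE -fP mulrC.
Qed.

Definition scaled (a : K) (A : set K) : set K := (fun x => a * x) @` A.

Lemma has_index_scaled (a : K) A B n : a != 0 ->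
  has_index A B n -> has_index (scaled a A) (scaled a B) n.
Proof.
move=> a0; apply: (@has_index_image _ _ (GRing.mull_fun a idfun)).
exact: (mulfI a0).
Qed.

Lemma subgroup_scaled (a : K) A : subgroup A -> subgroup (scaled a A).
Proof.
move=> sA; split; first by exists 0; rewrite ?mulr0 //; apply: sA.1.
by move=> _ _ [x Ax <-] [y Ay <-]; exists (x - y); rewrite ?mulrBr //; apply: sA.2.
Qed.

(* The matrix of multiplication by [a] is conjugate to the diagonal of the
   conjugates of [a] by the Vandermonde matrix of the embeddings. *)
Lemma lattice_index (a : K) : a != 0 -> (forall i : 'I_d, lattice (a * th ^+ i)) ->
  scaled a lattice `<=` lattice /\
  exists n, has_index lattice (scaled a lattice) n /\ n%:R = \prod_j `|sg j a|.
Proof.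
move=> a0 aL.
have aL' (i : 'I_d) : exists c, a * th ^+ i = lat c by have [c _ <-] := aL i; exists c.
have [r rP] := choice aL'.
pose M : 'M[int]_d := \matrix_i r i.
have aM c : a * lat c = lat (c *m M).
  have -> : lat (c *m M) = \sum_i lat (r i) *~ c 0 i.
    rewrite mulmx_sum_row raddf_sum; apply: eq_bigr => i _.
    by rewrite rowK -{1}[c 0 i]intz scaler_int raddfMz.
  rewrite [X in a * X]/lat mulr_sumr; apply: eq_bigr => i _.
  by rewrite mulrzAr rP.
have sub : scaled a lattice = lat @` row_lattice M.
  apply/seteqP; split=> [_ [_ [c _ <-] <-]|_ [_ [c _ <-] <-]].
    by exists (c *m M); [exists c | rewrite aM].
  by exists (lat c); [exists c | rewrite aM].
have detM : (\det M)%:~R = \prod_j sg j a :> C.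
  pose D := diag_mx (\row_j sg j a).
  have e : map_mx (intr : int -> C) M *m emb_mx = emb_mx *m D.
    apply/row_matrixP => i; rewrite !row_mul -map_row rowK -emb_lat -rP.
    apply/rowP => j; rewrite !mxE (bigD1 j) //= big1 => [|k kj].
      by rewrite !mxE eqxx mulr1n addr0 rmorphM rmorphXn mulrC.
    by rewrite !mxE (negbTE kj) mulr0.
  have := congr1 (@determinant C d) e.
  rewrite !det_mulmx [RHS]mulrC det_map_mx => /mulIf -> //; last first.
    by have := emb_mx_unit; rewrite unitmxE unitfE.
  by rewrite det_diag; apply: eq_bigr => j _; rewrite mxE.
have det0 : \det M != 0.
  rewrite -(intr_eq0 C) detM; apply/prodf_neq0 => j _.
  by rewrite fmorph_eq0.
split; first by rewrite sub => _ [c _ <-]; exists c.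
exists `|\det M|%N; split.
  by rewrite sub; apply: (has_index_image lat_inj); apply: has_index_row_lattice.
by rewrite -normr_prod -detM -intr_norm -abszE.
Qed.

(** As [e] maps the ring of integers into the lattice, the ring sits between the lattice and its
    multiple by [1/e], in which the lattice has finite index by the determinant computation. *)
Lemma OK_lattice_index : exists k, has_index OK lattice k.
Proof.
have [e e0 eL] := OK_lattice.
have eK0 : (e%:~R : K) != 0 by rewrite intK_eq0.
have [eLL [n [iLn _]]] := lattice_index eK0 (lattice_pow e).
have : has_index (scaled e%:~R^-1 lattice) lattice n.
  have := has_index_scaled (invr_neq0 eK0) iLn.
  congr (has_index _ _ _); apply/seteqP; split.
    by move=> _ [_ [x Lx <-] <-]; rewrite mulKf.
  by move=> x Lx; exists (e%:~R * x); [exists x | rewrite mulKf].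
apply: has_index_sub; [exact: subgroup_OK | exact: subgroup_lattice | | exact: lattice_OK].
move=> x Ox; exists (x *~ e); first exact: eL.
by rewrite -[x *~ e]mulrzl mulKf.
Qed.

(** Write O for the ring of integers and [L] for the lattice. The index of [a L] in O factors both
    through [L] and through [a O]; the index of [a L] in [a O] equals that of [L] in O, and this
    common factor cancels. *)
Lemma stable_index (a : K) : OK a -> a != 0 -> (forall i : 'I_d, lattice (a * th ^+ i)) ->
  exists n, has_index OK (principal a) n /\ n%:R = \prod_j `|sg j a|.
Proof.
move=> Oa a0 aL; have [aLL [n [iLn en]]] := lattice_index a0 aL.
have [k iOk] := OK_lattice_index.
have sO := subgroup_OK K; have sL := subgroup_lattice.
have saL := subgroup_scaled a sL; have saO : subgroup (principal a) := subgroup_scaled a sO.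
have iOaL := has_index_trans sO sL saL lattice_OK aLL iOk iLn.
have aLaO : scaled a lattice `<=` principal a.
  by move=> _ [x Lx <-]; exists x => //; apply: lattice_OK.
have aOO : principal a `<=` OK by move=> _ [x Ox <-]; apply: OKM.
have [m im] := has_index_sup saO saL aLaO iOaL.
have := has_index_trans sO saO saL aOO aLaO im (has_index_scaled a0 iOk).
move=> /(has_index_unique saL iOaL) e.
have k0 := has_index_gt0 sO iOk.
exists m; split=> //; rewrite -en; congr (_%:R).
by apply/eqP; rewrite -(eqn_pmul2r k0) -e mulnC.
Qed.

Lemma lattice_denominator (a : K) :
  exists2 m : int, m != 0 & forall i : 'I_d, lattice (m%:~R * a * th ^+ i).
Proof.
have [f fP] := choice (fun i : 'I_d => coordP (a * th ^+ i)).
have [m m0 mP] := @common_denominator ('I_d * 'I_d)%type (fun u => f u.1 0 u.2).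
exists m => // i; have [g gP] := choice (fun j => mP (i, j)).
exists (\row_j g j) => //; rewrite latE -mulrA fP mulr_sumr; apply: eq_bigr => j _.
by rewrite !mxE -gP intK_scale scalerA.
Qed.

(** Stability of the lattice is arranged by an integer [m] such that [m a] preserves it: the index
    of [(m a)] is the product of those of [(a)] and [(m)], and the products of conjugates are
    multiplicative too. *)
Theorem norm_index (a : K) : OK a -> a != 0 ->
  exists n, has_index OK (principal a) n /\ n%:R = \prod_j `|sg j a|.
Proof.
move=> Oa a0; have [m m0 mL] := lattice_denominator a.
have mK0 : (m%:~R : K) != 0 by rewrite intK_eq0.
have Om := OK_int K m.
have b0 : m%:~R * a != 0 by apply: mulf_neq0.
have [nb [ib eb]] := stable_index (OKM Om Oa) b0 mL.
have [nm [im em]] := stable_index Om mK0 (lattice_pow m).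
have sO := subgroup_OK K.
have sp x : subgroup (principal x) := subgroup_scaled x sO.
have pba : principal (m%:~R * a) `<=` principal a.
  by move=> _ [x Ox <-]; exists (m%:~R * x); [apply: OKM | rewrite mulrA [a * _]mulrC].
have pO x : OK x -> principal x `<=` OK by move=> Ox _ [y Oy <-]; apply: OKM.
have [n ia] := has_index_sup (sp a) (sp _) pba ib.
have e2 : scaled a (principal m%:~R) = principal (m%:~R * a).
  apply/seteqP; split=> [_ [_ [x Ox <-] <-]|_ [x Ox <-]].
    by exists x => //; rewrite mulrA [a * _]mulrC.
  by exists (m%:~R * x); [exists x | rewrite mulrA [a * _]mulrC].
have iab : has_index (principal a) (principal (m%:~R * a)) nm.
  by rewrite -e2; apply: has_index_scaled.
have nbE : nb = (n * nm)%N.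
  apply: (has_index_unique (sp _) ib).
  by apply: (has_index_trans sO (sp a) (sp _) (pO _ Oa)).
exists n; split=> //.
have nm0 : nm%:R != 0 :> C by rewrite pnatr_eq0 -lt0n; apply: has_index_gt0 im.
apply: (mulIf nm0); rewrite -natrM -nbE eb em -big_split /=.
by apply: eq_bigr => j _; rewrite rmorphM normrM mulrC.
Qed.

(** Inverting the matrix of the embeddings bounds the integer coordinates of [x *~ e] in terms of
    [B], which leaves finitely many candidates. *)
Lemma bounded_integers (B : C) : (forall x : C, exists n : nat, `|x| <= n%:R) ->
  exists s : seq K, forall x, OK x -> (forall j, `|sg j x| <= B) -> x \in s.
Proof.
move=> archi; have [e e0 eL] := OK_lattice.
have eK0 : (e%:~R : K) != 0 by rewrite intK_eq0.
pose W := invmx emb_mx.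
have [N hN] := archi (`|e%:~R| * \sum_i \sum_j (`|B| * `|W j i|)).
(* Coordinates between [-N] and [N] are encoded by ordinals below [2 N + 1]; the division by [e]
   undoes the scaling into the lattice. *)
pose F (f : {ffun 'I_d -> 'I_(N + N).+1}) : K :=
  lat (\row_i ((f i)%:Z - N%:Z)) / e%:~R.
exists (codom F) => x Ox xB; have [c _ ec] := eL x Ox.
have cE : map_mx (intr : int -> C) c = (\row_j sg j (x *~ e)) *m W.
  by rewrite -ec emb_lat mulmxK // emb_mx_unit.
have cN (i : 'I_d) : (`|c 0%R i| <= N)%N.
  rewrite -(ler_nat C).
  have -> : (`|c 0%R i|%N)%:R = `|(c 0 i)%:~R| :> C by rewrite -intr_norm -abszE.
  have <- : (map_mx (intr : int -> C) c) 0 i = (c 0 i)%:~R by rewrite mxE.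
  have S0 : 0 <= `|e%:~R| * \sum_i \sum_j (`|B| * `|W j i|).
    apply: mulr_ge0 => //; apply: sumr_ge0 => k _; apply: sumr_ge0 => j _.
    exact: mulr_ge0.
  rewrite (ger0_norm S0) in hN; apply: le_trans hN.
  rewrite cE mxE mulr_sumr [leRHS](bigD1 i) //= ler_wpDr //.
    apply: sumr_ge0 => k _; apply: mulr_ge0 => //; apply: sumr_ge0 => j _.
    exact: mulr_ge0.
  apply: le_trans (ler_norm_sum _ _ _) _; rewrite mulr_sumr; apply: ler_sum => j _.
  rewrite mxE -mulrzl rmorphM rmorph_int !normrM -mulrA ler_wpM2l // ler_wpM2r //.
  by apply: le_trans (xB j) _; apply: real_ler_norm; apply: ger0_real; apply: le_trans (xB j).
apply/codomP; exists [ffun i => inord (absz (c 0 i + N%:Z))].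
rewrite /F; have -> : (\row_i (([ffun i => inord (absz (c 0 i + N%:Z))] i : 'I_(N + N).+1)%:Z - N%:Z)) = c.
  apply/rowP => i; rewrite mxE ffunE; move: (c 0 i) (cN i) => ci ciN.
  by rewrite inordK; lia.
by rewrite ec -mulrzr mulfK.
Qed.

End Lattice.
End Embeddings.

Lemma principal_index (K : fieldExtType rat) (a : K) : OK a -> a != 0 ->
  exists n, has_index (@OK K) (principal a) n.
Proof.
move=> Oa a0; have [th [sg [Oth cP inj _]]] := embeddings_exist K algC.
by have [n [iN _]] := norm_index Oth cP inj Oa a0; exists n.
Qed.

Lemma fin_gen_OK (K : fieldExtType rat) : fin_gen (@OK K).
Proof.
have [th [sg [Oth cP inj _]]] := embeddings_exist K algC.
have [k ik] := OK_lattice_index Oth cP inj.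
apply: (fin_gen_index (lattice_OK Oth) _ ik).
exists [seq th ^+ i | i <- iota 0 (\dim {:K})].
  move=> _ /mapP[i + ->]; rewrite mem_iota add0n => /= lti.
  by have := lattice_pow th 1 (Ordinal lti); rewrite mul1r.
move=> _ [c _ <-]; exists (fun i => if insub i is Some i' then c 0 i' else 0).
rewrite size_map size_iota; apply: eq_bigr => i _.
rewrite (nth_map 0%N) ?size_iota // nth_iota // add0n insubT // => lti.
by congr (_ *~ c 0 _); apply: val_inj.
Qed.

(** * Factorization of ideals *)

Section Dedekind.
Variable K : fieldExtType rat.
Local Notation OK := (@OK K).
Implicit Types (x y a b s t : K) (I J P Q A B : set K).

Lemma ideal_index I a : is_ideal I -> I a -> a != 0 -> exists n, has_index OK I n.
Proof.
move=> iI Ia a0; have Oa := ideal_sub iI Ia.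
have [n] := principal_index Oa a0.
apply: has_index_sup; [exact: ideal_subgroup | | exact: principal_sub].
by apply: ideal_subgroup; apply: principal_ideal.
Qed.

(** The ideal contains with finite index [(a)], a copy of the finitely generated ring of integers.
    It is thus a finitely generated group stable under [t], and the determinant trick applies. *)
Lemma ideal_integral I a t : is_ideal I -> I a -> a != 0 ->
  (forall x, I x -> I (t * x)) -> OK t.
Proof.
move=> iI Ia a0 tI; have Oa := ideal_sub iI Ia.
have [n ia] := principal_index Oa a0.
have [Y YO OY] := fin_gen_OK K.
have fa : fin_gen (principal a).
  exists (map (fun y => a * y) Y).
    by move=> _ /mapP[y yY ->]; apply: principalM; apply: YO.
  move=> _ [x /OY[c ->] <-]; exists c; rewrite size_map mulr_sumr.
  by apply: eq_bigr => i _; rewrite (nth_map 0) // mulrzAr.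
have sI := ideal_subgroup iI; have sa := ideal_subgroup (principal_ideal Oa).
have paI := principal_sub iI Ia.
have [m im] := has_index_sub sI sa (ideal_sub iI) paI ia.
have [Z ZI IZ] := fin_gen_index paI fa im.
apply: (@integral_of_stable _ Z); last by move=> y /ZI /tI /IZ.
apply: contraNT a0 => /hasPn Z0; have [c ->] := IZ _ Ia.
apply/eqP; apply: big1 => i _.
by have := Z0 _ (mem_nth 0 (ltn_ord i)); rewrite negbK => /eqP ->; rewrite mul0rz.
Qed.

Lemma adjoin_is_ideal I g : is_ideal I -> OK g -> is_ideal (adjoin_ideal I g).
Proof.
move=> iI Og; split.
- move=> _ [x Ix [y Oy <-]]; apply: OKD; first exact: (ideal_sub iI).
  exact: OKM.
- by exists 0; [apply: (ideal_0 iI) | exists 0; [apply: OK0 | rewrite mulr0 addr0]].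
- move=> _ _ [x Ix [y Oy <-]] [x' Ix' [y' Oy' <-]].
  exists (x + x'); first exact: (ideal_D iI).
  by exists (y + y'); [apply: OKD | rewrite mulrDr addrACA].
- move=> a _ Oa [x Ix [y Oy <-]]; exists (a * x); first exact: (ideal_M iI).
  by exists (a * y); [apply: OKM | rewrite mulrDr [a * (g * y)]mulrCA].
Qed.

Lemma adjoin_sub I g : I `<=` adjoin_ideal I g.
Proof. by move=> x Ix; exists x => //; exists 0; [apply: OK0 | rewrite mulr0 addr0]. Qed.

Lemma adjoin_mem I g : is_ideal I -> adjoin_ideal I g g.
Proof.
by move=> iI; exists 0; [apply: (ideal_0 iI) | exists 1; [apply: OK1 | rewrite mulr1 add0r]].
Qed.

(* Minimality of the index of [I] in [I + (g)] makes [(g)] simple modulo [I],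
   within the class of generators satisfying [G]. *)
Lemma adjoin_minimal I a (G : set K) g0 : is_ideal I -> I a -> a != 0 ->
    G `<=` OK -> G g0 ->
  exists2 g, G g & forall x, OK x -> G (x * g) ->
    exists2 y, OK y & I ((1 - x * y) * g).
Proof.
move=> iI Ia a0 GO Gg0; have sI := ideal_subgroup iI.
have [N iN] := ideal_index iI Ia a0.
have fin g : G g -> exists n, has_index (adjoin_ideal I g) I n.
  move=> /GO Og; have iJ := adjoin_is_ideal iI Og.
  by apply: has_index_sub iN; rewrite //; [apply: ideal_subgroup | apply: (ideal_sub iJ) | apply: adjoin_sub].
pose p := [pred n | `[< exists2 g, G g & has_index (adjoin_ideal I g) I n >]].
have exp : exists n, p n.
  by have [n ig] := fin _ Gg0; exists n; apply/asboolP; exists g0.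
case: (ex_minnP exp) => n /asboolP[g Gg ig] nmin; exists g => // x Ox Gxg.
have [k ik] := fin _ Gxg.
have nk : (n <= k)%N by apply: nmin; apply/asboolP; exists (x * g).
have iJ := adjoin_is_ideal iI (GO _ Gg); have iJ' := adjoin_is_ideal iI (GO _ Gxg).
have sJJ : adjoin_ideal I (x * g) `<=` adjoin_ideal I g.
  move=> _ [z Iz [y Oy <-]]; exists z => //; exists (x * y); first exact: OKM.
  by rewrite mulrCA mulrA.
have sJ := ideal_subgroup iJ; have sJ' := ideal_subgroup iJ'.
have [m im] : exists m, has_index (adjoin_ideal I g) (adjoin_ideal I (x * g)) m.
  by apply: has_index_sup ig => //; apply: adjoin_sub.
have nE : n = (m * k)%N.
  by apply: (has_index_unique sI ig); apply: (has_index_trans sJ sJ') => //; apply: adjoin_sub.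
have k0 := has_index_gt0 sJ' ik; have m0 := has_index_gt0 sJ im.
(* [n = m k] and the minimality [n <= k] leave only [m = 1], so [g] already lies in [I + (x g)]. *)
have m1 : m = 1%N by nia.
rewrite m1 in im.
have [z Iz [y Oy e]] := has_index1 sJ sJ' im (adjoin_mem g iI).
exists y => //; rewrite mulrBl mul1r -{1}e mulrAC addrK.
by [].
Qed.

Section Prime.
Variable P : set K.
Hypothesis nzP : nonzero_primes P.

Let pP : is_prime_ideal P := proj1 nzP.
Let iP : is_ideal P := prime_is_ideal pP.

Lemma prime_nonzero : exists2 a, P a & a != 0.
Proof.
have [_ P0] := nzP; apply: contrapT => H; move/negP: P0; apply; apply/eqP.
apply/seteqP; split=> [x Px|_ ->]; last exact: (ideal_0 iP).
by apply/eqP; apply: contrapT => /negP x0; apply: H; exists x.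
Qed.

Lemma prime_index : has_index OK P (ideal_norm P).
Proof.
have [a Pa a0] := prime_nonzero; have [n inn] := ideal_index iP Pa a0.
by rewrite (ideal_norm_index iP inn).
Qed.

Lemma prime_notM a b : OK a -> OK b -> ~ P a -> ~ P b -> ~ P (a * b).
Proof. by move=> Oa Ob nPa nPb /(prime_M pP Oa Ob)[]. Qed.

Lemma prime_notX a n : OK a -> ~ P a -> ~ P (a ^+ n).
Proof.
move=> Oa nPa; elim: n => [|n IH]; first by rewrite expr0; apply: prime_proper.
by rewrite exprS; apply: prime_notM => //; apply: OKX.
Qed.

Lemma prime_not1B a : P a -> ~ P (1 - a).
Proof. by move=> Pa /(ideal_D iP)/(_ Pa); rewrite subrK; apply: prime_proper. Qed.

(** A finite domain is a field: two powers [a^i] and [a^j] with [i < j] agree modulo [P], and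
    cancelling [a^i] shows [a^(j - i - 1)] to be an inverse of [a]. *)
Lemma prime_maximal a : OK a -> ~ P a -> exists2 b, OK b & P (1 - a * b).
Proof.
move=> Oa nPa; apply: contrapT => H.
have := @incongruent_mkseq _ OK P (fun i => a ^+ i) (ideal_norm P).+1 (ideal_subgroup iP).
move=> /(_ (fun i _ => OKX i Oa)) inc.
suff /inc/(incongruent_size (ideal_subgroup iP) prime_index) :
    forall i j, (i < j < (ideal_norm P).+1)%N -> ~ P (a ^+ i - a ^+ j).
  by rewrite size_mkseq ltnn.
move=> i j /andP[ij _].
rewrite -{1}(subnKC ij) addSnnS exprD -{1}[a ^+ i]mulr1 -mulrBr.
apply: prime_notM; [exact: OKX | | exact: prime_notX |].
  by apply: OKB; [apply: OK1 | apply: OKX].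
by move=> P1; apply: H; exists (a ^+ (j - i.+1)); [apply: OKX | rewrite -exprS].
Qed.

(** The inverse of [P] is larger than the ring of integers. [G] collects the [g] that stay nonzero
    in the localization at [P] of the quotient by [(a)]; for a minimal such [g], every [x] in [P]
    has [x g] killed by some [s] outside [P]. Finitely many classes modulo [(a)] allow a common [s],
    and [t = s g / a]. *)
Lemma prime_colon : exists t, [/\ ~ OK t & forall x, P x -> OK (t * x)].
Proof.
have [a Pa a0] := prime_nonzero; have Oa := ideal_sub iP Pa.
have ia := principal_ideal Oa; have paP := principal_sub iP Pa.
pose G := [set g | OK g /\ forall s, OK s -> ~ P s -> ~ principal a (s * g)].
have G1 : G 1.
  by split; [apply: OK1 | move=> s Os nPs; rewrite mulr1 => /paP].
have [|g [Og Gg] gmin] := adjoin_minimal ia (principal_self a) a0 _ G1.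
  by move=> g [].
have killx x : P x -> exists s, [/\ OK s, ~ P s & principal a (s * (x * g))].
  move=> Px; have Ox := ideal_sub iP Px; apply: contrapT => H.
  have [|y Oy Iy] := gmin x Ox.
    by split; [apply: OKM | move=> s Os nPs ps; apply: H; exists s].
  apply: (Gg (1 - x * y)) Iy; first by apply: OKB; [apply: OK1 | apply: OKM].
  by apply: prime_not1B; apply: ideal_Mr.
have [n [r [_ cov _]]] := principal_index Oa a0.
have [s [Os nPs sk]] : exists s, [/\ OK s, ~ P s &
    {in r, forall x, P x -> principal a (s * (x * g))}].
  elim: r {cov} => [|x r [s [Os nPs sk]]].
    by exists 1; split=> //; [apply: OK1 | apply: (prime_proper pP)].
  have [Px|nPx] := pselect (P x); last first.
    by exists s; split=> // y; rewrite inE => /predU1P[->|/sk].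
  have [s' [Os' nPs' sk']] := killx x Px.
  exists (s * s'); split; [exact: OKM | exact: prime_notM |].
  move=> y; rewrite inE => /predU1P[->|yr] Py.
    by rewrite -mulrA; apply: (ideal_M ia).
  by rewrite mulrAC; apply: ideal_Mr => //; apply: sk.
exists (s * g / a); split=> [Ot|x Px].
  by apply: (Gg s) => //; exists (s * g / a) => //; rewrite mulrC divfK.
have Ox := ideal_sub iP Px.
have [y yr pxy] := cov x Ox.
have Py : P y by rewrite -[y](subKr x); apply: ideal_B => //; apply: paP.
have : principal a (s * (x * g)).
  rewrite -[x](subrK y) mulrDl mulrDr; apply: (ideal_D ia); last exact: sk.
  by apply: (ideal_M ia) => //; apply: ideal_Mr.
move=> [z Oz ez]; have -> : s * g / a * x = z; last by [].
by apply: (mulfI a0); rewrite ez; field.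
Qed.

(** If [t P] were contained in [P], then [t] would be integral; so [t pi] is outside [P] for some
    [pi] in [P]. With [c] an inverse of [t pi] modulo [P], the element [u = t pi c] satisfies
    [u x = pi (c t x)]: locally, [pi] generates [P]. *)
Lemma prime_uniformizer : exists pi u, [/\ P pi, pi != 0, OK u, ~ P u &
  forall x, P x -> exists2 y, OK y & u * x = pi * y].
Proof.
have [a Pa a0] := prime_nonzero; have [t [nOt tP]] := prime_colon.
have [pi Ppi ntpi] : exists2 pi, P pi & ~ P (t * pi).
  apply: contrapT => H; apply: nOt; apply: (ideal_integral iP Pa a0) => x Px.
  by apply: contrapT => nPx; apply: H; exists x.
have [c Oc Pc] := prime_maximal (tP _ Ppi) ntpi.
exists pi, (t * pi * c); split=> //.
- by apply: contra_notN ntpi => /eqP ->; rewrite mulr0; apply: (ideal_0 iP).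
- by apply: OKM => //; apply: tP.
- by move=> Pu; apply: (prime_not1B Pu).
- move=> x Px; exists (c * (t * x)); first by apply: OKM => //; apply: tP.
  by ring.
Qed.

Lemma ideal_mul_ideal I J : is_ideal I -> is_ideal J -> is_ideal (ideal_mul I J).
Proof.
move=> iI iJ; split.
- move=> _ [r rIJ ->]; rewrite big_seq; elim/big_ind: _ => [|x y|u /rIJ[Iu Ju]].
  + exact: OK0.
  + exact: OKD.
  + by apply: OKM; [apply: (ideal_sub iI) | apply: (ideal_sub iJ)].
- by exists [::] => //; rewrite big_nil.
- move=> _ _ [r rIJ ->] [r' rIJ' ->]; exists (r ++ r'); last by rewrite big_cat.
  by move=> u; rewrite mem_cat => /orP[/rIJ|/rIJ'].
- move=> a _ Oa [r rIJ ->]; exists [seq (a * u.1, u.2) | u <- r].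
    by move=> _ /mapP[u /rIJ[Iu Ju] ->]; split=> //; apply: (ideal_M iI).
  by rewrite big_map mulr_sumr; apply: eq_bigr => u _; rewrite /= mulrA.
Qed.

Lemma ideal_mul_mem I J x y : I x -> J y -> ideal_mul I J (x * y).
Proof.
by move=> Ix Jy; exists [:: (x, y)]; [move=> u; rewrite inE => /eqP -> | rewrite big_seq1].
Qed.

Lemma is_ideal_OK : is_ideal OK.
Proof. by split=> //; [apply: OK0 | apply: OKD | apply: OKM]. Qed.

Lemma ideal_exp_ideal n : is_ideal (ideal_exp P n).
Proof. by elim: n => [|n IH]; [apply: is_ideal_OK | apply: ideal_mul_ideal]. Qed.

Lemma ideal_exp_self n x : P x -> ideal_exp P n (x ^+ n).
Proof.
by move=> Px; elim: n => [|n IH]; [apply: OK1 | rewrite exprS; apply: ideal_mul_mem].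
Qed.

Section Local.
Variables pi u : K.
Hypotheses (Ppi : P pi) (pi0 : pi != 0) (Ou : OK u) (nPu : ~ P u).
Hypothesis upi : forall x, P x -> exists2 y, OK y & u * x = pi * y.

Let Opi : OK pi := ideal_sub iP Ppi.

(** Membership in [pi^n] times the local ring at [P], written without fractions: the denominator [s]
    is a unit at [P]. *)
Definition locally_in n x :=
  exists s y, [/\ OK s, ~ P s, OK y & s * x = pi ^+ n * y].

(** One way, [u] turns each factor from [P] into a multiple of [pi]. Conversely, the denominator [s]
    is invertible modulo [P^n], so [x] is the sum of an element of [P^n] and a multiple of [s x],
    itself a multiple of [pi^n]. *)
Lemma ideal_expE n x : ideal_exp P n x <-> OK x /\ locally_in n x.
Proof.
split=> [Px|[Ox [s [y [Os nPs Oy e]]]]].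
  split; first exact: (ideal_sub (ideal_exp_ideal n)).
  elim: n x Px => [|n IH] x /=.
    by move=> Ox; exists 1, x; split=> //; [apply: OK1 | apply: (prime_proper pP)].
  move=> [r rP ->]; rewrite big_seq; elim/big_ind: _.
  - exists 1, 0; split; [exact: OK1 | exact: (prime_proper pP) | exact: OK0 |].
    by rewrite !mulr0.
  - move=> x1 x2 [s1 [y1 [Os1 nPs1 Oy1 e1]]] [s2 [y2 [Os2 nPs2 Oy2 e2]]].
    exists (s1 * s2), (y1 * s2 + s1 * y2).
    split; [exact: OKM | exact: prime_notM | by apply: OKD; apply: OKM |].
    rewrite mulrDr mulrDr [pi ^+ _ * (y1 * _)]mulrA -e1.
    by rewrite [pi ^+ _ * (s1 * _)]mulrCA -e2; ring.
  - move=> v /rP[Pv1 /IH[s [y [Os nPs Oy e]]]].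
    have [z Oz ez] := upi Pv1; exists (u * s), (z * y).
    split; [exact: OKM | exact: prime_notM | exact: OKM |].
    by rewrite mulrACA ez e exprS; ring.
have [s' Os' Ps'] := prime_maximal Os nPs.
have [z Oz Pz] : exists2 z, OK z & ideal_exp P n (1 - s * z).
  elim: n {e} => [|n [z Oz Pz]]; first by exists 0; rewrite ?mulr0 ?subr0; apply: OK0 || apply: OK1.
  (* Chosen so that [1 - s z] gets multiplied by [1 - s s'], an element of [P]: the inverse of [s]
     is lifted from [P^n] to [P^(n+1)]. *)
  exists (z + s' - s * z * s').
    by apply: OKB; [apply: OKD | apply: OKM => //; apply: OKM].
  have -> : 1 - s * (z + s' - s * z * s') = (1 - s * s') * (1 - s * z) by ring.
  exact: ideal_mul_mem.
have iPn := ideal_exp_ideal n.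
have -> : x = (1 - s * z) * x + z * (s * x) by ring.
apply: (ideal_D iPn); first exact: ideal_Mr.
apply: (ideal_M iPn) => //; rewrite e; apply: ideal_Mr => //.
exact: ideal_exp_self.
Qed.

Lemma local_ord_eq x n s c : OK x ->
  OK s -> ~ P s -> OK c -> ~ P c -> s * x = pi ^+ n * c -> ord_int P x = n.
Proof.
move=> Ox Os nPs Oc nPc e.
have Pn : ideal_exp P n x by apply/ideal_expE; split=> //; exists s, c.
have max m : ideal_exp P m x -> (m <= n)%N.
  move=> /ideal_expE[_ [s' [y [Os' nPs' Oy e']]]]; rewrite leqNgt; apply/negP => nm.
  apply: (prime_notM Os' Oc nPs' nPc).
  have -> : s' * c = pi * (pi ^+ (m - n.+1) * (s * y)).
    apply: (mulfI (expf_neq0 n pi0)).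
    rewrite mulrCA -e mulrCA e' -{1}(subnKC nm) exprD exprS; ring.
  by apply: ideal_Mr => //; apply: OKM; [apply: OKX | apply: OKM].
have : [set n | ideal_exp P n x /\ forall m, ideal_exp P m x -> (m <= n)%N] (ord_int P x).
  by apply: xgetPex; exists n.
move=> [/max le1 /(_ _ Pn) le2]; apply/eqP; rewrite eqn_leq le1 le2.
by [].
Qed.

(** Some power of [P] must omit [x]. If [x] belonged to [P^(N+1)] with [N] the index of [(x)], the
    [N + 1] powers [pi^0, ..., pi^N] would be pairwise incongruent modulo [(x)], because
    [pi^i - pi^j] has order [i] for [i < j]. The last exponent before the first failure is the
    order. *)
Lemma local_ord x : OK x -> x != 0 ->
  exists s c, [/\ OK s, ~ P s, OK c, ~ P c & s * x = pi ^+ ord_int P x * c].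
Proof.
move=> Ox x0.
have [n nloc] : exists n, ~ locally_in n x.
  apply: contrapT => H.
  have loc n : locally_in n x by apply: contrapT => Hn; apply: H; exists n.
  have [N iN] := principal_index Ox x0.
  have iPN := ideal_exp_ideal N.+1.
  have xP : ideal_exp P N.+1 x by apply/ideal_expE.
  have := @incongruent_mkseq _ OK (principal x) (fun i => pi ^+ i) N.+1
    (ideal_subgroup (principal_ideal Ox)) (fun i _ => OKX i Opi).
  move=> inc; suff /inc/(incongruent_size (ideal_subgroup (principal_ideal Ox)) iN) :
      forall i j, (i < j < N.+1)%N -> ~ principal x (pi ^+ i - pi ^+ j).
    by rewrite size_mkseq ltnn.
  move=> i j /andP[ij jN].
  move=> /(principal_sub iPN xP) /ideal_expE[_ [s [y [Os nPs Oy e]]]].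
  pose v := 1 - pi ^+ (j - i).
  have Ov : OK v by apply: OKB; [apply: OK1 | apply: OKX].
  have nPv : ~ P v.
    apply: prime_not1B; rewrite -(@prednK (j - i)) ?subn_gt0 // exprS.
    by apply: ideal_Mr => //; apply: OKX.
  apply: (prime_notM Os Ov nPs nPv).
  have -> : s * v = pi * (pi ^+ (N - i) * y).
    apply: (mulfI (expf_neq0 i pi0)).
    have -> : pi ^+ i * (s * v) = s * (pi ^+ i - pi ^+ j).
      by rewrite -{1}(subnKC (ltnW ij)) exprD /v; ring.
    rewrite e mulrA -exprS mulrA -exprD addnS subnKC //.
    by rewrite -ltnS; apply: ltn_trans jN.
  by apply: ideal_Mr => //; apply: OKM => //; apply: OKX.
pose p := [pred n | `[< ~ locally_in n x >]].
have exp : exists n, p n by exists n; apply/asboolP.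
case: (ex_minnP exp) => m /asboolP nm mmin.
case: m nm mmin => [|m] nm mmin.
  by case: nm; exists 1, x; split=> //; [apply: OK1 | apply: (prime_proper pP)].
have [s [c [Os nPs Oc e]]] : locally_in m x.
  apply: contrapT => Hm; have : p m by apply/asboolP.
  by move=> /mmin; rewrite ltnn.
have nPc : ~ P c.
  move=> /upi[z Oz ez]; apply: nm; exists (u * s), z.
  split; [exact: OKM | exact: prime_notM | by [] |].
  by rewrite -mulrA e mulrCA ez exprSr mulrA.
by exists s, c; split=> //; rewrite (local_ord_eq Ox Os nPs Oc nPc e).
Qed.

End Local.

Lemma ord_intM x y : OK x -> OK y -> x != 0 -> y != 0 ->
  ord_int P (x * y) = (ord_int P x + ord_int P y)%N.
Proof.
move=> Ox Oy x0 y0; have [pi [u [Ppi pi0 Ou nPu upi]]] := prime_uniformizer.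
have [s [c [Os nPs Oc nPc e]]] := local_ord Ppi pi0 Ou nPu upi Ox x0.
have [s' [c' [Os' nPs' Oc' nPc' e']]] := local_ord Ppi pi0 Ou nPu upi Oy y0.
apply: (local_ord_eq Ppi pi0 Ou nPu upi (s := s * s') (c := c * c')).
- exact: OKM.
- exact: OKM.
- exact: prime_notM.
- exact: OKM.
- exact: prime_notM.
- by rewrite mulrACA e e' exprD mulrACA.
Qed.

Lemma ord_int_notin x : OK x -> ~ P x -> ord_int P x = 0%N.
Proof.
move=> Ox nPx; have [pi [u [Ppi pi0 Ou nPu upi]]] := prime_uniformizer.
apply: (local_ord_eq Ppi pi0 Ou nPu upi (s := 1) (c := x)) => //; first exact: OK1.
exact: (prime_proper pP).
Qed.

Lemma ord_int_gt0 x : x != 0 -> P x -> (0 < ord_int P x)%N.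
Proof.
move=> x0 Px; have Ox := ideal_sub iP Px.
have [pi [u [Ppi pi0 Ou nPu upi]]] := prime_uniformizer.
have [s [c [Os nPs Oc nPc e]]] := local_ord Ppi pi0 Ou nPu upi Ox x0.
rewrite lt0n; apply/eqP => o0; apply: nPc; move: e; rewrite o0 expr0 mul1r => <-.
exact: (ideal_M iP).
Qed.

Lemma ord_int_exists1 : exists2 pi, P pi /\ pi != 0 & ord_int P pi = 1%N.
Proof.
have [pi [u [Ppi pi0 Ou nPu upi]]] := prime_uniformizer; exists pi => //.
have Opi := ideal_sub iP Ppi.
apply: (local_ord_eq Ppi pi0 Ou nPu upi (s := 1) (c := 1)) => //; rewrite ?expr1 ?mulr1 ?mul1r //.
- exact: OK1.
- exact: (prime_proper pP).
- exact: OK1.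
- exact: (prime_proper pP).
Qed.

Lemma ord_int_dvd x y : OK x -> OK y -> x != 0 -> y != 0 ->
    (ord_int P x <= ord_int P y)%N ->
  exists s z, [/\ OK s, ~ P s, OK z & s * y = z * x].
Proof.
move=> Ox Oy x0 y0 le; have [pi [u [Ppi pi0 Ou nPu upi]]] := prime_uniformizer.
have Opi := ideal_sub iP Ppi.
have [s [c [Os nPs Oc nPc e]]] := local_ord Ppi pi0 Ou nPu upi Ox x0.
have [s' [c' [Os' nPs' Oc' nPc' e']]] := local_ord Ppi pi0 Ou nPu upi Oy y0.
exists (c * s'), (pi ^+ (ord_int P y - ord_int P x) * c' * s).
split; [exact: OKM | exact: prime_notM | |].
  by apply: OKM => //; apply: OKM => //; apply: OKX.
have E : pi ^+ ord_int P y = pi ^+ (ord_int P y - ord_int P x) * pi ^+ ord_int P x.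
  by rewrite -exprD subnK.
by rewrite -[LHS]mulrA e' E -[RHS]mulrA e [LHS]mulrC -!mulrA; congr (_ * _); rewrite mulrCA.
Qed.

Lemma ord_int_geP x n : OK x -> x != 0 -> ideal_exp P n x <-> (n <= ord_int P x)%N.
Proof.
move=> Ox x0; have [pi [u [Ppi pi0 Ou nPu upi]]] := prime_uniformizer.
have Opi := ideal_sub iP Ppi.
have [s [c [Os nPs Oc nPc e]]] := local_ord Ppi pi0 Ou nPu upi Ox x0.
move: (ord_int P x) e => o e; split.
  move=> /(ideal_expE Ppi Ou nPu upi)[_ [s' [y [Os' nPs' Oy e']]]].
  rewrite leqNgt; apply/negP => lt; apply: (prime_notM Os' Oc nPs' nPc).
  have -> : s' * c = pi * (pi ^+ (n - o.+1) * (s * y)).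
    apply: (mulfI (expf_neq0 o pi0)).
    rewrite mulrCA -e mulrCA e' -{1}(subnKC lt) exprD exprS; ring.
  by apply: ideal_Mr => //; apply: OKM; [apply: OKX | apply: OKM].
move=> le; apply/(ideal_expE Ppi Ou nPu upi); split=> //.
exists s, (pi ^+ (o - n) * c); split=> //.
  by apply: OKM => //; apply: OKX.
by rewrite mulrA -exprD subnKC.
Qed.

Lemma ord_intD x y n : OK x -> OK y -> x != 0 -> y != 0 -> x + y != 0 ->
  (n <= ord_int P x)%N -> (n <= ord_int P y)%N -> (n <= ord_int P (x + y))%N.
Proof.
move=> Ox Oy x0 y0 xy0 /(ord_int_geP _ Ox x0) nx /(ord_int_geP _ Oy y0) ny.
by apply/ord_int_geP => //; [apply: OKD | apply: (ideal_D (ideal_exp_ideal n))].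
Qed.

Lemma ideal_norm_gt1 : (1 < ideal_norm P)%N.
Proof.
have := prime_index; case: (ideal_norm P) => [|[|//]] iN.
  by have := has_index_gt0 (subgroup_OK K) iN.
case: (prime_proper pP); apply: (has_index1 (subgroup_OK K) (ideal_subgroup iP) iN).
exact: OK1.
Qed.

Lemma ideal_norm_mem : P (ideal_norm P)%:R.
Proof.
exact: (has_index_mulrn (subgroup_OK K) (ideal_subgroup iP) prime_index (OK1 K)).
Qed.

End Prime.

Lemma prime_sub_eq P Q : nonzero_primes P -> nonzero_primes Q -> P `<=` Q -> P = Q.
Proof.
move=> nzP nzQ PQ; apply/seteqP; split=> // x Qx; apply: contrapT => nPx.
have iQ := prime_is_ideal nzQ.1.
have [y Oy Py] := prime_maximal nzP (ideal_sub iQ Qx) nPx.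
apply: (prime_not1B nzQ (a := x * y)); last exact: PQ.
exact: ideal_Mr.
Qed.

(** The exponent of [Q] in [I], described as the least order attained on nonzero elements; this
    avoids products of ideals. *)
Definition min_ord Q I m :=
  (forall x, I x -> x != 0 -> (m <= ord_int Q x)%N) /\
  exists x, [/\ I x, x != 0 & ord_int Q x = m].

(** For [g] outside [I] with [I + (g)] as small as possible over [I], the quotient is simple. [Q] is
    the annihilator of [g] modulo [I], and minimality makes every [x] outside [Q] invertible modulo
    [Q]. *)
Lemma simple_quotient I a : is_ideal I -> I a -> a != 0 -> ~ I 1 ->
  exists g Q, [/\ OK g, ~ I g, nonzero_primes Q & forall x, OK x -> I (x * g) <-> Q x].
Proof.
move=> iI Ia a0 nI1.
pose G := [set g | OK g /\ ~ I g].
have [||g [Og nIg] gmin] := adjoin_minimal (G := G) (g0 := 1) iI Ia a0.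
- by move=> g [].
- by split=> //; apply: OK1.
pose Q := [set x | OK x /\ I (x * g)].
have Qmax x : OK x -> ~ Q x -> exists2 y, OK y & Q (1 - x * y).
  move=> Ox nQx; have [|y Oy Iy] := gmin x Ox.
    by split; [apply: OKM | move=> Ixg; apply: nQx].
  exists y => //; split=> //.
  by apply: OKB; [apply: OK1 | apply: OKM].
have iQ : is_ideal Q.
  split.
  - by move=> x [].
  - by split; [apply: OK0 | rewrite mul0r; apply: (ideal_0 iI)].
  - move=> x y [Ox Ix] [Oy Iy]; split; first exact: OKD.
    by rewrite mulrDl; apply: (ideal_D iI).
  - move=> b x Ob [Ox Ix]; split; first exact: OKM.
    by rewrite -mulrA; apply: (ideal_M iI).
exists g, Q; split=> //; last by move=> x Ox; split=> [Ix|[]].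
split.
  split=> //; first by case=> _; rewrite mul1r.
  move=> x b Ox Ob Qxb; have [Qx|nQx] := pselect (Q x); [by left | right].
  have [y Oy Qy] := Qmax x Ox nQx.
  have -> : b = b * (1 - x * y) + y * (x * b) by ring.
  by apply: (ideal_D iQ); apply: (ideal_M iQ).
apply/eqP => Q0; have : Q a by split; [apply: (ideal_sub iI) | apply: ideal_Mr].
by rewrite Q0 => /eqP; apply/negP.
Qed.

(** Multiplication by [g] identifies the quotient of the ring of integers by [Q] with that of
    [I + (g)] by [I]. *)
Lemma adjoin_index I g Q : is_ideal I -> OK g -> nonzero_primes Q ->
    (forall x, OK x -> I (x * g) <-> Q x) ->
  has_index (adjoin_ideal I g) I (ideal_norm Q).
Proof.
move=> iI Og nzQ QE; have iQ := prime_is_ideal nzQ.1.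
have [r [[ur rO rQ] cov <-]] := prime_index nzQ.
have inj : {in r &, forall x y, I (x * g - y * g) -> x = y}.
  move=> x y xr yr; rewrite -mulrBl => /QE Qxy; apply: rQ => //; apply: Qxy.
  by apply: OKB; apply: rO.
exists [seq x * g | x <- r]; split; last by rewrite size_map.
  split.
  - rewrite map_inj_in_uniq // => x y xr yr e; apply: inj => //.
    by rewrite e subrr; apply: (ideal_0 iI).
  - move=> _ /mapP[x /rO Ox ->]; exists 0; first exact: (ideal_0 iI).
    by exists x => //; rewrite add0r mulrC.
  - by move=> _ _ /mapP[x xr ->] /mapP[y yr ->] /inj ->.
move=> _ [x Ix [y Oy <-]]; have [z zr Qyz] := cov y Oy.
exists (z * g); first exact: map_f.
have -> : x + g * y - z * g = x + (y - z) * g by ring.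
by apply: (ideal_D iI) => //; apply/QE => //; apply: (ideal_sub iQ).
Qed.

(** Induction on the index. Enlarging [I] to [J = I + (g)] divides the index by the norm of [Q],
    lowers the exponent at [Q] by exactly one and leaves the other exponents unchanged. This rests
    on [Q J] being contained in [I] and on [s g] staying outside [I] for [s] outside [Q]. *)
Lemma ideal_factorization n I a : is_ideal I -> I a -> a != 0 -> has_index OK I n ->
  exists ps : seq (set K),
    [/\ {in ps, forall Q, nonzero_primes Q}, n = (\prod_(Q <- ps) ideal_norm Q)%N
      & forall Q, nonzero_primes Q -> min_ord Q I (count_mem Q ps)].
Proof.
elim/ltn_ind: n I a => n IH I a iI Ia a0 iN; have sI := ideal_subgroup iI.
have [I1|nI1] := pselect (I 1).
  have IO : I = OK.
    apply/seteqP; split; first exact: (ideal_sub iI).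
    by move=> x Ox; rewrite -[x]mulr1; apply: (ideal_M iI).
  exists [::]; split=> //.
    rewrite big_nil; apply: (has_index_unique sI iN); rewrite {1}IO.
    by apply: has_index_refl; apply: subgroup_OK.
  move=> Q nzQ; split=> //=; exists 1; split=> //; first exact: oner_neq0.
  apply: ord_int_notin => //; first exact: OK1.
  exact: (prime_proper nzQ.1).
have [g [Q [Og nIg nzQ QE]]] := simple_quotient iI Ia a0 nI1.
have iJ := adjoin_is_ideal iI Og; set J := adjoin_ideal I g in iJ.
have IJ : I `<=` J by apply: adjoin_sub.
have iJI : has_index J I (ideal_norm Q) := adjoin_index iI Og nzQ QE.
have [m iOJ] : exists m, has_index OK J m.
  by apply: has_index_sup iN => //; apply: ideal_subgroup.
have nE : n = (m * ideal_norm Q)%N.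
  apply: (has_index_unique sI iN).
  apply: (has_index_trans (subgroup_OK K) (ideal_subgroup iJ) sI (ideal_sub iJ) IJ) => //.
have m0 := has_index_gt0 (subgroup_OK K) iOJ; have Q1 := ideal_norm_gt1 nzQ.
have ltmn : (m < n)%N by rewrite nE; nia.
have [ps [psP mE psord]] := IH m ltmn J a iJ (IJ _ Ia) a0 iOJ.
exists (Q :: ps); split.
- by move=> Q'; rewrite inE => /predU1P[->|/psP].
- by rewrite big_cons nE mE mulnC.
move=> Q' nzQ' /=; have [lb [x [Jx x0 ox]]] := psord Q' nzQ'.
have QJ q y : Q q -> J y -> I (q * y).
  move=> Qq [y1 Iy1 [y2 Oy2 <-]]; have Oq := ideal_sub (prime_is_ideal nzQ.1) Qq.
  rewrite mulrDr; apply: (ideal_D iI); first exact: (ideal_M iI).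
  by rewrite mulrA; apply: ideal_Mr => //; apply/QE.
have Ox := ideal_sub iJ Jx.
have [eQ|neQ] := eqVneq Q Q'.
  rewrite -eQ in nzQ' lb ox *; rewrite add1n; split=> [h Ih h0|].
    rewrite ltn_neqAle lb ?andbT //; last exact: IJ.
    (* Were the order of [h] equal to the minimum over [J], some [s g] with [s] outside [Q] would be
       a multiple of [h] and lie in [I]. *)
    apply/eqP => eh; have g0 : g != 0.
      by apply: contra_notN nIg => /eqP ->; apply: (ideal_0 iI).
    have Oh := ideal_sub iI Ih.
    have [|s [z [Os nQs Oz e]]] := ord_int_dvd nzQ Oh Og h0 g0.
      by rewrite -eh; apply: lb => //; apply: adjoin_mem.
    by apply/nQs/QE => //; rewrite e; apply: (ideal_M iI).
  have [pi [Qpi pi0] opi] := ord_int_exists1 nzQ.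
  have Opi := ideal_sub (prime_is_ideal nzQ.1) Qpi.
  exists (pi * x); split; [exact: QJ | exact: mulf_neq0 |].
  by rewrite ord_intM // opi ox.
rewrite add0n; split=> [h Ih h0|]; first by apply: lb => //; apply: IJ.
(* Multiplication by such a [q] carries [x] from [J] into [I] without changing its order at [Q']. *)
have [q Qq nQ'q] : exists2 q, Q q & ~ Q' q.
  apply: contrapT => H; move/negP: neQ; apply; apply/eqP.
  apply: prime_sub_eq => // q Qq; apply: contrapT => nq; apply: H; by exists q.
have Oq := ideal_sub (prime_is_ideal nzQ.1) Qq.
have q0 : q != 0.
  apply: contra_notN nQ'q => /eqP ->; exact: (ideal_0 (prime_is_ideal nzQ'.1)).
exists (q * x); split; [exact: QJ | exact: mulf_neq0 |].
by rewrite ord_intM // ord_int_notin.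
Qed.

(** [I] is the ideal of denominators of [a / b]. Were it proper, some prime [Q] would have positive
    exponent in it, yet the inequality at [Q] provides a denominator [s] outside [Q]. *)
Lemma local_integral a b : OK a -> OK b -> a != 0 -> b != 0 ->
    (forall P, nonzero_primes P -> (ord_int P b <= ord_int P a)%N) ->
  OK (a / b).
Proof.
move=> Oa Ob a0 b0 le.
pose I := [set y | OK y /\ principal b (y * a)].
have ib := principal_ideal Ob.
have iI : is_ideal I.
  split.
  - by move=> y [].
  - by split; [apply: OK0 | rewrite mul0r; apply: (ideal_0 ib)].
  - move=> x y [Ox Ix] [Oy Iy]; split; first exact: OKD.
    by rewrite mulrDl; apply: (ideal_D ib).
  - move=> c x Oc [Ox Ix]; split; first exact: OKM.
    by rewrite -mulrA; apply: (ideal_M ib).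
have Ib : I b by split=> //; apply: principalM.
have [[_ [z Oz e]]|nI1] := pselect (I 1).
  by rewrite -[a]mul1r -e mulrC mulKf.
have [n iN] := ideal_index iI Ib b0.
have [[|Q ps] [psP nE psord]] := ideal_factorization iI Ib b0 iN.
  case: nI1; rewrite big_nil in nE; rewrite nE in iN.
  by apply: (has_index1 (subgroup_OK K) (ideal_subgroup iI) iN); apply: OK1.
have nzQ := psP Q (mem_head _ _).
have [s [z [Os nQs Oz e]]] := ord_int_dvd nzQ Ob Oa b0 a0 (le Q nzQ).
have Is : I s by split=> //; rewrite e mulrC; apply: principalM.
have s0 : s != 0.
  apply: contra_notN nQs => /eqP ->; exact: (ideal_0 (prime_is_ideal nzQ.1)).
have [/(_ s Is s0) + _] := psord Q nzQ.
by rewrite /= eqxx add1n (ord_int_notin nzQ).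
Qed.

End Dedekind.

(** * The complex modulus with values in the reals *)

Section Normc.
Variable R : realType.
Implicit Types z : R[i].
Local Notation normc := (@Normc.normc R).

Lemma normcE z : `|z| = (normc z)%:C%C.
Proof. by []. Qed.

Lemma normc_ge0 z : 0 <= normc z.
Proof. by rewrite -lecR -normcE normr_ge0. Qed.

Lemma normcD z1 z2 : normc (z1 + z2) <= normc z1 + normc z2.
Proof. by rewrite -lecR rmorphD /= -!normcE ler_normD. Qed.

Lemma normc_opp z : normc (- z) = normc z.
Proof. by apply: complexI; rewrite -!normcE normrN. Qed.

Lemma normcX z n : normc (z ^+ n) = normc z ^+ n.
Proof. by apply: complexI; rewrite rmorphXn /= -!normcE normrX. Qed.

Lemma normc_nat n : normc n%:R = n%:R.
Proof. by apply: complexI; rewrite -normcE rmorph_nat normr_nat. Qed.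

Lemma normc_int (m : int) : normc m%:~R = `|m|%:~R.
Proof. by apply: complexI; rewrite -normcE rmorph_int intr_norm. Qed.

Lemma normc_prod (I : Type) (r : seq I) (F : I -> R[i]) :
  normc (\prod_(i <- r) F i) = \prod_(i <- r) normc (F i).
Proof. exact: (big_morph normc (@Normc.normcM R) (@Normc.normc1 R)). Qed.

Lemma normc_sum (I : Type) (r : seq I) (P : pred I) (F : I -> R[i]) :
  normc (\sum_(i <- r | P i) F i) <= \sum_(i <- r | P i) normc (F i).
Proof.
elim/big_rec2: _ => [|i x y _ le]; first by rewrite Normc.normc0.
by apply: le_trans (normcD _ _) _; rewrite lerD2l.
Qed.

Lemma normc_gt0 z : (0 < normc z) = (z != 0).
Proof.
rewrite lt0r normc_ge0 andbT; congr negb; apply/eqP/eqP => [/Normc.eq0_normc //|->].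
exact: Normc.normc0.
Qed.

Lemma normc_archi z : exists n : nat, `|z| <= n%:R.
Proof.
exists (Num.bound (normc z)); rewrite normcE -(rmorph_nat (real_complex R)) lecR.
by apply: ltW; apply: archi_boundP; apply: normc_ge0.
Qed.

End Normc.

(** * Gauss norms and the product formula *)

Section GaussNorm.
Variables (R : realType) (K : fieldExtType rat).
Implicit Types (f g : {poly K}) (v : K -> R).

Record abs_value v : Prop := AbsValue {
  abs_ge0 : forall x, 0 <= v x;
  abs_eq0 : forall x, (v x == 0) = (x == 0);
  abs_1 : v 1 = 1;
  abs_M : forall x y, v (x * y) = v x * v y }.

Definition ultrametric v := forall x y, v (x + y) <= Num.max (v x) (v y).

Lemma abs_0 v : abs_value v -> v 0 = 0.
Proof. by move=> av; apply/eqP; rewrite (abs_eq0 av). Qed.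

Lemma abs_N v x : abs_value v -> v (- x) = v x.
Proof.
move=> av; apply/eqP; rewrite -(@eqrXn2 _ 2) ?(abs_ge0 av) // !expr2 -!(abs_M av).
by rewrite mulrNN.
Qed.

Lemma abs_X v x n : abs_value v -> v (x ^+ n) = v x ^+ n.
Proof.
by move=> av; elim: n => [|n IH]; rewrite ?expr0 ?(abs_1 av) // !exprS (abs_M av) IH.
Qed.

Lemma gauss_norm_ge f v i : abs_value v -> v f`_i <= gauss_norm f v.
Proof.
move=> av; have [lt|ge] := ltnP i (size f).
  exact: (le_bigmax _ (fun j : 'I_(size f) => v f`_j) (Ordinal lt)).
by rewrite nth_default // (abs_0 av); apply: bigmax_ge_id.
Qed.

Lemma gauss_norm_le f v (B : R) : 0 <= B -> (forall i, v f`_i <= B) -> gauss_norm f v <= B.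
Proof. by move=> B0 fB; apply: bigmax_le => // i _. Qed.

Lemma gauss_norm_attained f v : abs_value v -> exists i, gauss_norm f v = v f`_i.
Proof.
move=> av; rewrite /gauss_norm; elim/big_ind: _ => [|x y [i ->] [j ->]|i _].
- by exists (size f); rewrite nth_default // (abs_0 av).
- by case: leP => _; [exists j | exists i].
- by exists i.
Qed.

Lemma gauss_norm_gt0 f v : abs_value v -> f != 0 -> 0 < gauss_norm f v.
Proof.
move=> av f0; apply: lt_le_trans (gauss_norm_ge f (size f).-1 av).
by rewrite lt0r (abs_eq0 av) (abs_ge0 av) -lead_coefE lead_coef_eq0 f0.
Qed.

Lemma gauss_normZ c f v : abs_value v -> gauss_norm (c *: f) v = v c * gauss_norm f v.
Proof.
move=> av; apply/le_anti/andP; split.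
  apply: gauss_norm_le => [|i]; first by rewrite mulr_ge0 ?(abs_ge0 av) //; have [i ->] := gauss_norm_attained f av; apply: (abs_ge0 av).
  by rewrite coefZ (abs_M av) ler_wpM2l ?(abs_ge0 av) // gauss_norm_ge.
have [i ->] := gauss_norm_attained f av.
by rewrite -(abs_M av) -coefZ gauss_norm_ge.
Qed.

Lemma ultra_lt v x y : abs_value v -> ultrametric v -> v y < v x -> v (x + y) = v x.
Proof.
move=> av uv lt; apply/le_anti/andP; split.
  by apply: le_trans (uv _ _) _; rewrite ge_max lexx ltW.
rewrite leNgt; apply/negP => lt2; have := uv (x + y) (- y).
by rewrite addrK (abs_N _ av) leNgt gt_max lt lt2.
Qed.

(** Gauss's lemma for one linear factor, which is enough for split polynomials. If [|r| <= 1], take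
    the last index [i] at which [f] attains its norm: there [f_i] dominates [r f_(i+1)]. If
    [|r| > 1], take any such [i]: there [r f_i] dominates [f_(i-1)]. *)
Lemma gauss_norm_linear r f v : abs_value v -> ultrametric v -> f != 0 ->
  gauss_norm (('X - r%:P) * f) v = Num.max 1 (v r) * gauss_norm f v.
Proof.
move=> av uv f0; have G0 := gauss_norm_gt0 av f0; set G := gauss_norm f v in G0 *.
have coefE i : ((('X - r%:P) * f)`_i.+1 = f`_i - r * f`_i.+1) *
    ((('X - r%:P) * f)`_0 = - (r * f`_0)).
  by rewrite mulrBl !coefB coefXM coefCM !coefXM /= coefCM sub0r.
apply/le_anti/andP; split.
  apply: gauss_norm_le => [|i]; first by apply: mulr_ge0; [rewrite le_max ler01 | apply: ltW].
  have fG j : v f`_j <= Num.max 1 (v r) * G.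
    apply: le_trans (gauss_norm_ge f j av) _.
    by apply: ler_peMl; [apply: ltW | rewrite le_max lexx].
  have rfG j : v (r * f`_j) <= Num.max 1 (v r) * G.
    rewrite (abs_M av) ler_pM ?(abs_ge0 av) ?gauss_norm_ge // le_max lexx orbT //.
  case: i => [|i]; first by rewrite (coefE 0%N) (abs_N _ av).
  rewrite (coefE i); apply: le_trans (uv _ _) _.
  by rewrite (abs_N _ av) ge_max fG rfG.
have [r1|r1] := leP (v r) 1.
  rewrite mul1r.
  have [i0 Gi0] := gauss_norm_attained f av.
  pose p := [pred i | v f`_i == G].
  have exp : exists i, p i by exists i0; rewrite /= -Gi0.
  have pbd i : p i -> (i <= size f)%N.
    move=> /eqP pi; rewrite leqNgt; apply/negP => lt.
    by move: G0; rewrite -pi nth_default ?(abs_0 av) ?ltxx // ltnW.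
  case: (ex_maxnP exp pbd) => i /eqP iG imax.
  have lt : v (- (r * f`_i.+1)) < v f`_i.
    rewrite (abs_N _ av) (abs_M av) iG.
    apply: (@le_lt_trans _ _ (v f`_i.+1)); first by rewrite ler_piMl ?(abs_ge0 av).
    rewrite lt_neqAle gauss_norm_ge // andbT; apply/negP => /imax.
    by rewrite ltnn.
  by rewrite -iG -(ultra_lt av uv lt) -(coefE i) gauss_norm_ge.
have [i Gi] := gauss_norm_attained f av.
rewrite -/G in Gi; rewrite Gi -(abs_M av) -(abs_N _ av).
case: i Gi => [|i] Gi; first by rewrite -(coefE 0%N) gauss_norm_ge.
have lt : v f`_i < v (- (r * f`_i.+1)).
  rewrite (abs_N _ av) (abs_M av) -Gi; apply: le_lt_trans (gauss_norm_ge f i av) _.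
  by rewrite ltr_pMl.
by rewrite -(ultra_lt av uv lt) addrC -(coefE i) gauss_norm_ge.
Qed.

Lemma gauss_norm1 v : abs_value v -> gauss_norm 1 v = 1.
Proof.
move=> av; apply/le_anti/andP; split.
  apply: gauss_norm_le => // i; rewrite coef1.
  by case: eqP => _; rewrite ?(abs_1 av) // (abs_0 av).
by have := gauss_norm_ge 1 0 av; rewrite coef1 eqxx (abs_1 av).
Qed.

Lemma gauss_norm_split v c (rs : seq K) : abs_value v -> ultrametric v ->
  gauss_norm (c *: \prod_(r <- rs) ('X - r%:P)) v = v c * \prod_(r <- rs) Num.max 1 (v r).
Proof.
move=> av uv; rewrite gauss_normZ //; congr (_ * _).
elim: rs => [|r rs IH]; first by rewrite !big_nil gauss_norm1.
by rewrite !big_cons gauss_norm_linear ?IH // monic_neq0 // monic_prod_XsubC.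
Qed.

Lemma abs_emb_value (s : {rmorphism K -> R[i]}) : abs_value (abs_emb s).
Proof.
split=> [x|x||x y]; rewrite /abs_emb.
- exact: normc_ge0.
- by rewrite -[RHS](fmorph_eq0 s) -[RHS]negbK -normc_gt0 lt0r normc_ge0 andbT negbK.
- by rewrite rmorph1 Normc.normc1.
- by rewrite rmorphM Normc.normcM.
Qed.

End GaussNorm.

Section PrimeValue.
Variables (R : realType) (K : fieldExtType rat).
Implicit Types (x y : K).
Local Notation OK := (@OK K).

Lemma fraction x : exists a b, [/\ OK a, OK b, b != 0 & x = a / b].
Proof.
have [m m0 Om] := int_multiple_OK x.
have mK : (m%:~R : K) != 0 by rewrite intK_eq0.
by exists (m%:~R * x), m%:~R; split=> //; [apply: OK_int | rewrite mulrC mulKf].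
Qed.

Section OnePrime.
Variable P : set K.
Hypothesis nzP : nonzero_primes P.
Local Notation N := ((ideal_norm P)%:R : R).

Lemma ord_primeE a b : OK a -> a != 0 -> OK b -> b != 0 ->
  ord_prime P (a / b) = (ord_int P a)%:Z - (ord_int P b)%:Z.
Proof.
move=> Oa a0 Ob b0.
have : [set m : int | exists a' b', [/\ OK a' /\ a' != 0, OK b' /\ b' != 0, a / b = a' / b'
      & m = (ord_int P a')%:Z - (ord_int P b')%:Z]] (ord_prime P (a / b)).
  by apply: xgetPex; exists ((ord_int P a)%:Z - (ord_int P b)%:Z), a, b.
move=> [a' [b' [[Oa' a'0] [Ob' b'0] e ->]]].
have : ord_int P (a * b') = ord_int P (a' * b).
  by congr (ord_int P _); apply/eqP; rewrite -eqr_div //; apply/eqP.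
rewrite !ord_intM //; lia.
Qed.

Lemma ord_prime_OK a : OK a -> a != 0 -> ord_prime P a = (ord_int P a)%:Z.
Proof.
move=> Oa a0; have := ord_primeE Oa a0 (OK1 K) (oner_neq0 _).
rewrite divr1 => ->; rewrite (ord_int_notin nzP (OK1 K)) ?subr0 //.
exact: (prime_proper nzP.1).
Qed.

Lemma ord_primeM x y : x != 0 -> y != 0 ->
  ord_prime P (x * y) = ord_prime P x + ord_prime P y.
Proof.
have [a [b [Oa Ob b0 ->]]] := fraction x; have [c [e [Oc Oe e0 ->]]] := fraction y.
rewrite !mulf_eq0 !negb_or => /andP[a0 _] /andP[c0 _].
rewrite mulf_div !ord_primeE ?ord_intM ?mulf_neq0 //; try exact: OKM.
rewrite !PoszD; ring.
Qed.

Lemma ord_primeD x y : x != 0 -> y != 0 -> x + y != 0 ->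
  Num.min (ord_prime P x) (ord_prime P y) <= ord_prime P (x + y).
Proof.
have [a [b [Oa Ob b0 ->]]] := fraction x; have [c [e [Oc Oe e0 ->]]] := fraction y.
have -> : a / b = (a * e) / (b * e) by rewrite -mulf_div divff // mulr1.
have -> : c / e = (c * b) / (b * e) by rewrite [b * e]mulrC -mulf_div divff // mulr1.
have Obe := OKM Ob Oe; have be0 := mulf_neq0 b0 e0.
have := OKM Oc Ob; have := OKM Oa Oe.
move: (a * e) (c * b) (b * e) Obe be0 => {}a {}c {}b {}Ob {}b0 {}Oa {}Oc.
rewrite -mulrDl !mulf_eq0 !negb_or => /andP[a0 _] /andP[c0 _] /andP[ac0 _].
rewrite !ord_primeE //; last exact: OKD.
have := @ord_intD _ _ nzP a c (minn (ord_int P a) (ord_int P c)) Oa Oc a0 c0 ac0 (geq_minl _ _) (geq_minr _ _).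
by rewrite ge_min !lerD2r !lez_nat; case: (leqP (ord_int P a) (ord_int P c)) => _ ->; rewrite ?orbT.
Qed.

Lemma norm_prime_gt1 : 1 < N.
Proof. by rewrite ltr1n ideal_norm_gt1. Qed.

Lemma norm_prime_unit : N \is a GRing.unit.
Proof. by rewrite unitfE gt_eqF // (lt_trans ltr01 norm_prime_gt1). Qed.

Lemma abs_primeE x : x != 0 -> abs_prime R P x = N ^ (- ord_prime P x).
Proof. by rewrite /abs_prime => /negbTE ->. Qed.

Lemma abs_prime_gt0 x : x != 0 -> 0 < abs_prime R P x.
Proof.
move=> x0; rewrite abs_primeE //; apply: exprz_gt0.
exact: lt_trans ltr01 norm_prime_gt1.
Qed.

Lemma abs_prime_value : abs_value (abs_prime R P).
Proof.
split=> [x|x||x y].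
- have [->|x0] := eqVneq x 0; first by rewrite /abs_prime eqxx.
  by apply: ltW; apply: abs_prime_gt0.
- have [->|x0] := eqVneq x 0; first by rewrite /abs_prime !eqxx.
  by rewrite gt_eqF // abs_prime_gt0.
- rewrite abs_primeE ?oner_neq0 // ord_prime_OK ?oner_neq0 //; last exact: OK1.
  rewrite (ord_int_notin nzP (OK1 K)) //.
  exact: (prime_proper nzP.1).
- have [->|x0] := eqVneq x 0; first by rewrite mul0r /abs_prime eqxx mul0r.
  have [->|y0] := eqVneq y 0; first by rewrite mulr0 /abs_prime eqxx mulr0.
  rewrite !abs_primeE ?mulf_neq0 // ord_primeM // opprD exprzDr //.
  exact: norm_prime_unit.
Qed.

Lemma abs_prime_ultra : ultrametric (abs_prime R P).
Proof.
move=> x y; have av := abs_prime_value.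
have [->|x0] := eqVneq x 0; first by rewrite add0r le_max lexx orbT.
have [->|y0] := eqVneq y 0; first by rewrite addr0 le_max lexx.
have [->|xy0] := eqVneq (x + y) 0; first by rewrite (abs_0 av) le_max (abs_ge0 av).
rewrite !abs_primeE // le_max !(ler_eXz2l norm_prime_gt1).
by have := ord_primeD x0 y0 xy0; rewrite ge_min !lerN2.
Qed.

Lemma abs_prime_OK x : OK x -> abs_prime R P x <= 1.
Proof.
move=> Ox; have [->|x0] := eqVneq x 0; first by rewrite /abs_prime eqxx.
rewrite abs_primeE // ord_prime_OK // -(expr0z N) (ler_eXz2l norm_prime_gt1).
by rewrite oppr_le0.
Qed.

End OnePrime.

Lemma min_ord_principal P a m : nonzero_primes P -> OK a -> a != 0 ->
  min_ord P (principal a) m -> m = ord_int P a.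
Proof.
move=> nzP Oa a0 [lb [_ [[x Ox <-] ax0 em]]]; apply/eqP; rewrite eqn_leq.
rewrite lb //=; last exact: principal_self.
have x0 : x != 0 by apply: contraNneq ax0 => ->; rewrite mulr0.
by rewrite -em ord_intM // leq_addr.
Qed.

(** Only primes in the factorization of a numerator or a denominator can give [x] an absolute value
    other than 1; this makes the products over all primes finite. *)
Lemma prime_support x : x != 0 ->
  exists S : seq (set K), {in S, forall P, nonzero_primes P} /\
    forall P, nonzero_primes P -> P \notin S -> abs_prime R P x = 1.
Proof.
have [a [b [Oa Ob b0 ->]]] := fraction x; rewrite mulf_eq0 negb_or => /andP[a0 _].
have supp c : OK c -> c != 0 -> exists S : seq (set K), {in S, forall P, nonzero_primes P} /\
    forall P, nonzero_primes P -> P \notin S -> ord_int P c = 0%N.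
  move=> Oc c0; have [n ic] := principal_index Oc c0.
  have [ps [psP _ psord]] := ideal_factorization (principal_ideal Oc) (principal_self c) c0 ic.
  exists ps; split=> // P nzP nP.
  rewrite -(min_ord_principal nzP Oc c0 (psord P nzP)).
  by apply/eqP; rewrite -leqn0 leqNgt -has_count has_pred1.
have [S [SP So]] := supp a Oa a0; have [T [TP To]] := supp b Ob b0.
exists (S ++ T); split=> [P|P nzP]; rewrite mem_cat; first by move=> /orP[/SP|/TP].
rewrite negb_or => /andP[nS nT].
by rewrite abs_primeE ?mulf_neq0 ?invr_neq0 // ord_primeE // So // To // subrr.
Qed.

Lemma prime_support_seq (xs : seq K) : 0 \notin xs ->
  exists S : seq (set K), [/\ uniq S, {in S, forall P, nonzero_primes P} &
    forall P, nonzero_primes P -> P \notin S -> {in xs, forall x, abs_prime R P x = 1}].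
Proof.
elim: xs => [_|x xs IH]; first by exists [::]; split.
rewrite inE negb_or eq_sym => /andP[x0 /IH[S [uS SP So]]].
have [T [TP To]] := prime_support x0.
exists (undup (T ++ S)); split; first exact: undup_uniq.
  by move=> P; rewrite mem_undup mem_cat => /orP[/TP|/SP].
move=> P nzP; rewrite mem_undup mem_cat negb_or => /andP[nT nS] y.
by rewrite inE => /predU1P[->|yxs]; [apply: To | apply: So].
Qed.

End PrimeValue.

Lemma prod_exp_count (T : eqType) (A : comNzRingType) (F : T -> A) (S ps : seq T) :
  uniq S -> {subset ps <= S} ->
  \prod_(P <- S) F P ^+ count_mem P ps = \prod_(P <- ps) F P.
Proof.
move=> uS; elim: ps => [_|Q ps IH sub]; first by rewrite big_nil big1.
have QS : Q \in S by apply: sub; rewrite mem_head.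
rewrite big_cons -IH; last by move=> P Pps; apply: sub; rewrite inE Pps orbT.
under eq_bigr do rewrite /= exprD.
rewrite big_split /=; congr (_ * _).
rewrite (bigD1_seq Q) //= eqxx expr1 big1 ?mulr1 // => P /negbTE.
by rewrite eq_sym => ->.
Qed.

Section Places.
Variables (R : realType) (K : fieldExtType rat).
Local Notation OK := (@OK K).
Local Notation d := (\dim {:K}).
Local Notation normc := (@Normc.normc R).

Variables (th : K) (sg : 'I_d -> {rmorphism K -> R[i]}).
Hypothesis Oth : OK th.
Hypothesis coordP : forall x, exists c : 'rV[rat]_d, x = \sum_i c 0 i *: th ^+ i.
Hypothesis sg_inj : injective (fun j => sg j th).
Hypothesis sg_surj : forall t : {rmorphism K -> R[i]}, exists j, t =1 sg j.

Lemma prod_embeddings (F : (K -> R[i]) -> R) :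
  \big[*%R/1]_(s \in @embeddings R K) F s = \prod_j F (sg j).
Proof.
pose es := [seq (sg j : K -> R[i]) | j <- enum 'I_d].
have -> : @embeddings R K = [set` es].
  apply/seteqP; split=> [_ [t ->]|_ /= /mapP[j _ ->]]; last by exists (sg j).
  have [j tj] := sg_surj t; have -> : (t : K -> R[i]) = sg j by apply/funext.
  by apply/mapP; exists j => //; rewrite mem_enum.
rewrite -fsbig_seq.
  by rewrite big_map big_enum.
rewrite map_inj_in_uniq ?enum_uniq // => i j _ _ e; apply: sg_inj.
by rewrite /= e.
Qed.

Lemma prod_placesE (F : (K -> R) -> R) (S : seq (set K)) :
    uniq S -> {in S, forall P, nonzero_primes P} ->
    (forall P, nonzero_primes P -> P \notin S -> F (abs_prime R P) = 1) ->
  prod_places F = (\prod_(P <- S) F (abs_prime R P)) * \prod_j F (abs_emb (sg j)).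
Proof.
move=> uS SP SF; rewrite /prod_places prod_embeddings; congr (_ * _).
rewrite (fsbigE S) //.
by rewrite big_seq_cond [RHS]big_seq_cond; apply: eq_bigl => P; case PS: (P \in S) => //=; apply/mem_set; apply: SP.
Qed.

(** The index of [(a)] is the product of the moduli of the conjugates and, by factorization, the
    product of the powers of prime norms with exponents [ord_int P a]; the absolute values at the
    primes are the inverses of these powers. *)
Lemma product_formula_OK a (S : seq (set K)) : OK a -> a != 0 ->
    uniq S -> {in S, forall P, nonzero_primes P} ->
    (forall P, nonzero_primes P -> P \notin S -> abs_prime R P a = 1) ->
  (\prod_(P <- S) abs_prime R P a) * \prod_j normc (sg j a) = 1.
Proof.
move=> Oa a0 uS SP SF.
have [n [ia en]] := norm_index Oth coordP sg_inj Oa a0.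
have {}en : n%:R = \prod_j normc (sg j a) :> R.
  apply: complexI; rewrite rmorph_nat en rmorph_prod; apply: eq_bigr => j _.
  by rewrite normcE.
have [ps [psP nE psord]] := ideal_factorization (principal_ideal Oa) (principal_self a) a0 ia.
have psS : {subset ps <= S}.
  move=> P Pps; apply: contraT => /(SF P (psP P Pps)).
  rewrite (@abs_primeE R _ P _ a0) -(expr0z (ideal_norm P)%:R).
  have nzP := psP P Pps; rewrite (ord_prime_OK nzP) //.
  rewrite -(min_ord_principal nzP Oa a0 (psord P nzP)).
  have c0 : (0 < count_mem P ps)%N by rewrite -has_count has_pred1.
  move=> /eqP; rewrite eq_le !(ler_eXz2l (norm_prime_gt1 R nzP)); lia.
rewrite -en nE natr_prod -(prod_exp_count (fun P => (ideal_norm P)%:R) uS psS) -big_split /=.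
rewrite big_seq big1 // => P /SP nzP.
rewrite (@abs_primeE R _ P _ a0) (ord_prime_OK nzP) // (min_ord_principal nzP Oa a0 (psord P nzP)).
by rewrite exprnP -exprzDr ?(norm_prime_unit R nzP) // addNr expr0z.
Qed.

Theorem product_formula x (S : seq (set K)) : x != 0 ->
    uniq S -> {in S, forall P, nonzero_primes P} ->
    (forall P, nonzero_primes P -> P \notin S -> abs_prime R P x = 1) ->
  (\prod_(P <- S) abs_prime R P x) * \prod_j normc (sg j x) = 1.
Proof.
move=> x0 uS SP SF; have [a [b [Oa Ob b0 ex]]] := fraction x.
have a0 : a != 0 by apply: contraNneq x0 => e; rewrite ex e mul0r.
have [|T [uT TP TF]] := @prime_support_seq R K [:: a; b].
  by rewrite !inE !negb_or ![0 == _]eq_sym a0 b0.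
have xb : x * b = a by rewrite ex divfK.
pose U := undup (S ++ T).
have uU : uniq U by apply: undup_uniq.
have UP : {in U, forall P, nonzero_primes P}.
  by move=> P; rewrite mem_undup mem_cat => /orP[/SP|/TP].
have UF y : y \in [:: a; b] -> forall P, nonzero_primes P -> P \notin U -> abs_prime R P y = 1.
  move=> yab P nzP; rewrite mem_undup mem_cat negb_or => /andP[_ nT].
  exact: TF.
have Fa := product_formula_OK Oa a0 uU UP (UF a (mem_head _ _)).
have Fb := product_formula_OK Ob b0 uU UP (UF b _).
rewrite !inE eqxx orbT in Fb.
have -> : \prod_(P <- S) abs_prime R P x = \prod_(P <- U) abs_prime R P x.
  have -> : \prod_(P <- S) abs_prime R P x = \prod_(P <- U | P \in S) abs_prime R P x.
    rewrite -[RHS]big_filter; apply: perm_big; apply: uniq_perm => //; first exact: filter_uniq.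
    by move=> P; rewrite mem_filter mem_undup mem_cat; case: (P \in S).
  rewrite [RHS]big_seq [LHS]big_seq_cond [RHS](bigID (mem S)) /= [X in _ = _ * X]big1 ?mulr1 //.
  by move=> P /andP[/UP nzP nS]; apply: SF.
(* Multiplying by the formula for [b], whose value is 1, turns the factors of [x] into those of
   [x b = a]. *)
rewrite -[LHS]mulr1 -[X in _ * X](Fb isT) mulrACA -!big_split /= -[RHS]Fa.
congr (_ * _).
  rewrite big_seq [RHS]big_seq; apply: eq_bigr => P /UP nzP.
  by rewrite -(abs_M (abs_prime_value R nzP)) xb.
by apply: eq_bigr => j _; rewrite -Normc.normcM -rmorphM xb.
Qed.

End Places.

(** * Landau's inequality *)

Section ComplexPoly.
Variable R : realType.
Implicit Types (z : R[i]) (p g : {poly R[i]}) (zs : seq R[i]).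
Local Notation normc := (@Normc.normc R).

Lemma unit_circle_bound p u n (h : R) : (size p <= n)%N -> normc u = 1 ->
  (forall i, normc p`_i <= h) -> normc p.[u] <= n%:R * h.
Proof.
move=> sp nu ph; rewrite (horner_coef_wide _ sp).
apply: le_trans (normc_sum _ _ _) _.
apply: (@le_trans _ _ (\sum_(i < n) h)); last first.
  by rewrite sumr_const card_ord mulr_natl.
apply: ler_sum => i _; rewrite Normc.normcM normcX nu expr1n mulr1.
exact: ph.
Qed.

Lemma eval_bound a zs w (h : R) : (0 < w)%N ->
  (forall i, normc (a *: \prod_(z <- zs) ('X - z%:P))`_i <= h) ->
  normc a ^+ w * \prod_(z <- zs) normc (z ^+ w + 1) <= ((size zs).+1%:R * h) ^+ w.
Proof.
set p := _ *: _ => w0 ph.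
have [us eus] := closed_field_poly_normal ('X^w + 1 : {poly R[i]}).
have mon : 'X^w + 1 \is @monic R[i].
  by rewrite -[1]opprK -polyCN; apply: monicXnsubC.
rewrite (monicP mon) scale1r in eus.
have sus : size us = w.
  have := congr1 (fun q : {poly R[i]} => size q) eus.
  by rewrite size_prod_XsubC -[1]opprK -polyCN size_XnsubC // => -[].
have nu u : u \in us -> normc u = 1.
  move=> uus; have : root ('X^w + 1 : {poly R[i]}) u by rewrite eus root_prod_XsubC.
  rewrite /root !hornerE addr_eq0 => /eqP e.
  have : normc u ^+ w = 1 by rewrite -normcX e normc_opp Normc.normc1.
  by move=> /eqP; rewrite pexpr_eq1 // ?normc_ge0 // => /eqP.
have sp : (size p <= (size zs).+1)%N.
  by apply: leq_trans (size_scale_leq _ _) _; rewrite size_prod_XsubC.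
have zE z : \prod_(u <- us) normc (u - z) = normc (z ^+ w + 1).
  have -> : z ^+ w + 1 = \prod_(u <- us) (z - u).
    have := congr1 (fun q : {poly R[i]} => q.[z]) eus.
    rewrite !hornerE => ->; rewrite horner_prod.
    by apply: eq_bigr => u _; rewrite hornerXsubC.
  by rewrite normc_prod; apply: eq_bigr => u _; rewrite -normc_opp opprB.
have -> : normc a ^+ w * \prod_(z <- zs) normc (z ^+ w + 1) = \prod_(u <- us) normc p.[u].
  under eq_bigr do rewrite -zE.
  rewrite exchange_big /= -sus.
  have -> : normc a ^+ size us = \prod_(u <- us) normc a.
    by rewrite big_const_seq count_predT -Monoid.iteropE.
  rewrite -big_split /=; apply: eq_bigr => u _.
  rewrite hornerZ Normc.normcM horner_prod normc_prod; congr (_ * _).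
  by apply: eq_bigr => z _; rewrite hornerXsubC.
have -> : ((size zs).+1%:R * h) ^+ w = \prod_(u <- us) ((size zs).+1%:R * h).
  by rewrite big_const_seq count_predT sus -Monoid.iteropE.
rewrite big_seq [leRHS]big_seq; apply: ler_prod => u uus; rewrite normc_ge0 /=.
exact: unit_circle_bound (nu u uus) ph.
Qed.

(** Coefficientwise trace of the fact that [X - z] and [1 - conj(z) X] have the same modulus on the
    unit circle; [a] and [b] stand for consecutive coefficients of a cofactor. *)
Lemma normc_swap z a b :
  normc (a - z * b) ^+ 2 - normc (b - z^* * a) ^+ 2 =
  (1 - normc z ^+ 2) * (normc a ^+ 2 - normc b ^+ 2).
Proof.
case: z => zr zi; case: a => ar ai; case: b => br bi.
rewrite /Normc.normc /= !sqr_sqrtr ?addr_ge0 ?sqr_ge0 //.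
by ring.
Qed.

Definition l2 n p : R := \sum_(i < n) normc p`_i ^+ 2.

(** By [normc_swap] the difference of the sums telescopes to [1 - |z|^2] times a difference of
    boundary terms, and both vanish, the last one because [size g < n]. *)
Lemma l2_swap n z g : (size g < n)%N ->
  l2 n (('X - z%:P) * g) = l2 n ((1 - z^* *: 'X) * g).
Proof.
move=> sg; apply/eqP; rewrite -subr_eq0 /l2 -sumrB; apply/eqP.
pose t i := if i is i'.+1 then normc g`_i' ^+ 2 else 0.
have tE (i : 'I_n) : normc (('X - z%:P) * g)`_i ^+ 2 - normc ((1 - z^* *: 'X) * g)`_i ^+ 2
    = (1 - normc z ^+ 2) * (t i - t i.+1).
  rewrite [('X - _) * g]mulrBl [(1 - _) * g]mulrBl !coefB mul1r -scalerAl coefZ coefCM !coefXM.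
  case: i => -[|i] lt /=.
    by rewrite normc_swap Normc.normc0 expr0n.
  by rewrite normc_swap.
rewrite (eq_bigr _ (fun i _ => tE i)) -mulr_sumr.
rewrite -(big_mkord xpredT (fun i => t i - t i.+1)).
under eq_bigr do rewrite -opprB.
rewrite sumrN telescope_sumr //; case: n sg {tE} => // n sg /=.
by rewrite nth_default ?Normc.normc0 ?expr0n ?subrr ?oppr0 ?mulr0.
Qed.

(** Roots outside the unit disk are reflected into it without changing [l2] of the product. The
    leading coefficient acquires the modulus [max(1, |z|)], so the Mahler measure becomes a single
    coefficient. *)
Definition reflect_root z : {poly R[i]} :=
  if normc z <= 1 then 'X - z%:P else 1 - z^* *: 'X.

Lemma size_reflect_root z : (size (reflect_root z) <= 2)%N.
Proof.
rewrite /reflect_root; case: ifP => _; first by rewrite size_XsubC.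
apply: leq_trans (size_polyD _ _) _; rewrite size_polyN geq_max size_poly1 /=.
by apply: leq_trans (size_scale_leq _ _) _; rewrite size_polyX.
Qed.

Lemma l2_reflect n zs g : (size g + size zs <= n)%N ->
  l2 n ((\prod_(z <- zs) ('X - z%:P)) * g) = l2 n ((\prod_(z <- zs) reflect_root z) * g).
Proof.
elim: zs g => [|z zs IH] g; first by rewrite !big_nil.
rewrite /= addnS => sn; rewrite !big_cons -!mulrA.
have sg : (size ((\prod_(z <- zs) ('X - z%:P)) * g)%R < n)%N.
  apply: leq_ltn_trans (size_polyMleq _ _) _; rewrite size_prod_XsubC.
  by rewrite addSn /= addnC.
have -> : l2 n (('X - z%:P) * ((\prod_(z <- zs) ('X - z%:P)) * g)) =
    l2 n (reflect_root z * ((\prod_(z <- zs) ('X - z%:P)) * g)).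
  by rewrite /reflect_root; case: ifP => // _; apply: l2_swap.
rewrite mulrCA [in RHS]mulrCA; apply: IH.
apply: leq_trans (leq_add (size_polyMleq _ _) (leqnn _)) _.
apply: leq_trans sn; rewrite -addSn leq_add2r.
rewrite -subn1 leq_subLR add1n.
exact: leq_trans (leq_add (size_reflect_root z) (leqnn _)) _.
Qed.

(* Landau's inequality, up to the harmless replacement of the square root of
   the degree by the degree. *)
Lemma landau a zs (h : R) : 0 <= h ->
  (forall i, normc (a *: \prod_(z <- zs) ('X - z%:P))`_i <= h) ->
  normc a * \prod_(z <- zs) Num.max 1 (normc z) <= (size zs).+1%:R * h.
Proof.
move=> h0 ph; have [->|a0] := eqVneq a 0.
  by rewrite Normc.normc0 mul0r mulr_ge0.
pose q := (\prod_(z <- zs) reflect_root z) * a%:P.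
have leadE z : normc (lead_coef (reflect_root z)) = Num.max 1 (normc z).
  rewrite /reflect_root; have [le|lt] := leP (normc z) 1.
    by rewrite lead_coefXsubC Normc.normc1.
  have z0 : z^* != 0.
    rewrite conjC_eq0; apply: contraTneq lt => ->.
    by rewrite Normc.normc0 -leNgt ler01.
  rewrite addrC lead_coefDl; last first.
    by rewrite size_polyN size_scale // size_polyX size_poly1.
  rewrite lead_coefN lead_coefZ lead_coefX mulr1 normc_opp.
  by apply: complexI; rewrite -!normcE norm_conjC.
have lq : normc (lead_coef q) = normc a * \prod_(z <- zs) Num.max 1 (normc z).
  rewrite lead_coefM lead_coefC Normc.normcM mulrC lead_coef_prod normc_prod.
  by congr (_ * _); apply: eq_bigr => z _; rewrite leadE.
have sa : (size a%:P + size zs <= (size zs).+1)%N.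
  by rewrite size_polyC a0 add1n.
have l2q : l2 (size zs).+1 q = l2 (size zs).+1 (a *: \prod_(z <- zs) ('X - z%:P)).
  by rewrite -mul_polyC mulrC /q l2_reflect.
have sq : (size q <= (size zs).+1)%N.
  apply: leq_trans (size_polyMleq _ _) _; rewrite size_polyC a0 addn1 /=.
  elim: {+}zs => [|z s IH]; first by rewrite big_nil size_poly1.
  rewrite big_cons; apply: leq_trans (size_polyMleq _ _) _.
  rewrite -subn1 leq_subLR.
  exact: leq_trans (leq_add (size_reflect_root z) IH) (leqnn _).
have n0 : 0 <= (size zs).+1%:R * h by apply: mulr_ge0.
rewrite -lq -(@ler_pXn2r _ 2) ?nnegrE ?normc_ge0 //.
apply: (@le_trans _ _ (l2 (size zs).+1 q)).
  have q0 : q != 0.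
    rewrite -lead_coef_eq0 -normc_gt0 lq.
    rewrite mulr_gt0 ?normc_gt0 //; apply: prodr_gt0 => z _.
    by rewrite lt_max ltr01.
  have lt : ((size q).-1 < (size zs).+1)%N by rewrite prednK // size_poly_gt0.
  rewrite /l2 (bigD1 (Ordinal lt)) //= -lead_coefE lerDl sumr_ge0 // => i _.
  exact: sqr_ge0.
rewrite l2q /l2; apply: (@le_trans _ _ (\sum_(i < (size zs).+1) h ^+ 2)).
  by apply: ler_sum => i _; rewrite ler_pXn2r ?nnegrE ?normc_ge0.
rewrite sumr_const card_ord -[leLHS]mulr_natl exprMn ler_wpM2r ?sqr_ge0 //.
by rewrite expr2 ler_peMr // ler1n.
Qed.

End ComplexPoly.

Lemma integral_of_abs (R : realType) (K : fieldExtType rat) (x : K) :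
  (forall P, nonzero_primes P -> abs_prime R P x <= 1) -> OK x.
Proof.
have [->|x0] := eqVneq x 0; first by move=> _; apply: OK0.
have [a [b [Oa Ob b0 ex]]] := fraction x => H.
have a0 : a != 0 by apply: contraNneq x0 => e; rewrite ex e mul0r.
rewrite ex; apply: local_integral => // P nzP; have := H P nzP.
rewrite abs_primeE // -(expr0z (ideal_norm P)%:R) (ler_eXz2l (norm_prime_gt1 R nzP)).
by rewrite ex ord_primeE //; lia.
Qed.

(** * Heights of split polynomials *)

Section Heights.
Variables (R : realType) (K : fieldExtType rat).
Local Notation OK := (@OK K).
Local Notation d := (\dim {:K}).
Local Notation normc := (@Normc.normc R).
Local Notation absP := (@abs_prime R K).

(** The norm of the denominator ideal of [r], formed by the integers [y] of [K] for which [y r] is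
    integral. *)
Definition denom (r : K) : R :=
  \big[*%R/1]_(P \in @nonzero_primes K) Num.max 1 (absP P r).

Lemma prod_primesE (F : set K -> R) (S : seq (set K)) :
    uniq S -> {in S, forall P, nonzero_primes P} ->
    (forall P, nonzero_primes P -> P \notin S -> F P = 1) ->
  \big[*%R/1]_(P \in @nonzero_primes K) F P = \prod_(P <- S) F P.
Proof.
move=> uS SP SF; rewrite (fsbigE S) //.
rewrite big_seq_cond [RHS]big_seq_cond; apply: eq_bigl => P.
by case PS: (P \in S) => //=; apply/mem_set; apply: SP.
Qed.

Lemma denomE (r : K) (S : seq (set K)) : uniq S -> {in S, forall P, nonzero_primes P} ->
    (forall P, nonzero_primes P -> P \notin S -> absP P r = 1) ->
  denom r = \prod_(P <- S) Num.max 1 (absP P r).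
Proof.
move=> uS SP SF; apply: prod_primesE => // P nzP nS.
by rewrite SF // maxxx.
Qed.

Lemma denom_ge1 r : r != 0 -> 1 <= denom r.
Proof.
move=> r0; have [|S [uS SP SF]] := @prime_support_seq R K [:: r].
  by rewrite inE eq_sym.
rewrite (denomE uS SP); last by move=> P nzP nS; apply: SF => //; rewrite mem_head.
elim/big_ind: _ => // [x y x1 y1|P _]; last by rewrite le_max lexx.
by rewrite -[leLHS]mulr1 ler_pM.
Qed.

Lemma abs_prime_expz P (x : K) : nonzero_primes P -> x != 0 ->
  absP P x = (ideal_norm P)%:R ^ (- ord_prime P x).
Proof. by move=> nzP x0; rewrite abs_primeE. Qed.

Lemma max_prime_exp P (r : K) : nonzero_primes P -> r != 0 ->
  exists k : nat, Num.max 1 (absP P r) = (ideal_norm P)%:R ^+ k.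
Proof.
move=> nzP r0; have [le|lt] := leP (absP P r) 1; first by exists 0%N.
move: lt; rewrite abs_prime_expz // -{1}(expr0z (ideal_norm P)%:R).
rewrite (ltr_eXz2l (norm_prime_gt1 R nzP)) => lt.
by exists `|ord_prime P r|%N; rewrite exprnP; congr (_ ^ _); lia.
Qed.

Lemma prime_ratio_exp P (r y : K) k : nonzero_primes P -> r != 0 -> y != 0 ->
    absP P y <= Num.max 1 (absP P r) ^+ k ->
  exists e : nat, Num.max 1 (absP P r) ^+ k = absP P y * (ideal_norm P)%:R ^+ e.
Proof.
move=> nzP r0 y0; have [m ->] := max_prime_exp nzP r0.
rewrite abs_prime_expz // -exprM exprnP (ler_eXz2l (norm_prime_gt1 R nzP)) => le.
exists (absz ((m * k)%:Z + ord_prime P y)).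
rewrite [_ ^+ absz _]exprnP -exprzDr ?norm_prime_unit //; congr (_ ^ _).
lia.
Qed.

Variables (th : K) (sg : 'I_d -> {rmorphism K -> R[i]}).
Hypothesis Oth : OK th.
Hypothesis coordP : forall x, exists c : 'rV[rat]_d, x = \sum_i c 0 i *: th ^+ i.
Hypothesis sg_inj : injective (fun j => sg j th).
Hypothesis sg_surj : forall t : {rmorphism K -> R[i]}, exists j, t =1 sg j.

(** The hypothesis says that the [k]-th power of the denominator ideal of [r] clears the
    denominators of [y]; by the product formula for [y], the left side is then the norm of an
    integral ideal. The exponents are recorded because over Q(i) the values of this norm matter, not
    only its size. *)
Lemma denom_norm (r y : K) k : r != 0 -> y != 0 ->
    (forall P, nonzero_primes P -> absP P y <= Num.max 1 (absP P r) ^+ k) ->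
  exists (S : seq (set K)) (e : set K -> nat), {in S, forall P, nonzero_primes P} /\
    denom r ^+ k * \prod_j normc (sg j y) = \prod_(P <- S) (ideal_norm P)%:R ^+ e P.
Proof.
move=> r0 y0 le; have [|S [uS SP SF]] := @prime_support_seq R K [:: r; y].
  by rewrite !inE !negb_or ![0 == _]eq_sym r0 y0.
have Fr P : nonzero_primes P -> P \notin S -> absP P r = 1.
  by move=> nzP nS; apply: SF => //; rewrite mem_head.
have Fy P : nonzero_primes P -> P \notin S -> absP P y = 1.
  by move=> nzP nS; apply: SF => //; rewrite !inE eqxx orbT.
have ex P : exists e : nat, nonzero_primes P ->
    Num.max 1 (absP P r) ^+ k = absP P y * (ideal_norm P)%:R ^+ e.
  have [nzP|] := pselect (nonzero_primes P); last by exists 0%N.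
  by have [e He] := prime_ratio_exp nzP r0 y0 (le P nzP); exists e.
have [e eP] := choice ex; exists S, e; split=> //.
have pf := product_formula Oth coordP sg_inj y0 uS SP Fy.
rewrite (denomE uS SP Fr) -prodrXl.
have -> : \prod_(P <- S) Num.max 1 (absP P r) ^+ k =
    (\prod_(P <- S) absP P y) * \prod_(P <- S) (ideal_norm P)%:R ^+ e P.
  by rewrite -big_split /= big_seq [RHS]big_seq; apply: eq_bigr => P /SP; apply: eP.
by rewrite mulrAC pf mul1r.
Qed.

Lemma denom_norm_ge1 (r y : K) k : r != 0 -> y != 0 ->
    (forall P, nonzero_primes P -> absP P y <= Num.max 1 (absP P r) ^+ k) ->
  1 <= denom r ^+ k * \prod_j normc (sg j y).
Proof.
move=> r0 y0 le; have [S [e [SP ->]]] := denom_norm r0 y0 le.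
rewrite big_seq; elim/big_ind: _ => // [x z x1 z1|P /SP nzP].
  by rewrite -[leLHS]mulr1 ler_pM.
by apply: exprn_ege1; apply: ltW; apply: norm_prime_gt1.
Qed.

(** Each prime contains its own norm, so at every [P] the integer [m] is divisible by at least the
    power of [P] in the denominator of [r]. *)
Lemma denom_integral (r : K) : r != 0 ->
  exists m : nat, [/\ (0 < m)%N, denom r = m%:R & OK (m%:R * r)].
Proof.
move=> r0; have [|S [uS SP SF]] := @prime_support_seq R K [:: r].
  by rewrite inE eq_sym.
have Fr P : nonzero_primes P -> P \notin S -> absP P r = 1.
  by move=> nzP nS; apply: SF => //; rewrite mem_head.
have ex P : exists e : nat, nonzero_primes P ->
    Num.max 1 (absP P r) = (ideal_norm P)%:R ^+ e.
  have [nzP|] := pselect (nonzero_primes P); last by exists 0%N.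
  by have [e He] := max_prime_exp nzP r0; exists e.
have [e eP] := choice ex.
pose m := (\prod_(P <- S) ideal_norm P ^ e P)%N.
have dm : denom r = m%:R.
  rewrite (denomE uS SP Fr) natr_prod big_seq [RHS]big_seq; apply: eq_bigr => P /SP nzP.
  by rewrite eP // natrX.
have m0 : (0 < m)%N by have := denom_ge1 r0; rewrite dm ler1n.
exists m; split=> //; apply: (@integral_of_abs R) => P nzP.
have av := abs_prime_value R nzP; rewrite (abs_M av).
have [PS|nS] := boolP (P \in S); last first.
  by rewrite Fr // mulr1; apply: abs_prime_OK => //; apply: OK_nat.
rewrite {m0 dm}/m (bigD1_seq P) //= natrM (abs_M av) -mulrA mulrCA.
set u := absP P (\prod_(_ <- _ | _) _)%:R.
have u1 : u <= 1 by apply: abs_prime_OK => //; apply: OK_nat.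
apply: (@le_trans _ _ (1 * 1)); last by rewrite mulr1.
apply: ler_pM => //; first exact: (abs_ge0 av).
  by apply: mulr_ge0; apply: (abs_ge0 av).
apply: (@le_trans _ _ (absP P (ideal_norm P ^ e P)%N%:R * Num.max 1 (absP P r))).
  by apply: ler_wpM2l; [apply: (abs_ge0 av) | rewrite le_max lexx orbT].
rewrite eP // natrX (abs_X _ _ av) -exprMn.
have N1 := norm_prime_gt1 R nzP.
have N0 : 0 < (ideal_norm P)%:R :> R by apply: lt_trans ltr01 N1.
apply: exprn_ile1.
  by apply: mulr_ge0; [apply: (abs_ge0 av) | apply: ltW].
have NK0 : (ideal_norm P)%:R != 0 :> K.
  by rewrite -(mulr1z _%:R) pmulrn intK_eq0; have := ideal_norm_gt1 nzP; lia.
rewrite abs_prime_expz // ord_prime_OK //; last exact: OK_nat.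
rewrite -[X in _ * X <= _]expr1z -exprzDr ?norm_prime_unit // -(expr0z (ideal_norm P)%:R).
rewrite (ler_eXz2l N1); have := ord_int_gt0 nzP NK0 (ideal_norm_mem nzP); lia.
Qed.

Lemma M_eltE (r : K) : M_elt R r = denom r * \prod_j Num.max 1 (normc (sg j r)).
Proof. by rewrite /M_elt /prod_places (prod_embeddings sg_inj sg_surj). Qed.

Lemma prod_max_ge (z : 'I_d -> R) i : z i <= \prod_j Num.max 1 (z j).
Proof.
rewrite (bigD1 i) //=; apply: (@le_trans _ _ (Num.max 1 (z i))).
  by rewrite le_max lexx orbT.
rewrite ler_peMr //; first by rewrite le_max ler01.
elim/big_ind: _ => // [x y x1 y1|j _]; last by rewrite le_max lexx.
by rewrite -[leLHS]mulr1 ler_pM.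
Qed.

Lemma prod_max_ge1 (z : 'I_d -> R) : 1 <= \prod_j Num.max 1 (z j).
Proof.
elim/big_ind: _ => // [x y x1 y1|j _]; last by rewrite le_max lexx.
by rewrite -[leLHS]mulr1 ler_pM.
Qed.

(** A bound [B] on [M_elt] bounds both the denominator [m] of [x] and its conjugates. The integer
    [m x] then has conjugates at most [B * B], which leaves finitely many choices for it and for
    [m]. *)
Theorem northcott (B : R) : exists s : seq K, forall x, x != 0 -> M_elt R x <= B -> x \in s.
Proof.
have [s0 s0P] := bounded_integers Oth coordP sg_inj (B * B)%:C%C (@normc_archi R).
have [nB hB] : exists n : nat, 0 <= B -> B <= n%:R.
  by exists (Num.bound B) => B0; apply: ltW; apply: archi_boundP.
exists [seq y / m%:R | y <- s0, m <- iota 1 nB] => x x0; rewrite M_eltE => xB.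
have D1 := denom_ge1 x0; have Z1 := prod_max_ge1 (fun j => normc (sg j x)).
have D0 : 0 <= denom x by apply: le_trans D1.
have B1 : 1 <= B by apply: le_trans xB; rewrite -[leLHS]mulr1 ler_pM.
have B0 : 0 <= B by apply: le_trans B1.
have DB : denom x <= B by apply: le_trans xB; rewrite ler_peMr.
have ZB j : normc (sg j x) <= B.
  apply: le_trans (prod_max_ge (fun j => normc (sg j x)) j) _.
  by apply: le_trans xB; rewrite ler_peMl // (le_trans ler01).
have [m [m0 dm Om]] := denom_integral x0.
have mK0 : (m%:R : K) != 0.
  by rewrite -(mulr1z _%:R) pmulrn intK_eq0; move: m0; lia.
apply/allpairsP; exists (m%:R * x, m); split=> /=.
- apply: s0P => // j; rewrite normcE lecR rmorphM Normc.normcM rmorph_nat normc_nat.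
  by rewrite -dm ler_pM // normc_ge0.
- rewrite mem_iota m0 /= add1n ltnS -(ler_nat R) -dm.
  by apply: le_trans DB (hB B0).
- by rewrite mulrC mulKf.
Qed.

(** At the primes Gauss's lemma separates [c] from the roots. The product formula moves the
    contribution of [c] to the embeddings, so that the primes contribute only denominators. *)
Theorem height_splitE (c : K) (rs : seq K) : c != 0 -> 0 \notin rs ->
  let f := c *: \prod_(r <- rs) ('X - r%:P) in
  prod_places (gauss_norm f) * \prod_j normc (sg j c) =
  (\prod_(r <- rs) denom r) * \prod_j gauss_norm f (abs_emb (sg j)).
Proof.
move=> c0 rs0 f; have [|S [uS SP SF]] := @prime_support_seq R K (c :: rs).
  by rewrite inE negb_or eq_sym c0.
have Fc P : nonzero_primes P -> P \notin S -> absP P c = 1.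
  by move=> nzP nS; apply: SF => //; rewrite mem_head.
have gP P : nonzero_primes P ->
    gauss_norm f (absP P) = absP P c * \prod_(r <- rs) Num.max 1 (absP P r).
  by move=> nzP; apply: gauss_norm_split; [apply: abs_prime_value | apply: abs_prime_ultra].
rewrite (prod_placesE sg_inj sg_surj uS SP); last first.
  move=> P nzP nS; rewrite gP // Fc // mul1r big_seq big1 // => r rrs.
  by rewrite SF ?maxxx // inE rrs orbT.
have -> : \prod_(P <- S) gauss_norm f (absP P) =
    (\prod_(P <- S) absP P c) * \prod_(r <- rs) denom r.
  rewrite big_seq (eq_bigr _ (fun P PS => gP P (SP P PS))) -big_seq big_split /=.
  congr (_ * _); rewrite exchange_big /= big_seq [RHS]big_seq; apply: eq_bigr => r rrs.
  rewrite (denomE uS SP) // => P nzP nS; apply: SF => //.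
  by rewrite inE rrs orbT.
have pf := product_formula Oth coordP sg_inj c0 uS SP Fc.
by rewrite -[LHS]mulrA [X in _ * X]mulrC mulrACA pf mul1r.
Qed.

Lemma map_split (c : K) (rs : seq K) j :
  map_poly (sg j) (c *: \prod_(r <- rs) ('X - r%:P)) =
  sg j c *: \prod_(z <- map (sg j) rs) ('X - z%:P).
Proof.
rewrite map_polyZ rmorph_prod big_map; congr (_ *: _).
by apply: eq_bigr => r _; rewrite rmorphB /= map_polyX map_polyC.
Qed.

Lemma emb_coef_le (c : K) (rs : seq K) j i :
  normc (sg j c *: \prod_(z <- map (sg j) rs) ('X - z%:P))`_i <=
  gauss_norm (c *: \prod_(r <- rs) ('X - r%:P)) (abs_emb (sg j)).
Proof.
by rewrite -map_split coef_map /=; apply: gauss_norm_ge; apply: abs_emb_value.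
Qed.

(** Common form of the two estimates, for [F z = |z^w + 1|] and, with [w = 1], for
    [F z = max(1, |z|)]: the inequalities at the embeddings are multiplied and the leading
    coefficient cancels. *)
Lemma height_bound (c : K) (rs : seq K) (w : nat) (F : R[i] -> R) :
    c != 0 -> 0 \notin rs -> (forall z, 0 <= F z) ->
    (forall (a : R[i]) zs (h : R), 0 <= h ->
       (forall i, normc (a *: \prod_(z <- zs) ('X - z%:P))`_i <= h) ->
       normc a ^+ w * \prod_(z <- zs) F z <= ((size zs).+1%:R * h) ^+ w) ->
  \prod_(r <- rs) (denom r ^+ w * \prod_j F (sg j r)) <=
  ((size rs).+1%:R ^+ d *
    prod_places (gauss_norm (c *: \prod_(r <- rs) ('X - r%:P)))) ^+ w.
Proof.
set f := _ *: _ => c0 rs0 F0 bound.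
have hE := height_splitE c0 rs0; rewrite -/f /= in hE.
have f0 : f != 0.
  by rewrite /f scaler_eq0 negb_or c0 monic_neq0 // monic_prod_XsubC.
have c0' j : 0 < normc (sg j c) by rewrite normc_gt0 fmorph_eq0.
have C0 : 0 < \prod_j normc (sg j c) by apply: prodr_gt0 => j _.
have D0 : 0 <= \prod_(r <- rs) denom r.
  rewrite big_seq; apply: prodr_ge0 => r rrs; apply: le_trans ler01 (denom_ge1 _).
  by apply: contraNneq rs0 => <-.
rewrite big_split /= prodrXl exchange_big /=.
rewrite -(ler_pM2r (exprn_gt0 w C0)) -exprMn -[_ * prod_places _ * _]mulrA hE.
rewrite [_ ^+ d * _]mulrCA exprMn -[leLHS]mulrA ler_wpM2l ?exprn_ge0 //.
have -> : (size rs).+1%:R ^+ d = \prod_(j < d) (size rs).+1%:R :> R.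
  by rewrite prodr_const card_ord.
rewrite -big_split /= -!prodrXl -big_split /=; apply: ler_prod => j _.
rewrite mulr_ge0 ?exprn_ge0 ?prodr_ge0 // ?(ltW (c0' j)) //=.
rewrite mulrC -(size_map (sg j)) -(big_map (sg j) xpredT F).
apply: bound; last by move=> i; apply: emb_coef_le.
exact: ltW (gauss_norm_gt0 (abs_emb_value (sg j)) f0).
Qed.

(** The factor of a root [r] over all places. The exponent is left free: besides the number of roots
    of unity, 2, 4 and 6 are used for totally real fields, Q(i) and Q(sqrt(-3)). *)
Definition A_elt w (r : K) : R := denom r ^+ w * \prod_j normc (sg j r ^+ w + 1).

Lemma prod_A_elt_le w (c : K) (rs : seq K) : (0 < w)%N -> c != 0 -> 0 \notin rs ->
  \prod_(r <- rs) A_elt w r <=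
  ((size rs).+1%:R ^+ d * prod_places (gauss_norm (c *: \prod_(r <- rs) ('X - r%:P)))) ^+ w.
Proof.
move=> w0 c0 rs0; apply: (@height_bound c rs w (fun z => normc (z ^+ w + 1))) => //.
  by move=> z; apply: normc_ge0.
by move=> a zs h h0; apply: eval_bound.
Qed.

Lemma prod_M_elt_le (c : K) (rs : seq K) : c != 0 -> 0 \notin rs ->
  \prod_(r <- rs) M_elt R r <=
  (size rs).+1%:R ^+ d * prod_places (gauss_norm (c *: \prod_(r <- rs) ('X - r%:P))).
Proof.
move=> c0 rs0; have := @height_bound c rs 1 (fun z => Num.max 1 (normc z)) c0 rs0.
rewrite /= !expr1; under eq_bigr do rewrite expr1 -M_eltE.
apply; first by move=> z; rewrite le_max ler01.
by move=> a zs h h0 ph; rewrite !expr1; apply: landau.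
Qed.

End Heights.

Lemma seq_min (R : realDomainType) (s : seq R) x : x \in s ->
  exists2 m, m \in s & {in s, forall y, m <= y}.
Proof.
elim: s x => // a s IH x _; case: s IH => [_|b s IH].
  by exists a; rewrite ?mem_head // => y; rewrite inE => /eqP ->.
have [m ms mle] := IH b (mem_head _ _).
have [le|lt] := leP a m.
  exists a; first exact: mem_head.
  by move=> y; rewrite inE => /predU1P[-> //|/mle]; apply: le_trans.
exists m; first by rewrite inE ms orbT.
by move=> y; rewrite inE => /predU1P[->|/mle //]; apply: ltW.
Qed.

Lemma prod_count_ge (R : realDomainType) (T : eqType) (a : pred T) (F : T -> R) (c : R)
    (rs : seq T) : 0 <= c -> {in rs, forall r, 1 <= F r} ->
    {in rs, forall r, a r -> c <= F r} ->
  c ^+ count a rs <= \prod_(r <- rs) F r.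
Proof.
move=> c0; elim: rs => [_ _|r rs IH F1 Fc]; first by rewrite big_nil.
have {}IH : c ^+ count a rs <= \prod_(r <- rs) F r.
  by apply: IH => x xrs; [apply: F1 | apply: Fc]; rewrite inE xrs orbT.
have Fr1 := F1 r (mem_head _ _).
rewrite big_cons /=; case ar: (a r); rewrite ?add1n ?add0n ?exprS.
  by rewrite ler_pM ?exprn_ge0 // Fc ?mem_head.
apply: le_trans IH _; apply: ler_peMl => //.
rewrite big_seq; apply: prodr_ge0 => x xrs; apply: le_trans ler01 _.
by apply: F1; rewrite inE xrs orbT.
Qed.

(** * Kronecker's theorem and admissible constants *)

Section Global.
Variables (R : realType) (K : fieldExtType rat).
Local Notation OK := (@OK K).
Local Notation d := (\dim {:K}).
Local Notation normc := (@Normc.normc R).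
Local Notation absP := (@abs_prime R K).

Definition unity : set K := [set x | exists2 n, (0 < n)%N & n.-unity_root x].

Lemma unityP x : unity x <-> exists2 n, (0 < n)%N & x ^+ n = 1.
Proof. by split=> -[n n0]; rewrite ?unity_rootE => /eqP; exists n; rewrite ?unity_rootE. Qed.

Lemma unity_neq0 x : unity x -> x != 0.
Proof.
move=> /unityP[n n0 xn]; apply: contra_eqN xn => /eqP ->.
by rewrite expr0n gtn_eqF // eq_sym oner_eq0.
Qed.

Lemma unityM x y : unity x -> unity y -> unity (x * y).
Proof.
move=> /unityP[n n0 xn] /unityP[m m0 ym]; apply/unityP; exists (n * m)%N.
  by rewrite muln_gt0 n0.
by rewrite exprMn exprM xn expr1n mul1r mulnC exprM ym expr1n.
Qed.

Lemma unity_OK x : unity x -> OK x.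
Proof.
move=> /unityP[n n0 xn]; exists ('X^n - 1); first by rewrite -polyC1 monicXnsubC.
by rewrite rmorphB rmorph1 /= map_polyXn /root !hornerE xn subrr.
Qed.

Lemma unity_abs (s : {rmorphism K -> R[i]}) x : unity x -> normc (s x) = 1.
Proof.
move=> /unityP[n n0 xn]; have /eqP : normc (s x) ^+ n = 1.
  by rewrite -normcX -rmorphXn xn rmorph1 Normc.normc1.
by rewrite pexpr_eq1 ?normc_ge0 // => /eqP.
Qed.

Lemma unity1 : unity 1.
Proof. by apply/unityP; exists 1%N. Qed.

Variables (th : K) (sg : 'I_d -> {rmorphism K -> R[i]}).
Hypothesis Oth : OK th.
Hypothesis coordP : forall x, exists c : 'rV[rat]_d, x = \sum_i c 0 i *: th ^+ i.
Hypothesis sg_inj : injective (fun j => sg j th).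
Hypothesis sg_surj : forall t : {rmorphism K -> R[i]}, exists j, t =1 sg j.

Lemma deg_gt0 : (0 < d)%N.
Proof. by apply: adim_gt0. Qed.

Lemma M_elt_bounded x : OK x -> (forall j, normc (sg j x) <= 1) -> M_elt R x = 1.
Proof.
move=> Ox x1; rewrite (M_eltE sg_inj sg_surj) /denom fsbig1 => [|P nzP].
  by rewrite mul1r big1 // => j _; apply/max_idPl.
by apply/max_idPl; apply: abs_prime_OK.
Qed.

Lemma M_elt0 : M_elt R (0 : K) = 1.
Proof.
by apply: M_elt_bounded => [|j]; [apply: OK0 | rewrite rmorph0 Normc.normc0 ler01].
Qed.

Lemma M_elt_ge1 (x : K) : 1 <= M_elt R x.
Proof.
have [->|x0] := eqVneq x 0; first by rewrite M_elt0.
by rewrite (M_eltE sg_inj sg_surj) -[leLHS]mulr1 ler_pM // ?denom_ge1 // prod_max_ge1.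
Qed.

(** The bound forces [x] to be integral with all conjugates in the unit disk. Its powers share these
    properties, so they lie in the finite list given by [northcott] and two of them coincide. *)
Theorem kronecker x : x != 0 -> M_elt R x <= 1 -> unity x.
Proof.
move=> x0; rewrite (M_eltE sg_inj sg_surj) => M1.
have D1 := denom_ge1 R x0; have Z1 := prod_max_ge1 (fun j => normc (sg j x)).
have DB : denom R x <= 1.
  by apply: le_trans M1; rewrite ler_peMr // (le_trans ler01).
have ZB j : normc (sg j x) <= 1.
  apply: le_trans (prod_max_ge (fun j => normc (sg j x)) j) _.
  by apply: le_trans M1; rewrite ler_peMl // (le_trans ler01).
have [m [m0 dm Om]] := denom_integral R x0.
have Ox : OK x.
  have m1 : m = 1%N by apply/eqP; rewrite eqn_leq m0 andbT -(ler_nat R) -dm.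
  by rewrite m1 mul1r in Om.
have [s sP] := northcott Oth coordP sg_inj sg_surj 1.
pose t := mkseq (fun k => x ^+ k) (size s).+1.
have : ~~ uniq t.
  apply/negP => ut; have : (size t <= size s)%N.
    apply: uniq_leq_size => // _ /mapP[k _ ->]; apply: sP; first exact: expf_neq0.
    rewrite M_elt_bounded //; first exact: OKX.
    by move=> j; rewrite rmorphXn normcX exprn_ile1 ?normc_ge0.
  by rewrite size_mkseq ltnn.
move=> /(uniqPn 0)[i [j [ij]]]; rewrite size_mkseq => jN.
rewrite !nth_mkseq // ?(ltn_trans ij) // => e; apply/unityP; exists (j - i)%N.
  by rewrite subn_gt0.
by apply: (mulfI (expf_neq0 i x0)); rewrite -exprD subnKC ?mulr1 // ltnW.
Qed.

(** The value at 2 exceeds 1, and by [northcott] only finitely many nonzero elements have a value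
    not above it; the least value above 1 among these is the minimum over [K]. *)
Theorem M_constP : 1 < M_const R K /\ forall x : K, 1 < M_elt R x -> M_const R K <= M_elt R x.
Proof.
pose S := [set m : R | exists2 x : K, m = M_elt R x & 1 < m].
have M2 : 1 < M_elt R (2%:R : K).
  have K2 : 2%:R != 0 :> K.
    by rewrite -(mulr1z _%:R) pmulrn intK_eq0.
  rewrite (M_eltE sg_inj sg_surj); apply: (@lt_le_trans _ _ 2%:R); first by rewrite ltr1n.
  have j0 : 'I_d := Ordinal deg_gt0.
  apply: le_trans (ler_pM _ _ (denom_ge1 R K2) (prod_max_ge (fun j => normc (sg j 2%:R)) j0)) => //.
    by rewrite rmorph_nat normc_nat mul1r.
  exact: normc_ge0.
have [s sP] := northcott Oth coordP sg_inj sg_surj (M_elt R (2%:R : K)).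
have ins (x : K) : 1 < M_elt R x -> M_elt R x <= M_elt R (2%:R : K) ->
    M_elt R x \in [seq M_elt R y | y <- s & 1 < M_elt R y].
  move=> x1 x2; apply: map_f; rewrite mem_filter x1 /=; apply: sP => //.
  by apply: contraTneq x1 => ->; rewrite M_elt0 ltxx.
have [m ms mle] := seq_min (ins _ M2 (lexx _)).
have : [set m | S m /\ lbound S m] (M_const R K).
  apply: xgetPex; exists m; split.
    by move: ms => /mapP[y]; rewrite mem_filter => /andP[y1 _] ->; exists y.
  move=> _ [x -> x1]; have [le|lt] := leP (M_elt R x) (M_elt R (2%:R : K)).
    by apply: mle; apply: ins.
  by apply: le_trans (ltW lt); apply: mle; apply: ins.
move=> [[x ex x1] lb]; split=> // y y1; apply: lb; by exists y.
Qed.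

Lemma unity_finite : finite_set unity.
Proof.
have [s sP] := northcott Oth coordP sg_inj sg_surj 1.
apply: (@sub_finite_set _ _ [set` s]); last exact: finite_seq.
move=> x ux /=; apply: sP; first exact: unity_neq0.
rewrite M_elt_bounded //; first exact: unity_OK.
by move=> j; rewrite unity_abs.
Qed.

Local Notation w := (num_roots_of_unity K).
Let us : seq K := fset_set unity.

Let mem_us x : (x \in us) <-> unity x.
Proof. by rewrite (in_fset_set unity_finite); split=> [/set_mem|/mem_set]. Qed.

Let size_us : size us = w. Proof. by []. Qed.

Let uniq_us : uniq us. Proof. exact: fset_uniq. Qed.

Lemma num_unity_ge (s : seq K) : uniq s -> {in s, forall x, unity x} -> (size s <= w)%N.
Proof. by move=> us' su; apply: uniq_leq_size => // x /su /mem_us. Qed.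

Lemma num_unity_le (s : seq K) : (forall x, unity x -> x \in s) -> (w <= size s)%N.
Proof. by move=> us'; apply: uniq_leq_size => // x /mem_us /us'. Qed.

Lemma num_unity_gt0 : (0 < w)%N.
Proof. by apply: (@num_unity_ge [:: 1]) => // x; rewrite inE => /eqP ->; apply: unity1. Qed.

(** Multiplication by [x] permutes the roots of unity, so the factor [x ^+ w] leaves their product
    unchanged. *)
Lemma unity_exp x : unity x -> x ^+ w = 1.
Proof.
move=> ux; have x0 := unity_neq0 ux.
have pm : perm_eq [seq x * y | y <- us] us.
  have um : uniq [seq x * y | y <- us] by rewrite map_inj_uniq //; apply: mulfI.
  have sub : {subset [seq x * y | y <- us] <= us}.
    by move=> _ /mapP[y /mem_us uy ->]; apply/mem_us; apply: unityM.
  apply: uniq_perm => //.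
  by have [|_ e] := uniq_min_size um sub; first by rewrite size_map.
have p0 : \prod_(y <- us) y != 0.
  rewrite big_seq; elim/big_ind: _ => [|a b|y /mem_us/unity_neq0 //].
    exact: oner_neq0.
  exact: mulf_neq0.
apply: (mulIf p0); rewrite mul1r -{2}(perm_big _ pm) /= big_map big_split /=; congr (_ * _).
by rewrite big_const_seq count_predT -Monoid.iteropE size_us.
Qed.

Lemma unity_poly : 'X^w - 1 = \prod_(x <- us) ('X - x%:P).
Proof.
have := @all_roots_prod_XsubC _ ('X^w - 1 : {poly K}) us.
rewrite -polyC1 (monicP (monicXnsubC _ num_unity_gt0)) scale1r; apply.
- by rewrite size_XnsubC ?num_unity_gt0.
- by apply/allP => x /mem_us ux; rewrite /root !hornerE unity_exp // subrr.
- by rewrite uniq_rootsE.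
Qed.

Lemma unity_splits : exists2 rs : seq K, 0 \notin rs & 'X^w - 1 = \prod_(x <- rs) ('X - x%:P).
Proof.
exists us; last exact: unity_poly.
by apply/negP => /mem_us /unity_neq0; rewrite eqxx.
Qed.

Local Notation H f := (@prod_places R K (gauss_norm f)).

Lemma prod_places_gt0 (c : K) (rs : seq K) : c != 0 -> 0 \notin rs ->
  0 < H (c *: \prod_(r <- rs) ('X - r%:P)).
Proof.
move=> c0 rs0; have := height_splitE Oth coordP sg_inj sg_surj c0 rs0; set f := _ *: _ => /= hE.
have f0 : f != 0.
  by rewrite /f scaler_eq0 negb_or c0 monic_neq0 // monic_prod_XsubC.
have C0 : 0 < \prod_j normc (sg j c).
  by apply: prodr_gt0 => j _; rewrite normc_gt0 fmorph_eq0.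
rewrite -(pmulr_lgt0 _ C0) hE mulr_gt0 //.
  rewrite big_seq; apply: prodr_gt0 => r rrs; apply: lt_le_trans ltr01 (denom_ge1 _ _).
  by apply: contraNneq rs0 => <-.
by apply: prodr_gt0 => j _; apply: gauss_norm_gt0 => //; apply: abs_emb_value.
Qed.

Lemma split_poly n (f : {poly K}) : size f = n.+1 -> splits_with_nonzero_roots f ->
  exists rs : seq K, [/\ size rs = n, 0 \notin rs, lead_coef f != 0 &
    f = lead_coef f *: \prod_(r <- rs) ('X - r%:P)].
Proof.
move=> sf [rs rs0 ef]; have l0 : lead_coef f != 0.
  by rewrite lead_coef_eq0 -size_poly_eq0 sf.
exists rs; split=> //; have := sf; rewrite ef size_scale // size_prod_XsubC.
by case.
Qed.

Lemma ln_heightE f : ln (height R f) = d%:R^-1 * ln (H f).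
Proof. by rewrite /height ln_powR. Qed.

Lemma ln_bound (x y : R) (k w : nat) : 0 < y -> 0 < x ->
  x ^+ k <= y ^+ w -> k%:R * ln x <= w%:R * ln y.
Proof.
by move=> y0 x0 le; rewrite !mulr_natl -!lnXn // ler_ln ?posrE ?exprn_gt0.
Qed.

Lemma ln_height_bound (x : R) (k w : nat) n f : 0 < x -> 0 < H f ->
    x ^+ k <= (n.+1%:R ^+ d * H f) ^+ w ->
  k%:R * ln x <= w%:R * d%:R * (ln n.+1%:R + ln (height R f)).
Proof.
move=> x0 H0 le; have n0 : 0 < n.+1%:R ^+ d :> R by rewrite exprn_gt0.
apply: le_trans (ln_bound _ x0 le) _; first exact: mulr_gt0.
rewrite lnM ?posrE // lnXn // ln_heightE -[ln _ *+ _]mulr_natl -[leRHS]mulrA ler_wpM2l // mulrDr.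
by rewrite mulrA mulfV ?mul1r // pnatr_eq0 -lt0n deg_gt0.
Qed.

Lemma ln2_gt0 : 0 < ln 2 :> R.
Proof. by rewrite ln_gt0 // ltr1n. Qed.

(** The error term is [g(n) = c log(n + 1)], which is o(n). *)
Lemma admissible_intro (c : R) :
    (forall n (f : {poly K}), size f = n.+1 -> splits_with_nonzero_roots f ->
      n%:R <= c * (ln n.+1%:R + ln (height R f))) ->
  admissible_constants K c.
Proof.
move=> bound; exists (fun n => c * ln n.+1%:R); last first.
  by move=> n f sf /(bound n f sf); rewrite mulrDr lerBlDl.
apply/eqoP => e e0.
near=> n.
have n1 : 1 <= n%:R :> R by near: n; apply: nbhs_infty_ger.
(* With [log(n + 1) <= 2 sqrt(n + 1)], the squared claim follows from
   [4 c^2 (n + 1) <= 8 c^2 n <= e^2 n^2]. *)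
have nc : 8 * c ^+ 2 / e ^+ 2 <= n%:R by near: n; apply: nbhs_infty_ger.
have n0 : 0 <= n%:R :> R by [].
rewrite normrM [ `|n%:R| ]ger0_norm // [ `|ln _| ]ger0_norm ?ln_ge0 ?ler1n //.
have s0 : 0 < Num.sqrt n.+1%:R :> R by rewrite sqrtr_gt0.
have lns : ln n.+1%:R <= 2 * Num.sqrt n.+1%:R :> R.
  rewrite -{1}[n.+1%:R]sqr_sqrtr // lnXn // -[ln _ *+ _]mulr_natl ler_wpM2l //.
  exact: ltW (ln_sublinear s0).
apply: le_trans (ler_wpM2l (normr_ge0 c) lns) _.
have L0 : 0 <= `|c| * (2 * Num.sqrt n.+1%:R) by rewrite mulr_ge0 // mulr_ge0 // ltW.
have R0 : 0 <= e * n%:R by rewrite mulr_ge0 // ltW.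
rewrite -(@ler_pXn2r _ 2) ?nnegrE //.
rewrite !exprMn sqr_sqrtr // real_normK ?num_real // -[n.+1%:R]natr1.
have e20 : 0 < e ^+ 2 by rewrite exprn_gt0.
move: nc; rewrite ler_pdivrMr // => nc.
apply: (@le_trans _ _ (8 * c ^+ 2 * n%:R)).
  have c20 := sqr_ge0 c.
  have -> : c ^+ 2 * (2 ^+ 2 * (n%:R + 1)) = (4 * c ^+ 2) * (n%:R + 1) by ring.
  have -> : 8 * c ^+ 2 * n%:R = (4 * c ^+ 2) * (n%:R + n%:R) by ring.
  by rewrite ler_wpM2l ?lerD2l // mulr_ge0.
have -> : e ^+ 2 * n%:R ^+ 2 = n%:R * e ^+ 2 * n%:R by ring.
exact: ler_wpM2r.
Unshelve. all: by end_near.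
Qed.

Lemma admissible_A_elt v : (0 < v)%N -> (forall r, r != 0 -> 2 ^+ d <= A_elt sg v r) ->
  admissible_constants K (v%:R / ln 2 : R).
Proof.
move=> v0 Av; apply: admissible_intro => n f sf spf.
have [rs [srs rs0 c0 ef]] := split_poly sf spf.
have H0 : 0 < H f by rewrite ef prod_places_gt0.
have := prod_A_elt_le Oth coordP sg_inj sg_surj v0 c0 rs0; rewrite -ef srs => le.
have : 2 ^+ (d * n) <= (n.+1%:R ^+ d * H f) ^+ v.
  apply: le_trans le; rewrite exprM -srs -count_predT; apply: prod_count_ge => //.
  - move=> r rrs; apply: le_trans (Av r _); first by rewrite exprn_ege1 // ler1n.
    by apply: contraNneq rs0 => <-.
  - by move=> r rrs _; apply: Av; apply: contraNneq rs0 => <-.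
move=> /(ln_height_bound (ltr0Sn _ _) H0).
rewrite natrM mulrAC [v%:R * d%:R]mulrC -!mulrA ler_pM2l ?ltr0n ?deg_gt0 // => {}le.
by rewrite mulrCA ler_pdivlMl ?ln2_gt0.
Qed.

Lemma A_elt_unity r : unity r -> A_elt sg w r = 2 ^+ d.
Proof.
move=> ur; have r0 := unity_neq0 ur.
have -> : A_elt sg w r = denom R r ^+ w * \prod_(j < d) 2.
  congr (_ * _); apply: eq_bigr => j _.
  by rewrite -rmorphXn unity_exp // rmorph1 -[1 + 1]/(2%:R) normc_nat.
have -> : denom R r = 1.
  by apply: fsbig1 => P nzP; apply/max_idPl; apply: abs_prime_OK => //; apply: unity_OK.
by rewrite expr1n mul1r prodr_const card_ord.
Qed.

Lemma abs_exp_addr_le P (r t : K) k : nonzero_primes P -> OK t ->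
  absP P (r ^+ k + t) <= Num.max 1 (absP P r) ^+ k.
Proof.
move=> nzP Ot; have av := abs_prime_value R nzP.
apply: le_trans (abs_prime_ultra R nzP (r ^+ k) t) _; rewrite ge_max; apply/andP; split.
  rewrite (abs_X _ _ av); case: k => [//|k].
  by rewrite ler_pXn2r ?nnegrE ?(abs_ge0 av) ?le_max ?lexx ?ler01 ?orbT.
apply: le_trans (abs_prime_OK R nzP Ot) _; apply: exprn_ege1.
by rewrite le_max lexx.
Qed.

(** The point is that [r^w] differs from -1: otherwise [r] would be a root of unity, hence
    [r^w = 1]. *)
Lemma A_elt_ge1 r : r != 0 -> 1 <= A_elt sg w r.
Proof.
move=> r0; have y0 : r ^+ w + 1 != 0.
  apply/negP; rewrite addr_eq0 => /eqP e.
  have ur : unity r.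
    apply/unityP; exists (w * 2)%N; first by rewrite muln_gt0 num_unity_gt0.
    by rewrite exprM e sqrrN expr1n.
  have : (2%:R : K) == 0.
    by rewrite -[2%:R]/(1 + 1) addr_eq0 -e unity_exp.
  by rewrite -(mulr1z _%:R) pmulrn intK_eq0.
have := denom_norm_ge1 Oth coordP sg_inj (k := w) r0 y0.
have -> : A_elt sg w r = denom R r ^+ w * \prod_j normc (sg j (r ^+ w + 1)).
  by congr (_ * _); apply: eq_bigr => j _; rewrite rmorphD rmorphXn rmorph1.
apply=> P nzP; apply: abs_exp_addr_le => //.
exact: OK1.
Qed.

Theorem admissible_upper :
  admissible_constants K (w%:R / ln 2 + d%:R / ln (M_const R K) : R).
Proof.
have [M1 Mle] := M_constP; have lnM0 := ln_gt0 M1.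
apply: admissible_intro => n f sf spf.
have [rs [srs rs0 c0 ef]] := split_poly sf spf.
have rsn0 r : r \in rs -> r != 0 by move=> rrs; apply: contraNneq rs0 => <-.
have H0 : 0 < H f by rewrite ef prod_places_gt0.
pose a := [pred r | `[< unity r >]].
have le1 : (count a rs)%:R <= w%:R / ln 2 * (ln n.+1%:R + ln (height R f)).
  have : 2 ^+ (d * count a rs) <= (n.+1%:R ^+ d * H f) ^+ w.
    have := prod_A_elt_le Oth coordP sg_inj sg_surj num_unity_gt0 c0 rs0; rewrite -ef srs.
    apply: le_trans; rewrite exprM; apply: prod_count_ge.
    - exact: exprn_ge0.
    - by move=> r /rsn0; apply: A_elt_ge1.
    - by move=> r rrs /asboolP /A_elt_unity ->.
  move=> /(ln_height_bound (ltr0Sn _ _) H0).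
  rewrite natrM mulrAC [w%:R * d%:R]mulrC -!mulrA ler_pM2l ?ltr0n ?deg_gt0 // => {}le.
  by rewrite mulrCA ler_pdivlMl ?ln2_gt0.
have le2 : (count (predC a) rs)%:R <= d%:R / ln (M_const R K) * (ln n.+1%:R + ln (height R f)).
  have : M_const R K ^+ count (predC a) rs <= (n.+1%:R ^+ d * H f) ^+ 1.
    have := prod_M_elt_le Oth coordP sg_inj sg_surj c0 rs0; rewrite -ef srs expr1.
    apply: le_trans; apply: prod_count_ge.
    - by rewrite (le_trans ler01) // ltW.
    - by move=> r _; apply: M_elt_ge1.
    - move=> r /rsn0 r0 /= /asboolP nur; apply: Mle; rewrite ltNge; apply/negP => le.
      by apply: nur; apply: kronecker.
  move=> /(ln_height_bound (lt_trans ltr01 M1) H0).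
  by rewrite mul1r => {}le; rewrite mulrAC ler_pdivlMr.
have -> : n%:R = (count a rs)%:R + (count (predC a) rs)%:R :> R.
  by rewrite -natrD count_predC srs.
by rewrite mulrDl; apply: lerD.
Qed.

Section Lower.
Variables (F : {poly int}) (l : nat).
Hypothesis Fm : F \is monic.
Hypothesis Fl : forall n, \sum_(i < n) `|F`_i| <= l%:Z.
Local Notation FK := (map_poly (intr : int -> K) F).

Lemma gauss_norm_mul_le (s : {rmorphism K -> R[i]}) (g : {poly K}) :
  gauss_norm (FK * g) (abs_emb s) <= l%:R * gauss_norm g (abs_emb s).
Proof.
have av := abs_emb_value s.
have G0 : 0 <= gauss_norm g (abs_emb s).
  by have [i ->] := gauss_norm_attained g av; apply: (abs_ge0 av).
apply: gauss_norm_le => [|k]; first exact: mulr_ge0.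
rewrite coefM /abs_emb rmorph_sum; apply: le_trans (normc_sum _ _ _) _.
apply: (@le_trans _ _ (\sum_(i < k.+1) (`|F`_i|%:~R * gauss_norm g (abs_emb s)))).
  apply: ler_sum => i _; rewrite rmorphM Normc.normcM coef_map /= rmorph_int normc_int.
  by rewrite ler_wpM2l ?ler0z //; apply: (gauss_norm_ge g (k - i) av).
rewrite -mulr_suml ler_wpM2r // -(rmorph_sum (intr : {rmorphism int -> R})) /=.
by rewrite pmulrn ler_int; apply: Fl.
Qed.

Lemma FK_monic : FK \is monic.
Proof. exact: monic_map. Qed.

Lemma FKX_coef k i : exists z : int, (FK ^+ k)`_i = z%:~R.
Proof.
exists (F ^+ k)`_i; rewrite -[RHS](coef_map (intr : {rmorphism int -> K})).
by rewrite rmorphXn.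
Qed.

Lemma FKX_lead_le k v : abs_value v -> 1 <= gauss_norm (FK ^+ k) (v : K -> R).
Proof.
move=> av; have := gauss_norm_ge (FK ^+ k) (size (FK ^+ k)).-1 av.
by rewrite -lead_coefE (monicP (monic_exp k FK_monic)) (abs_1 av).
Qed.

(** The primes contribute 1 because the polynomial is monic with integer coefficients; at an
    embedding, each factor [F] multiplies the norm by at most [l]. The lower bound 0 serves to fix
    the sign of an admissible constant. *)
Lemma ln_height_pow k : (0 < l)%N ->
  0 <= ln (height R (FK ^+ k)) /\ ln (height R (FK ^+ k)) <= k%:R * ln l%:R.
Proof.
move=> l0; have HE : H (FK ^+ k) = \prod_j gauss_norm (FK ^+ k) (abs_emb (sg j)).
  rewrite /prod_places (prod_embeddings sg_inj sg_surj) fsbig1 ?mul1r // => P nzP.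
  have av := abs_prime_value R nzP; apply/le_anti; rewrite FKX_lead_le // andbT.
  apply: gauss_norm_le => // i; have [z ->] := FKX_coef k i.
  by apply: abs_prime_OK => //; apply: OK_int.
have g1 j : 1 <= gauss_norm (FK ^+ k) (abs_emb (sg j)).
  by apply: FKX_lead_le; apply: abs_emb_value.
have gl j : gauss_norm (FK ^+ k) (abs_emb (sg j)) <= l%:R ^+ k.
  elim: k {HE g1} => [|k IH]; first by rewrite !expr0 (gauss_norm1 (abs_emb_value (sg j))).
  rewrite !exprS; apply: le_trans (gauss_norm_mul_le _ _) _.
  by rewrite ler_wpM2l.
have H1 : 1 <= H (FK ^+ k).
  rewrite HE; elim/big_ind: _ => // x y x1 y1.
  by rewrite -[leLHS]mulr1 ler_pM.
have Hl : H (FK ^+ k) <= (l%:R ^+ k) ^+ d.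
  rewrite HE -[d in leRHS]card_ord -prodr_const; apply: ler_prod => j _.
  by rewrite gl (le_trans ler01 (g1 j)).
have d0 : 0 < d%:R :> R by rewrite ltr0n deg_gt0.
have lr0 : 0 < l%:R :> R by rewrite ltr0n.
rewrite ln_heightE; split.
  by rewrite mulr_ge0 ?invr_ge0 ?ln_ge0 // ltW.
rewrite mulrC ler_pdivrMr // -[leRHS]mulrC mulrA -natrM mulr_natl -lnXn // mulnC exprM.
by rewrite ler_ln // posrE ?exprn_gt0 // (lt_le_trans ltr01 H1).
Qed.

Theorem admissible_lower e (C : R) : size F = e.+1 -> (0 < e)%N -> (1 < l)%N ->
    (exists2 rs : seq K, 0 \notin rs & FK = \prod_(r <- rs) ('X - r%:P)) ->
  admissible_constants K C -> e%:R / ln l%:R <= C.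
Proof.
move=> sF e0 l1 [rs rs0 eFK] [g go bound].
have ln0 : 0 < ln l%:R :> R by rewrite ln_gt0 // ltr1n.
have er0 : 0 < e%:R :> R by rewrite ltr0n.
have bd k : (e * k)%:R - g (e * k)%N <= C * ln (height R (FK ^+ k)).
  apply: bound.
    have sFK : size FK = e.+1.
      by rewrite size_map_poly_id0 // (monicP Fm) oner_neq0.
    have := size_exp FK k; rewrite sFK /= => <-.
    by rewrite prednK // size_poly_gt0 monic_neq0 // monic_exp // FK_monic.
  exists (flatten (nseq k rs)).
    by apply/negP => /flattenP[r]; rewrite mem_nseq => /andP[_ /eqP ->]; apply/negP.
  rewrite (monicP (monic_exp k FK_monic)) scale1r eFK.
  elim: k => [|k IH]; first by rewrite expr0 big_nil.
  by rewrite exprS /= big_cat /= -IH.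
(* Beyond the threshold [N] of the o(n) condition for [eps], the error at degree [e k] is at most
   [eps e k]; [k = N + 1] is large enough. *)
have key eps : 0 < eps -> exists2 k : nat, (0 < k)%N &
    (e * k)%:R * (1 - eps) <= C * ln (height R (FK ^+ k)).
  move=> eps0; have /eqoP/(_ eps eps0) [N _ NP] := go.
  exists N.+1 => //; apply: le_trans (bd _); rewrite mulrBr mulr1 lerD2l lerN2.
  have := NP (e * N.+1)%N; rewrite /= mulrC => NP'.
  apply: le_trans (ler_norm _) (le_trans (NP' _) _).
    by apply: leq_trans (leqnSn _) _; rewrite leq_pmull.
  by rewrite ger0_norm.
(* The sign is needed before the upper bound on the height is multiplied by [C]: for negative [C]
   the right side of [key] is nonpositive, while [eps = 1/2] keeps the left side positive. *)
have C0 : 0 <= C.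
  rewrite leNgt; apply/negP => C0.
  have [|k k0 le] := key (2^-1); first by rewrite invr_gt0.
  have [h0 _] := ln_height_pow k (ltnW l1).
  have : 0 < (e * k)%:R * (1 - 2^-1) :> R.
    by rewrite mulr_gt0 // ?ltr0n ?muln_gt0 ?e0 //; lra.
  rewrite ltNge => /negP; apply; apply: le_trans le _.
  by rewrite nmulr_rle0.
rewrite ler_pdivrMr //; apply/ler_addgt0Pr => eps eps0.
(* With [eps / e] the error becomes [eps k], and dividing by [k] leaves [eps]. *)
have [|k k0 le] := key (eps / e%:R); first by rewrite divr_gt0.
have [_ hl] := ln_height_pow k (ltnW l1).
have {le}le := le_trans le (ler_wpM2l C0 hl).
have kr0 : 0 < k%:R :> R by rewrite ltr0n.
have E : (e * k)%:R * (1 - eps / e%:R) = e%:R * k%:R - eps * k%:R.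
  by rewrite natrM; field; rewrite gt_eqF.
rewrite E in le; rewrite -(ler_pM2r kr0); lra.
Qed.

End Lower.

Theorem C_lower C : admissible_constants K C -> w%:R / ln 2 <= C :> R.
Proof.
move=> adm; have [rs rs0 ers] := unity_splits.
have mon : 'X^w - 1 \is @monic int by rewrite -polyC1 monicXnsubC // num_unity_gt0.
apply: (@admissible_lower ('X^w - 1) 2 mon _ w) => //.
- move=> n; apply: (@le_trans _ _ (\sum_(i < n) ((i == w :> nat)%:R + (i == 0%N :> nat)%:R))).
    apply: ler_sum => i _; rewrite coefB coefXn coef1.
    by apply: le_trans (ler_normB _ _) _; rewrite !normr_nat.
  rewrite big_split /= (_ : 2%:Z = 1 + 1) //.
  have one k : \sum_(i < n) (i == k :> nat)%:R <= 1 :> int.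
    have [lt|ge] := ltnP k n.
      rewrite (bigD1 (Ordinal lt)) //= eqxx big1 ?addr0 // => i.
      by rewrite -val_eqE /= => /negbTE ->.
    by rewrite big1 // => i _; rewrite ltn_eqF // (leq_trans (ltn_ord i)).
  exact: lerD.
- by rewrite -polyC1 size_XnsubC // num_unity_gt0.
- exact: num_unity_gt0.
- by exists rs => //; rewrite -ers rmorphB rmorph1 /= map_polyXn.
Qed.

End Global.

Lemma rat_sqr_int (q : rat) (m : int) : q ^+ 2 = m%:~R ->
  exists2 z : int, q = z%:~R & z ^+ 2 = m.
Proof.
move=> e; have [|z ez] := @rat_integral algC q.
  exists ('X^2 - m%:P); first by rewrite monicXnsubC.
  rewrite rmorphB /= map_polyXn map_polyC /root !hornerE.
  have -> : ratr q ^+ 2 = m%:~R :> algC by rewrite -rmorphXn e rmorph_int.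
  by apply/eqP; apply: subrr.
exists z => //; apply/eqP; rewrite -(eqr_int rat) rmorphXn /= -ez e.
by [].
Qed.

(** The list gathers the later irrationality arguments: 2 excludes a square root of 2 from Q(i), 3
    excludes a square root of -1 from Q(sqrt(-3)), and 8 and 24 exclude coordinates of roots of
    unity in Q(sqrt(-2)). *)
Lemma sqr_notin n : (n ^ 2)%N \notin [:: 2; 3; 8; 24]%N.
Proof.
case: n => [|[|[|[|[|n]]]]] //; rewrite !inE !negb_or.
by apply/and4P; split; apply/eqP; nia.
Qed.

Lemma rat_sqr_notin (q : rat) (m : nat) : m \in [:: 2; 3; 8; 24]%N -> q ^+ 2 <> m%:R.
Proof.
move=> mm; rewrite pmulrn => /rat_sqr_int[z _ /(congr1 absz)]; rewrite abszX => e.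
by have := sqr_notin `|z|%N; rewrite e mm.
Qed.

(** * Totally real and imaginary quadratic fields *)

Section ComplexConj.
Variable R : realType.
Implicit Types z u : R[i].
Local Notation normc := (@Normc.normc R).

Lemma normc_conj z : normc z^* = normc z.
Proof. by apply: complexI; rewrite -!normcE norm_conjC. Qed.

Lemma normc_real (x : R) : normc x%:C%C = `|x|.
Proof. by rewrite /= expr0n addr0 sqrtr_sqr. Qed.

Lemma conj_imaginary z (m : int) : z ^+ 2 = m%:~R -> m < 0 -> z^* = - z.
Proof.
case: z => a b /= e m0.
have : (a +i* b)%C ^+ 2 = (m%:~R : R)%:C%C by rewrite e rmorph_int.
rewrite expr2 => -[e1 e2].
have m0' : (m%:~R : R) < 0 by rewrite ltrz0.
have a0 : a = 0.
  have : a * b = 0 by lra.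
  move=> /eqP; rewrite mulf_eq0 => /orP[/eqP //|/eqP b0].
  rewrite b0 in e1; have := sqr_ge0 a; rewrite expr2; lra.
by apply/eqP; rewrite eq_complex /= a0 oppr0 !eqxx.
Qed.

Lemma parallelogram_i z u : u ^+ 2 = -1 ->
  normc (z + u) ^+ 2 + normc (z - u) ^+ 2 = 2 * (normc z ^+ 2 + 1).
Proof.
move=> e; have uc : u^* = - u by apply: (@conj_imaginary u (-1)); rewrite // e rmorphN1.
case: u e uc => a b e [a0].
have : (a +i* b)%C ^+ 2 = (-1 +i* 0)%C by rewrite e; apply/eqP; rewrite eq_complex /= oppr0 !eqxx.
rewrite expr2 => -[e1 e2]; case: z => c f.
rewrite /Normc.normc /= !sqr_sqrtr ?addr_ge0 ?sqr_ge0 //.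
have {}a0 : a = 0 by lra.
rewrite a0 in e1 *; lra.
Qed.

(** The points [-1], [1 - u] and [u] are the three cube roots of -1. Their sum vanishes, so the
    cross terms cancel in the sum of squared distances to [z]. *)
Lemma hexagon z u : u ^+ 2 = u - 1 ->
  normc (z + 1) ^+ 2 + normc (z + (u - 1)) ^+ 2 + normc (z - u) ^+ 2 =
  3 * (normc z ^+ 2 + 1).
Proof.
move=> e; have uc : u^* = 1 - u.
  have /conj_imaginary : (2 * u - 1) ^+ 2 = (-3)%:~R.
    have -> : (2 * u - 1) ^+ 2 = 4 * (u ^+ 2) - 4 * u + 1 by ring.
    by rewrite e; ring.
  move=> /(_ isT); rewrite rmorphB rmorphM /= rmorph1 rmorph_nat => e2.
  have two : (2%:R : R[i]) != 0 by rewrite pnatr_eq0.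
  apply: (mulfI two); have -> : 2 * u^* = (2 * u^* - 1) + 1 by ring.
  by rewrite e2; ring.
have one : (1 : R[i]) = (1 +i* 0)%C by [].
rewrite one in e uc *; case: u e uc => a b + [a0].
rewrite expr2 => -[e1 e2]; case: z => c f.
rewrite /Normc.normc /= !sqr_sqrtr ?addr_ge0 ?sqr_ge0 //.
have {}a0 : a = 2^-1 by lra.
rewrite a0 in e1 *; lra.
Qed.

End ComplexConj.

Section Fields.
Variables (R : realType) (K : fieldExtType rat).
Local Notation OK := (@OK K).
Local Notation d := (\dim {:K}).
Local Notation normc := (@Normc.normc R).
Local Notation absP := (@abs_prime R K).
Local Notation w := (num_roots_of_unity K).
Variables (th : K) (sg : 'I_d -> {rmorphism K -> R[i]}).
Hypothesis Oth : OK th.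
Hypothesis coordP : forall x, exists c : 'rV[rat]_d, x = \sum_i c 0 i *: th ^+ i.
Hypothesis sg_inj : injective (fun j => sg j th).
Hypothesis sg_surj : forall t : {rmorphism K -> R[i]}, exists j, t =1 sg j.

Lemma natK_eq0 n : (n%:R == 0 :> K) = (n == 0%N).
Proof. by rewrite -(mulr1z _%:R) pmulrn intK_eq0. Qed.

Lemma max_exp_ge P (r : K) k : nonzero_primes P -> (0 < k)%N ->
  absP P r <= Num.max 1 (absP P r) ^+ k.
Proof.
move=> nzP; case: k => // k _; rewrite exprS.
apply: (@le_trans _ _ (Num.max 1 (absP P r))); first by rewrite le_max lexx orbT.
rewrite ler_peMr //; first by rewrite le_max ler01.
by apply: exprn_ege1; rewrite le_max lexx.
Qed.

Lemma totally_real_A_elt r : totally_real R K -> r != 0 -> 2 ^+ d <= A_elt sg 2 r.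
Proof.
move=> tr r0; have := denom_norm_ge1 Oth coordP sg_inj (k := 2) r0 r0.
move=> /(_ (fun P nzP => @max_exp_ge P r 2 nzP isT)) D1.
have le : \prod_(j < d) (2 * normc (sg j r)) <= \prod_j normc (sg j r ^+ 2 + 1).
  apply: ler_prod => j _; rewrite mulr_ge0 ?normc_ge0 //=.
  have [a ->] : exists a : R, sg j r = a%:C%C.
    have : complex.Im (sg j r) = 0 by apply: tr; exists (sg j).
    by case: (sg j r) => a b /= ->; exists a.
  rewrite -rmorphXn -(rmorph1 (real_complex R)) -rmorphD !normc_real.
  rewrite [ `|a ^+ 2 + 1| ]ger0_norm ?addr_ge0 ?sqr_ge0 //.
  rewrite -[a ^+ 2]real_normK ?num_real //.
  have := sqr_ge0 (`|a| - 1); rewrite sqrrB1; move: (`|a|) => t; lra.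
rewrite big_split /= prodr_const card_ord in le.
apply: (@le_trans _ _ (denom R r ^+ 2 * (2 ^+ d * \prod_j normc (sg j r)))).
  by rewrite mulrCA ler_peMr // exprn_ge0.
apply: ler_wpM2l => //; rewrite exprn_ge0 // (le_trans ler01) // denom_ge1 //.
Qed.

Lemma num_unity_prim (z : K) n : (0 < n)%N -> z ^+ n = 1 ->
  (forall k, (0 < k < n)%N -> z ^+ k != 1) -> (n <= w)%N.
Proof.
move=> n0 zn zk; have uz : unity z by apply/unityP; exists n.
have z0 := unity_neq0 uz.
have ne i j : (i < j < n)%N -> z ^+ i != z ^+ j.
  move=> /andP[ij jn]; apply/eqP => e.
  have : z ^+ (j - i) != 1 by apply: zk; lia.
  case/eqP; apply: (mulfI (expf_neq0 i z0)).
  by rewrite -exprD subnKC ?mulr1 // ltnW.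
have uni k : unity (z ^+ k).
  by elim: k => [|k IH]; rewrite ?expr0 ?exprS; [apply: unity1 | apply: unityM].
have := @num_unity_ge R K th sg Oth coordP sg_inj sg_surj (mkseq (fun k => z ^+ k) n).
rewrite size_mkseq; apply; last by move=> _ /mapP[k _ ->].
rewrite map_inj_in_uniq ?iota_uniq // => i j; rewrite !mem_iota !add0n /= => ltin ltjn e.
have [ij|ji|//] := ltngtP i j.
  by have := ne i j; rewrite ij ltjn e eqxx => /(_ isT).
by have := ne j i; rewrite ji ltin e eqxx => /(_ isT).
Qed.

Lemma conj_ratr_comb (a b : rat) (z : R[i]) :
  (ratr a + ratr b * z)^* = ratr a + ratr b * z^*.
Proof.
pose c : {rmorphism R[i] -> R[i]} := Num.conj.
rewrite -/(c _) -/(c z) (rmorphD c) (rmorphM c (ratr b)).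
by rewrite !(fmorph_rat c).
Qed.

Section Quadratic.
Variables (x : K) (m : int).
Hypotheses (xm : x ^+ 2 = m%:~R) (m0 : m < 0) (gen : <<1; x>>%VS = {:K}%VS).

Lemma quad_coords y : exists a b : rat, y = a%:A + b *: x.
Proof.
have yF : y \in <<1; x>>%VS by rewrite gen memvf.
have /polyOver1P[q eq] := Fadjoin_polyOver 1 x y.
have yq : y = (map_poly (in_alg K) q).[x] by rewrite -eq Fadjoin_poly_eq.
pose p : {poly rat} := 'X^2 - (m%:~R)%:P.
have px : (map_poly (in_alg K) p).[x] = 0.
  rewrite rmorphB /= map_polyXn map_polyC !hornerE xm /= -scaler_int.
  by rewrite subrr.
have sp : size p = 3%N by rewrite size_XnsubC.
have sr : (size (q %% p)%R <= 2)%N.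
  by rewrite -ltnS -sp ltn_modp -size_poly_gt0 sp.
exists (q %% p)`_0, (q %% p)`_1.
rewrite yq {1}(divp_eq q p) rmorphD rmorphM /= hornerD hornerM px mulr0 add0r.
rewrite (@horner_coef_wide _ 2) ?size_map_poly // !big_ord_recl big_ord0 addr0.
by rewrite !coef_map /= expr0 mulr1 expr1 -scalerAl mul1r.
Qed.

Lemma quad_emb (s : {rmorphism K -> R[i]}) a b : s (a%:A + b *: x) = ratr a + ratr b * s x.
Proof. by rewrite rmorphD !rmorphZ_num rmorph1 mulr1. Qed.

Lemma emb_sqr (s : {rmorphism K -> R[i]}) : s x ^+ 2 = m%:~R.
Proof. by rewrite -rmorphXn xm rmorph_int. Qed.

Lemma emb_neq0 (s : {rmorphism K -> R[i]}) : s x != 0.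
Proof.
apply/eqP => e; have := emb_sqr s; rewrite e expr0n /= => /esym/eqP.
by rewrite intr_eq0 lt_eqF.
Qed.

Lemma emb_conj (s : {rmorphism K -> R[i]}) : (s x)^* = - s x.
Proof. exact: conj_imaginary (emb_sqr s) m0. Qed.

Lemma emb_pm (s t : {rmorphism K -> R[i]}) : s x = t x \/ s x = - t x.
Proof.
have : s x ^+ 2 == t x ^+ 2 by rewrite !emb_sqr.
by rewrite eqf_sqr => /orP[] /eqP; [left | right].
Qed.

(** Two embeddings agree or differ by complex conjugation, which preserves the modulus. *)
Lemma emb_norm_eq (s t : {rmorphism K -> R[i]}) y : normc (s y) = normc (t y).
Proof.
have [a [b ->]] := quad_coords y; rewrite !quad_emb.
have [->|->] // := emb_pm s t.
rewrite -[RHS]normc_conj; congr (normc _).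
by rewrite conj_ratr_comb emb_conj.
Qed.

Lemma quad_unique (a b : rat) : a%:A + b *: x = 0 -> a = 0 /\ b = 0.
Proof.
move=> e; have b0 : b = 0.
  apply/eqP; apply: contraT => b0.
  have xr : x = (- (a / b))%:A.
    apply: (scalerI b0); rewrite scalerA mulrN mulrCA mulfV // mulr1.
    by apply/eqP; rewrite scaleNr -addr_eq0 addrC e.
  have : (- (a / b)) ^+ 2 = m%:~R.
    apply: (fmorph_inj (in_alg K)); rewrite rmorphXn /= -xr xm -scaler_int.
    by [].
  move=> e2; have := sqr_ge0 (- (a / b)); rewrite e2 ler0z leNgt m0.
  by [].
split=> //; move: e; rewrite b0 scale0r addr0 => /eqP.
by rewrite scaler_eq0 oner_eq0 orbF => /eqP.
Qed.

Lemma quad_sqr (a b : rat) :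
  (a%:A + b *: x) ^+ 2 = (a ^+ 2 + m%:~R * b ^+ 2)%:A + (2 * a * b) *: x.
Proof.
have fM (p q : rat) : (p * q)%:A = p%:A * q%:A :> K by rewrite -scalerAl mul1r scalerA.
rewrite -[b *: x]mulr_algl -[(2 * a * b) *: x]mulr_algl sqrrD exprMn xm.
rewrite scalerDl !expr2 !fM scaler_int scaler_nat.
by move: (a%:A) (b%:A) (m%:~R) => A B M; ring.
Qed.

Lemma quad_sqr_eq (a b c : rat) : (a%:A + b *: x) ^+ 2 = c%:A ->
  a ^+ 2 + m%:~R * b ^+ 2 = c /\ 2 * a * b = 0.
Proof.
rewrite quad_sqr => /eqP; rewrite -subr_eq0 addrAC -scalerBl => /eqP.
by move=> /quad_unique[/eqP]; rewrite subr_eq0 => /eqP.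
Qed.

(** The degree is the number of embeddings, and each is determined by the image of [x], a square
    root of [m]. One embedding and its complex conjugate exhaust them, and they differ because
    [m < 0]. *)
Lemma quad_degree : d = 2%N.
Proof.
have d0 := deg_gt0 K; pose j0 : 'I_d := Ordinal d0.
have ext (s t : {rmorphism K -> R[i]}) : s x = t x -> s =1 t.
  by move=> e y; have [a [b ->]] := quad_coords y; rewrite !quad_emb e.
pose cj : {rmorphism K -> R[i]} := (Num.conj : {rmorphism R[i] -> R[i]}) \o sg j0.
have [k kP] := sg_surj cj.
have kx : sg k x = - sg j0 x by rewrite -kP /= emb_conj.
have kj : k != j0.
  apply/eqP => e; rewrite e in kx; move/eqP: kx.
  by rewrite -addr_eq0 -mulr2n mulrn_eq0 /= (negbTE (emb_neq0 _)).
apply/eqP; rewrite eqn_leq; apply/andP; split.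
  rewrite -[d]card_ord cardE.
  apply: (@uniq_leq_size _ (enum 'I_d) [:: j0; k] (enum_uniq _)) => i _.
  rewrite !inE; have [e|e] := emb_pm (sg i) (sg j0).
    by apply/orP; left; apply/eqP; apply: sg_inj; apply: ext.
  by apply/orP; right; apply/eqP; apply: sg_inj; apply: ext; rewrite e kx.
have := ltn_ord k; have := ltn_ord j0; move: kj; rewrite -val_eqE /=.
by move=> k0 _; apply: leq_ltn_trans; rewrite lt0n.
Qed.

Lemma quad_prod y j0 : \prod_j normc (sg j y) = normc (sg j0 y) ^+ 2.
Proof.
rewrite (eq_bigr (fun=> normc (sg j0 y))) => [|j _]; last exact: emb_norm_eq.
by rewrite prodr_const card_ord quad_degree.
Qed.

End Quadratic.

Let j0 : 'I_d := Ordinal (deg_gt0 K).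

(** Modulo a prime of norm 3 the elements 0, 1, -1 and [i] would be pairwise incongruent, one class
    too many: their differences are units or divide 2, and a prime containing 2 and 3 would contain
    1. *)
Lemma norm3_free_i (i : K) (P : set K) :
  i ^+ 2 = -1 -> nonzero_primes P -> ideal_norm P <> 3%N.
Proof.
move=> ii nzP N3; have iP := prime_is_ideal nzP.1; have pP := nzP.1.
have Oi : OK i.
  exists ('X^2 + 1); first by rewrite -[1]opprK -polyCN monicXnsubC.
  by rewrite rmorphD rmorph1 /= map_polyXn /root !hornerE ii addNr.
have n1 := prime_proper pP.
have P3 : P 3%:R by have := ideal_norm_mem nzP; rewrite N3.
have n2 : ~ P 2%:R.
  by move=> P2; apply: n1; have := ideal_B iP P3 P2; rewrite -natrB.
have nN y : ~ P y -> ~ P (- y).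
  by move=> nPy /(ideal_N iP); rewrite opprK.
have ni : ~ P i.
  move=> Pi; apply: (nN 1 n1); rewrite -ii expr2; exact: (ideal_M iP).
have nip : ~ P (1 - i).
  move=> Pi; apply: n2; have -> : 2%:R = (1 - i) * (1 + i) by rewrite -subr_sqr expr1n ii opprK.
  by apply: ideal_Mr => //; apply: OKD => //; apply: OK1.
have nim : ~ P (1 + i).
  move=> Pi; apply: n2; have -> : 2%:R = (1 + i) * (1 - i) by rewrite mulrC -subr_sqr expr1n ii opprK.
  by apply: ideal_Mr => //; apply: OKB => //; apply: OK1.
have := @incongruent_mkseq _ OK P (nth 0 [:: 0; 1; -1; i]) 4 (ideal_subgroup iP).
move=> inc; suff : (4 <= ideal_norm P)%N by rewrite N3.
rewrite -[4%N](size_mkseq (nth 0 [:: 0; 1; -1; i]) 4).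
apply: (incongruent_size (ideal_subgroup iP) (prime_index nzP)); apply: inc.
  by case=> [|[|[|[|]]]] //= _; [apply: OK0 | apply: OK1 | apply: OKN; apply: OK1].
move=> p q /andP[pq q4]; case: p q pq q4 => [|[|[|[|p]]]] [|[|[|[|q]]]] //= _ _.
- by rewrite sub0r; apply: nN.
- by rewrite sub0r opprK.
- by rewrite sub0r; apply: nN.
- by rewrite opprK.
- by rewrite -opprD; apply: nN.
Qed.

Lemma prod_eq3 (S : seq (set K)) (e : set K -> nat) :
  {in S, forall P, nonzero_primes P} -> (\prod_(P <- S) ideal_norm P ^ e P)%N = 3%N ->
  exists2 P : set K, nonzero_primes P & ideal_norm P = 3%N.
Proof.
elim: S => [|P S IH] SP; first by rewrite big_nil.
rewrite big_cons => e3.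
have nzP := SP P (mem_head _ _).
have /primeP[_ p3] : prime 3 by [].
have : (ideal_norm P ^ e P %| 3)%N by rewrite -e3 dvdn_mulr.
move=> /p3/pred2P[] eN.
  apply: IH; last by rewrite eN mul1n in e3.
  by move=> Q QS; apply: SP; rewrite inE QS orbT.
exists P => //; have eP : (0 < e P)%N by case: (e P) eN.
have : (ideal_norm P %| 3)%N by rewrite -eN -(prednK eP) expnS dvdn_mulr.
move=> /p3/pred2P[] // N1; have := ideal_norm_gt1 nzP.
by rewrite N1.
Qed.

(** The factors [r^2 + i] and [r^2 - i] contribute [n1, n2 >= 1] with sum at least 4, whence
    [n1 n2 >= n1 + n2 - 1 >= 3]. The product is a natural number other than 3, so it reaches
    [4 = 2^d]. *)
Lemma gauss_A_elt (i : K) r : i ^+ 2 = -1 -> <<1; i>>%VS = {:K}%VS -> r != 0 ->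
  2 ^+ d <= A_elt sg 4 r.
Proof.
move=> ii gen r0; have ii' : i ^+ 2 = (-1)%:~R by rewrite rmorphN1.
have d2 := quad_degree ii' isT gen.
have Oi : OK i.
  exists ('X^2 + 1); first by rewrite -[1]opprK -polyCN monicXnsubC.
  by rewrite rmorphD rmorph1 /= map_polyXn /root !hornerE ii addNr.
pose v y := normc (sg j0 y).
have prodE y : \prod_j normc (sg j y) = v y ^+ 2 by apply: (quad_prod ii' isT gen).
have sqn (s : K) : s ^+ 2 = 2%:~R -> False.
  have [a [b ->]] := quad_coords ii' gen s.
  move=> e; have {}e : (a%:A + b *: i) ^+ 2 = 2%:A by rewrite e scaler_nat.
  have [e1 /eqP] := quad_sqr_eq ii' isT e.
  rewrite !mulf_eq0 /= => /orP[/eqP a0|/eqP b0].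
    have := sqr_ge0 b; move: e1; rewrite a0 expr0n /= rmorphN1; lra.
  apply: (@rat_sqr_notin a 2) => //; rewrite b0 in e1; lra.
(* If [r^2 = -c], then [r (1 + c)] has square [-2 c^2 = 2], impossible in Q(i). *)
have y0 (c : K) : c ^+ 2 = -1 -> r ^+ 2 + c != 0.
  move=> cc; apply/eqP => /eqP; rewrite addr_eq0 => /eqP e.
  apply: (sqn (r * (1 + c))); rewrite exprMn e sqrrD cc expr1n mul1r.
  have -> : - c * (1 + c *+ 2 + -1) = - (c ^+ 2) * 2 by ring.
  by rewrite cc opprK mul1r.
have ypl := y0 i ii; have ymi : r ^+ 2 + - i != 0 by apply: y0; rewrite sqrrN.
have N1 := denom_norm_ge1 Oth coordP sg_inj (k := 2) r0 ypl (fun P nzP => abs_exp_addr_le R r 2 nzP Oi).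
have N2 := denom_norm_ge1 Oth coordP sg_inj (k := 2) r0 ymi (fun P nzP => abs_exp_addr_le R r 2 nzP (OKN Oi)).
have N0 := denom_norm_ge1 Oth coordP sg_inj (k := 2) r0 r0 (fun P nzP => @max_exp_ge P r 2 nzP isT).
rewrite !prodE in N0 N1 N2.
have AE : A_elt sg 4 r = denom R r ^+ 4 * \prod_j normc (sg j (r ^+ 4 + 1)).
  by congr (_ * _); apply: eq_bigr => j _; rewrite rmorphD rmorphXn rmorph1.
have fac : r ^+ 4 + 1 = (r ^+ 2 + i) * (r ^+ 2 - i).
  by rewrite mulrC -subr_sqr ii opprK -exprM.
have A12 : A_elt sg 4 r = (denom R r ^+ 2 * v (r ^+ 2 + i) ^+ 2) * (denom R r ^+ 2 * v (r ^+ 2 - i) ^+ 2).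
  rewrite AE prodE fac /v rmorphM Normc.normcM; ring.
have sum : denom R r ^+ 2 * v (r ^+ 2 + i) ^+ 2 + denom R r ^+ 2 * v (r ^+ 2 - i) ^+ 2 >= 4.
  rewrite -mulrDr /v rmorphD rmorphB /= parallelogram_i; last by rewrite -rmorphXn ii rmorphN1.
  rewrite rmorphXn normcX; move: N0; rewrite /v.
  have D0 := sqr_ge0 (denom R r); move: (denom R r ^+ 2) D0 => D D0.
  have := sqr_ge0 (normc (sg j0 r) ^+ 2 - 1); move: (normc (sg j0 r) ^+ 2) => t ht le.
  have : D * (t ^+ 2 + 1) >= D * (2 * t) by apply: ler_wpM2l => //; move: ht; rewrite sqrrB1; lra.
  lra.
have A3 : 3 <= A_elt sg 4 r.
  rewrite A12; move: (denom R r ^+ 2 * _) (denom R r ^+ 2 * _) N1 N2 sum => n1 n2 N1 N2 sum.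
  nra.
have yy0 : r ^+ 4 + 1 != 0 by rewrite fac mulf_neq0.
have [S [e [SP eS]]] := denom_norm Oth coordP sg_inj (k := 4) r0 yy0
  (fun P nzP => abs_exp_addr_le R r 4 nzP (OK1 K)).
have {}eS : A_elt sg 4 r = (\prod_(P <- S) ideal_norm P ^ e P)%N%:R.
  by rewrite AE eS natr_prod; apply: eq_bigr => P _; rewrite natrX.
have n3 : (\prod_(P <- S) ideal_norm P ^ e P)%N <> 3%N.
  by move=> /(prod_eq3 SP)[P nzP]; apply: (norm3_free_i ii nzP).
rewrite d2 eS -natrX ler_nat; move: A3; rewrite eS ler_nat; move: n3.
by move: (\prod_(P <- S) _)%N => n; lia.
Qed.

Lemma eisenstein_root (x : K) : x ^+ 2 = -3 -> ((1 + x) / 2) ^+ 2 = (1 + x) / 2 - 1.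
Proof.
move=> xx; have K2 : (2%:R : K) != 0 by rewrite natK_eq0.
have := mulfV K2; move: (2%:R^-1 : K) => h hh.
have -> : ((1 + x) * h) ^+ 2 = (1 + 2 * x + x ^+ 2) * h * h by ring.
rewrite xx; have -> : (1 + 2 * x + -3) * h * h = (x - 1) * h * (2 * h) by ring.
rewrite hh mulr1; have -> : (1 + x) * h - 1 = (1 + x) * h - 2 * h by rewrite hh.
by ring.
Qed.

(** Here [u] is a primitive sixth root of unity, and the three quadratic factors of [r^6 + 1]
    contribute [n1, n2, n3 >= 1] with sum at least 6. Applying [a b >= a + b - 1] twice bounds their
    product below by [6 - 2 = 2^d], with no exceptional value to exclude. *)
Lemma eisenstein_A_elt (x : K) r : x ^+ 2 = -3 -> <<1; x>>%VS = {:K}%VS -> r != 0 ->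
  2 ^+ d <= A_elt sg 6 r.
Proof.
move=> xx gen r0; have xx' : x ^+ 2 = (-3)%:~R by rewrite xx rmorphN.
have d2 := quad_degree xx' isT gen.
have K2 : (2%:R : K) != 0 by rewrite natK_eq0.
pose u : K := (1 + x) / 2.
have uu : u ^+ 2 = u - 1 := eisenstein_root xx.
have Ou : OK u.
  exists ('X^2 - ('X - 1)).
    apply/monicP; rewrite lead_coefDl ?lead_coefXn // size_polyN size_polyXn.
    by rewrite -polyC1 size_XsubC.
  by rewrite !rmorphB rmorph1 /= map_polyXn map_polyX /root !hornerE uu subrr.
pose v y := normc (sg j0 y).
have prodE y : \prod_j normc (sg j y) = v y ^+ 2 by apply: (quad_prod xx' isT gen).
(* A vanishing quadratic factor would make [r], [r u^2] or [r u] a square root of -1. *)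
have sqn (s : K) : s ^+ 2 <> -1.
  have [a [b ->]] := quad_coords xx' gen s.
  move=> e; have {}e : (a%:A + b *: x) ^+ 2 = (-1)%:A by rewrite e scaleN1r.
  have [e1 /eqP] := quad_sqr_eq xx' isT e.
  have m3 : (-3 : int)%:~R = -3 :> rat by rewrite rmorphN.
  rewrite m3 in e1; rewrite !mulf_eq0 /= => /orP[/eqP a0|/eqP b0].
    apply: (@rat_sqr_notin (3 * b) 3) => //.
    have : 3 * b ^+ 2 = 1 by move: e1; rewrite a0; lra.
    by rewrite exprMn; lra.
  have := sqr_ge0 a; rewrite b0 in e1; lra.
have y0 (c : K) : c ^+ 2 = -1 -> False by apply: sqn.
have nz0 : r ^+ 2 + 1 != 0.
  by apply/eqP => /eqP; rewrite addr_eq0 => /eqP /y0.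
have u3 : u ^+ 3 = -1.
  by rewrite exprS uu mulrBr mulr1 -expr2 uu; ring.
have nz1 : r ^+ 2 + (u - 1) != 0.
  apply/eqP => /eqP; rewrite addr_eq0 -uu => /eqP e; apply: (y0 (r * u ^+ 2)).
  by rewrite exprMn e -exprM mulNr -exprD -[(2 + 2 * 2)%N]/(3 * 2)%N exprM u3 sqrrN expr1n.
have nz2 : r ^+ 2 + (- u) != 0.
  apply/eqP => /eqP; rewrite addr_eq0 opprK => /eqP e; apply: (y0 (r * u)).
  by rewrite exprMn e -exprS u3.
have Ou1 : OK (u - 1) by apply: OKB => //; apply: OK1.
have N1 := denom_norm_ge1 Oth coordP sg_inj (k := 2) r0 nz0 (fun P nzP => abs_exp_addr_le R r 2 nzP (OK1 K)).
have N2 := denom_norm_ge1 Oth coordP sg_inj (k := 2) r0 nz1 (fun P nzP => abs_exp_addr_le R r 2 nzP Ou1).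
have N3 := denom_norm_ge1 Oth coordP sg_inj (k := 2) r0 nz2 (fun P nzP => abs_exp_addr_le R r 2 nzP (OKN Ou)).
have N0 := denom_norm_ge1 Oth coordP sg_inj (k := 2) r0 r0 (fun P nzP => @max_exp_ge P r 2 nzP isT).
rewrite !prodE in N0 N1 N2 N3.
have AE : A_elt sg 6 r = denom R r ^+ 6 * \prod_j normc (sg j (r ^+ 6 + 1)).
  by congr (_ * _); apply: eq_bigr => j _; rewrite rmorphD rmorphXn rmorph1.
have fac : r ^+ 6 + 1 = (r ^+ 2 + 1) * ((r ^+ 2 + (u - 1)) * (r ^+ 2 - u)).
  have -> : (r ^+ 2 + 1) * ((r ^+ 2 + (u - 1)) * (r ^+ 2 - u)) =
    (r ^+ 2 + 1) * (r ^+ 4 - r ^+ 2 + u - u ^+ 2) by ring.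
  by rewrite uu; ring.
have A123 : A_elt sg 6 r = (denom R r ^+ 2 * v (r ^+ 2 + 1) ^+ 2) *
    ((denom R r ^+ 2 * v (r ^+ 2 + (u - 1)) ^+ 2) * (denom R r ^+ 2 * v (r ^+ 2 - u) ^+ 2)).
  rewrite AE prodE fac /v !rmorphM !Normc.normcM; ring.
have sum : denom R r ^+ 2 * v (r ^+ 2 + 1) ^+ 2 + denom R r ^+ 2 * v (r ^+ 2 + (u - 1)) ^+ 2
    + denom R r ^+ 2 * v (r ^+ 2 - u) ^+ 2 >= 6.
  have eu : sg j0 u ^+ 2 = sg j0 u - 1 by rewrite -rmorphXn uu rmorphB rmorph1.
  rewrite -!mulrDr /v (rmorphD (sg j0) (r ^+ 2) 1) (rmorphD (sg j0) (r ^+ 2) (u - 1)).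
  rewrite (rmorphB (sg j0) u 1) (rmorphB (sg j0) (r ^+ 2) u) rmorph1 (hexagon _ eu).
  rewrite rmorphXn normcX; move: N0; rewrite /v.
  have D0 := sqr_ge0 (denom R r); move: (denom R r ^+ 2) D0 => D D0.
  have := sqr_ge0 (normc (sg j0 r) ^+ 2 - 1); move: (normc (sg j0 r) ^+ 2) => t ht le.
  have : D * (t ^+ 2 + 1) >= D * (2 * t) by apply: ler_wpM2l => //; move: ht; rewrite sqrrB1; lra.
  lra.
rewrite d2 A123.
move: (denom R r ^+ 2 * _) (denom R r ^+ 2 * _) (denom R r ^+ 2 * _) N1 N2 N3 sum => n1 n2 n3 N1 N2 N3 sum.
have h23 : n2 + n3 - 1 <= n2 * n3 by nra.
have : n1 * (n2 + n3 - 1) <= n1 * (n2 * n3) by apply: ler_wpM2l => //; lra.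
have : n1 + (n2 + n3 - 1) - 1 <= n1 * (n2 + n3 - 1) by nra.
by rewrite expr2; lra.
Qed.

Lemma totally_real_unity : (2 <= w)%N.
Proof.
apply: (@num_unity_prim (-1)) => //; first by rewrite sqrrN expr1n.
case=> [|[|]] // _; rewrite expr1 eq_sym -subr_eq0 opprK -[1 + 1]/(2%:R) natK_eq0.
by [].
Qed.

Lemma gauss_unity (i : K) : i ^+ 2 = -1 -> (4 <= w)%N.
Proof.
move=> ii; have n1 : -1 != 1 :> K.
  by rewrite eq_sym -subr_eq0 opprK -[1 + 1]/(2%:R) natK_eq0.
apply: (@num_unity_prim i) => //; first by rewrite -[4%N]/(2 * 2)%N exprM ii sqrrN expr1n.
case=> [|[|[|[|]]]] // _; rewrite ?expr1 ?ii //.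
  by apply: contra_neq n1 => i1; rewrite -ii i1 expr1n.
by rewrite exprSr ii mulN1r; apply: contra_neq n1 => i1; rewrite -ii -sqrrN i1 expr1n.
Qed.

Lemma eisenstein_unity (x : K) : x ^+ 2 = -3 -> (6 <= w)%N.
Proof.
move=> xx; pose u : K := (1 + x) / 2.
have uu : u ^+ 2 = u - 1 := eisenstein_root xx.
have u3 : u ^+ 3 = -1.
  by rewrite exprS uu mulrBr mulr1 -expr2 uu; ring.
have n1 : -1 != 1 :> K.
  by rewrite eq_sym -subr_eq0 opprK -[1 + 1]/(2%:R) natK_eq0.
have bad (n : nat) : (0 < n)%N -> (n%:R : K) = 0 -> False.
  by move=> n0 /eqP; rewrite natK_eq0; case: n n0.
apply: (@num_unity_prim u) => //; first by rewrite -[6%N]/(3 * 2)%N exprM u3 sqrrN expr1n.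
case=> [|[|[|[|[|[|]]]]]] // _; apply/eqP => e.
- rewrite expr1 in e; apply: (bad 1%N) => //; move: uu; rewrite e expr1n => h.
  by rewrite h subrr.
- rewrite uu in e; have e2 : u = 2 by rewrite -[u](subrK 1) e.
  apply: (bad 3%N) => //; move: uu; rewrite e2 => h.
  have -> : 3%:R = 2 ^+ 2 - (2 - 1) :> K by ring.
  by rewrite h subrr.
- by move/eqP: n1; apply; rewrite -u3.
- have e2 : u = -1 by rewrite -[u]opprK; congr (- _); rewrite -e exprSr u3 mulN1r.
  apply: (bad 3%N) => //; move: uu; rewrite e2 => h.
  have -> : 3%:R = (-1) ^+ 2 - (-1 - 1) :> K by ring.
  by rewrite h subrr.
- have e2 : u = 0.
    have : u ^+ 5 = 1 - u by rewrite -[5%N]/(3 + 2)%N exprD u3 mulN1r uu opprB.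
    by rewrite e => h; rewrite -[u](subKr 1) -h subrr.
  apply: (bad 1%N) => //; move: uu; rewrite e2 expr0n /= sub0r => h.
  by rewrite -[1%:R]opprK -h oppr0.
Qed.

(** The conjugate of a root of unity [y = a + b x] is its inverse, so [a^2 + 2 b^2 = 1], and the
    trace [2 a] is an integer of absolute value at most 2. The traces 0, 1 and -1 make [b]
    irrational; 2 and -2 force [b = 0]. *)
Lemma sqrt2_unity (x y : K) : x ^+ 2 = (-2)%:~R -> <<1; x>>%VS = {:K}%VS ->
  unity y -> y \in [:: 1; -1].
Proof.
move=> xx gen uy; have [a [b ey]] := quad_coords xx gen y.
pose y' := a%:A + (- b) *: x; pose s := sg j0.
have sy' : s y' = (s y)^*.
  by rewrite ey !quad_emb conj_ratr_comb (emb_conj xx) // rmorphN mulrN mulNr.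
have yy : y * y' = 1.
  apply: (fmorph_inj s); rewrite rmorphM sy' rmorph1 -normCK normcE (unity_abs s uy).
  by rewrite rmorph1 expr1n.
have Oy' : OK y'.
  have [n n0 yn] := proj1 (unityP y) uy.
  apply: unity_OK; apply/unityP; exists n => //.
  by have := congr1 (fun z => z ^+ n) yy; rewrite exprMn yn mul1r expr1n.
have [z ez] : exists z : int, 2 * a = z%:~R.
  apply: (@rat_integral R[i]).
  have -> : ratr (2 * a) = s (y + y').
    2: by apply: emb_integral; apply: OKD => //; apply: unity_OK.
  rewrite ey /y' addrACA -!scalerDl subrr scale0r addr0 rmorphZ_num rmorph1 mulr1.
  by congr (ratr _); ring.
have e1 : a ^+ 2 + 2 * b ^+ 2 = 1.
  have fM (p q : rat) : (p * q)%:A = p%:A * q%:A :> K by rewrite -scalerAl mul1r scalerA.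
  have e : (a ^+ 2 + 2 * b ^+ 2)%:A = 1%:A :> K.
    rewrite scale1r -[RHS]yy ey /y' -![_ *: x]mulr_algl scaleNr mulNr.
    rewrite [RHS]mulrC -subr_sqr exprMn xx.
    rewrite scalerDl !expr2 !fM scaler_nat.
    have -> : (-2 : int)%:~R = -2 :> K by rewrite rmorphN.
    by move: (a%:A) (b%:A) => A B; ring.
  by apply: (fmorph_inj (in_alg K)).
have z4 : z ^+ 2 <= 4.
  rewrite -(ler_int rat) rmorphXn /= -ez exprMn.
  by have := sqr_ge0 b; have -> : (4 : int)%:~R = 4 :> rat by []; lra.
have : z = 0 \/ z = 1 \/ z = -1 \/ z = 2 \/ z = -2.
  by move: z4; rewrite expr2; nia.
have half c : 2 * a = c -> a = c / 2 by move=> <-; field.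
rewrite !inE; case=> [z0|[z1|[z1|[z2|z2]]]].
- have a0 : a = 0 by rewrite (half _ ez) z0 mul0r.
  case: (@rat_sqr_notin (4 * b) 8) => //; rewrite a0 in e1; rewrite exprMn; lra.
- have a1 : a = 2^-1 by rewrite (half _ ez) z1 mul1r.
  case: (@rat_sqr_notin (8 * b) 24) => //; rewrite a1 in e1; rewrite exprMn; lra.
- have a1 : a = - 2^-1 by rewrite (half _ ez) z1 mulN1r.
  case: (@rat_sqr_notin (8 * b) 24) => //; rewrite a1 in e1; rewrite exprMn; lra.
- have a1 : a = 1 by rewrite (half _ ez) z2.
  have : b ^+ 2 = 0 by rewrite a1 in e1; lra.
  move=> /eqP; rewrite sqrf_eq0 => /eqP b0.
  by rewrite ey a1 b0 scale0r addr0 scale1r eqxx.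
- have a1 : a = -1 by rewrite (half _ ez) z2.
  have : b ^+ 2 = 0 by rewrite a1 in e1; lra.
  move=> /eqP; rewrite sqrf_eq0 => /eqP b0.
  by rewrite ey a1 b0 scale0r addr0 scaleN1r eqxx orbT.
Qed.

End Fields.

(** * The bounds on the constant, the cases of equality and the strict inequality *)

Section Final.
Variables (R : realType) (K : fieldExtType rat).
Local Notation w := (num_roots_of_unity K).

Lemma C_const_ge (c : R) : (forall C, admissible_constants K C -> c <= C) ->
  (c%:E <= C_const R K)%E.
Proof.
by move=> H; apply: le_ereal_inf_tmp => _ [C adm <-]; rewrite lee_fin; apply: H.
Qed.

Lemma C_const_le (c : R) : admissible_constants K c -> (C_const R K <= c%:E)%E.
Proof. by move=> adm; apply: ereal_inf_lbound; exists c. Qed.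

Lemma C_const_lower : ((w%:R / ln 2)%:E <= C_const R K)%E.
Proof.
have [th [sg [Oth cP inj surj]]] := embeddings_exist K R[i].
by apply: C_const_ge => C; apply: (C_lower Oth cP inj surj).
Qed.

Lemma C_const_upper :
  (C_const R K <= (w%:R / ln 2 + (\dim {:K})%:R / ln (M_const R K))%:E)%E.
Proof.
have [th [sg [Oth cP inj surj]]] := embeddings_exist K R[i].
exact: C_const_le (admissible_upper Oth cP inj surj).
Qed.

Lemma C_const_special :
  totally_real R K \/ is_Q_adjoin_sqrt K (-1) \/ is_Q_adjoin_sqrt K (-3) ->
  C_const R K = (w%:R / ln 2)%:E.
Proof.
have [th [sg [Oth cP inj surj]]] := embeddings_exist K R[i] => H.
apply/le_anti/andP; split; last exact: C_const_lower.
(* A lower bound [v] on the number of roots of unity is enough: it places [v / ln 2] below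
   [w / ln 2], and the opposite inequality on the constant is already known. *)
have adm v : (0 < v)%N -> (v <= w)%N -> (forall r, r != 0 -> 2 ^+ \dim {:K} <= A_elt sg v r) ->
    (C_const R K <= (w%:R / ln 2)%:E)%E.
  move=> v0 vw Av; apply: le_trans (C_const_le (admissible_A_elt Oth cP inj surj v0 Av)) _.
  by rewrite lee_fin ler_pM2r ?ler_nat // invr_gt0 ln2_gt0.
case: H => [tr|[[x xx gen]|[x xx gen]]].
- apply: (adm 2%N) => // [|r]; first exact: totally_real_unity Oth cP inj surj.
  exact: (totally_real_A_elt Oth cP inj (r := r) tr).
- have {}xx : x ^+ 2 = -1 by rewrite xx rmorphN1.
  apply: (adm 4%N) => // [|r].
    by apply: (gauss_unity Oth cP inj surj (i := x)).
  by apply: (gauss_A_elt Oth cP inj surj (i := x)).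
- have {}xx : x ^+ 2 = -3 by rewrite xx rmorphN.
  apply: (adm 6%N) => // [|r]; first by apply: (eisenstein_unity Oth cP inj surj (x := x)).
  by apply: (eisenstein_A_elt Oth cP inj surj (x := x)).
Qed.

Lemma C_const_sqrt2 (x : K) : x ^+ 2 = (-2)%:~R -> <<1; x>>%VS = {:K}%VS ->
  C_const R K <> (w%:R / ln 2)%:E.
Proof.
move=> xx gen; have [th [sg [Oth cP inj surj]]] := embeddings_exist K R[i].
have w2 : (w <= 2)%N.
  apply: (num_unity_le Oth cP inj surj (s := [:: 1; -1])) => y.
  exact: (sqrt2_unity sg xx gen).
pose F : {poly int} := 'X^6 - 3 *: 'X^2 + 2%:P.
have sF1 : (size (- (3 *: 'X^2) + 2%:P : {poly int})%R <= 6)%N.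
  apply: leq_trans (size_polyD _ _) _; rewrite geq_max size_polyN.
  apply/andP; split; first by apply: leq_trans (size_scale_leq _ _) _; rewrite size_polyXn.
  by apply: leq_trans (size_polyC_leq1 _) _.
have sF : size F = 7%N by rewrite /F -addrA size_polyDl size_polyXn.
have Fm : F \is monic.
  by apply/monicP; rewrite /F -addrA lead_coefDl ?lead_coefXn // size_polyXn.
have Fl n : \sum_(i < n) `|F`_i| <= 6%:Z.
  have one k : \sum_(i < n) (i == k :> nat)%:R <= 1 :> int.
    have [lt|ge] := ltnP k n.
      rewrite (bigD1 (Ordinal lt)) //= eqxx big1 ?addr0 // => i.
      by rewrite -val_eqE /= => /negbTE ->.
    by rewrite big1 // => i _; rewrite ltn_eqF // (leq_trans (ltn_ord i)).
  apply: (@le_trans _ _ (\sum_(i < n) ((i == 6%N :> nat)%:R + 3 * (i == 2%N :> nat)%:R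
      + 2 * (i == 0%N :> nat)%:R))).
    apply: ler_sum => i _; rewrite /F coefD coefB coefZ !coefXn coefC.
    by case: (i : nat) => [|[|[|[|[|[|[|k]]]]]]].
  rewrite !big_split /= -!mulr_sumr.
  pose le := lerD (lerD (one 6%N) (ler_wpM2l (ler0n _ 3) (one 2%N))).
  exact: le_trans (le _ _ (ler_wpM2l (ler0n _ 2) (one 0%N))) _.
have x0 : x != 0.
  apply/eqP => e; move: xx; rewrite e expr0n /= => /esym/eqP.
  by rewrite intK_eq0.
have splits : exists2 rs : seq K, 0 \notin rs &
    map_poly (intr : int -> K) F = \prod_(r <- rs) ('X - r%:P).
  exists [:: 1; 1; -1; -1; x; - x].
    by rewrite !inE ![0 == _]eq_sym !oppr_eq0 oner_eq0 (negbTE x0).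
  rewrite !big_cons big_nil /F rmorphD rmorphB /= map_polyZ /= map_polyXn map_polyC /= map_polyXn.
  rewrite !polyCN.
  have x2 : x%:P ^+ 2 = -2 :> {poly K}.
    have m2 : (-2 : int)%:~R = - 2%:R :> K by rewrite rmorphN.
    by rewrite -polyC_exp xx m2 polyCN polyC_natr.
  have -> : (2 : int)%:~R%:P = 2 :> {poly K} by rewrite -polyC_natr.
  rewrite -mul_polyC; have -> : (3 : int)%:~R%:P = 3 :> {poly K} by rewrite -polyC_natr.
  rewrite polyC1; set X := 'X; set a := x%:P in x2 *.
  have -> : (X - 1) * ((X - 1) * ((X - -1) * ((X - -1) * ((X - a) * ((X - - a) * 1))))) =
    (X ^+ 2 - 1) ^+ 2 * (X ^+ 2 - a ^+ 2) by ring.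
  by rewrite x2; ring.
have low : ((6%:R / ln 6%:R)%:E <= C_const R K)%E.
  apply: C_const_ge => C.
  by apply: (@admissible_lower R K th sg inj surj F 6 Fm Fl 6 C sF isT isT splits).
move=> eC; move: low; rewrite eC lee_fin => le.
have l2 := ln2_gt0 R.
have l6 : 0 < ln 6%:R :> R by rewrite ln_gt0 // ltr1n.
have {le} : 6%:R / ln 6%:R <= 2%:R / ln 2 :> R.
  by apply: le_trans le _; rewrite ler_pM2r ?invr_gt0 // ler_nat.
rewrite ler_pdivrMr // mulrAC ler_pdivlMr // => le.
(* This is [2^6 = 64 > 36 = 6^2]. *)
have : 6%:R * ln 2 > 2%:R * ln 6%:R :> R.
  rewrite !mulr_natl -!lnXn // ltr_ln ?posrE ?exprn_gt0 //.
  by rewrite -!natrX ltr_nat.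
by rewrite ltNge le.
Qed.

End Final.

Theorem theorem1p3 (R : realType) :
  (forall K : fieldExtType rat,
     let d : R := (\dim {:K})%:R in
     let w : R := (num_roots_of_unity K)%:R in
     (((w / ln 2)%:E <= C_const R K)%E /\
      (C_const R K <= (w / ln 2 + d / ln (M_const R K))%:E)%E) /\
     (totally_real R K \/ is_Q_adjoin_sqrt K (-1) \/ is_Q_adjoin_sqrt K (-3) ->
      C_const R K = (w / ln 2)%:E)) /\
  (exists K : fieldExtType rat,
     C_const R K <> ((num_roots_of_unity K)%:R / ln 2)%:E).
Proof.
split=> [K /=|].
  split; last exact: C_const_special.
  by split; [apply: C_const_lower | apply: C_const_upper].
(* Q(sqrt(-2)) is realized as the number field generated by a square root of -2 among the algebraic
   numbers. *)
have [K [emb [[|x []] // [ex] gen]]] := num_field_exists [:: sqrtC (-2)].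
rewrite adjoin_seq1 in gen; exists K; apply: (C_const_sqrt2 _ gen).
by apply: (fmorph_inj emb); rewrite rmorphXn ex sqrtCK rmorph_int rmorphN.
Qed.
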